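(* Let $n \ge 3$ and let $K$ be a smooth real-valued function on $\mathbb{R}^n$. Assume that $K$ is bounded between two positive constants outside a compact subset of $\mathbb{R}^n$. Assume also that there exist positive constants $r_o$, $c$ and $C$ such that $$\frac{\partial K}{\partial r}(r,\theta) \ge -C e^{-c\,r} \quad \text{for all } \theta \in S^{n-1} \text{ and } r \ge r_o .$$ Let $u$ be a positive smooth solution of $$\Delta u + K u^{\frac{n+2}{n-2}} = 0 \quad \text{in } \mathbb{R}^n .$$ If there exist positive constants $C'$ and $r'$ such that $$r \left| \frac{\partial u}{\partial r}(r,\theta) \right| \le C'\, u(r,\theta) \quad \text{for all } \theta \in S^{n-1} \text{ and } r \ge r',$$ then $u$ has slow decay, i.e. there exist positive constants $C_s$ and $r_s$ such that $u(x) \le C_s |x|^{-(n-2)/2}$ for all $|x| \ge r_s$.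
   Context: $\Delta$ is the standard Laplacian on $\mathbb{R}^n$. $(r,\theta)$ with $r>0$, $\theta \in S^{n-1}$ are the polar coordinates on $\mathbb{R}^n$, and $\partial/\partial r$ is the radial derivative. *)

(* Defs.v *)
From HB Require Import structures.
From mathcomp Require Export all_boot all_order all_algebra.
From mathcomp Require Export all_classical all_reals all_analysis.

Set Implicit Arguments.
Unset Strict Implicit.
Unset Printing Implicit Defensive.

Import Order.TTheory GRing.Theory Num.Theory.
Import numFieldNormedType.Exports.

Local Open Scope classical_set_scope.
Local Open Scope ring_scope.

(* The library norm `|x| on 'rV[R]_n is the sup norm; it induces the usual
   topology, but lengths, and hence polar coordinates, need the Euclidean one. *)
Definition enorm (R : realType) (n : nat) (x : 'rV[R]_n) : R :=
  Num.sqrt (\sum_(i < n) x 0 i ^+ 2).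

Definition unit_sphere (R : realType) (n : nat) : set 'rV[R]_n :=
  [set theta | enorm theta = 1].

Definition partial (R : realType) (n : nat) (i : 'I_n) (f : 'rV[R]_n -> R) :
    'rV[R]_n -> R :=
  'D_(delta_mx 0 i) f.

(* C^oo: every iterated partial derivative exists everywhere and is continuous.
   'D is total, with a junk value where the limit does not exist, so existence
   is required separately. *)
Definition smooth (R : realType) (n : nat) (f : 'rV[R]_n -> R) : Prop :=
  forall s : seq 'I_n,
    let g := foldr (@partial R n) f s in
    continuous g /\ forall (i : 'I_n) (x : 'rV[R]_n), derivable g x (delta_mx 0 i).

Definition laplacian (R : realType) (n : nat) (f : 'rV[R]_n -> R) :
    'rV[R]_n -> R :=
  fun x => \sum_(i < n) partial i (partial i f) x.

(* (df/dr)(r, theta), the point with polar coordinates (r, theta) being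
   r *: theta. *)
Definition radial_derivative (R : realType) (n : nat) (f : 'rV[R]_n -> R)
    (r : R) (theta : 'rV[R]_n) : R :=
  derive1 (fun s : R => f (s *: theta)) r.

Definition slow_decay (R : realType) (n : nat) (u : 'rV[R]_n -> R) : Prop :=
  exists Cs rs : R, 0 < Cs /\ 0 < rs /\
    forall x : 'rV[R]_n, rs <= enorm x ->
      u x <= Cs * enorm x `^ (- ((n%:R - 2) / 2)).

(* Main.v *)
Require Import Defs.
From mathcomp Require Import ring lra.
Import Order.TTheory GRing.Theory Num.Theory.
Import numFieldNormedType.Exports.
Local Open Scope classical_set_scope.
Local Open Scope ring_scope.

(** Let q = 2n/(n-2).  Multiplying the equation by (n-2)/2 u + x.grad u and by u, with radial
    cutoffs, gives the Pohozaev and the energy identity.  Eliminating the gradient between the two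
    leaves (1/n) int K u^q over an annulus |x| ~ r, up to terms in u^2 / r^2 (the radial derivative
    of u is at most C' u / r) and up to int (x.grad K) u^q, which is bounded below because u grows
    at most polynomially while x.grad K >= - C |x| e^(-c|x|).  Hence int u^q over dyadic annuli is
    bounded independently of r.  Since u^q changes by bounded factors along rays, a shell of
    thickness s carries at most O(s/r) of that energy.  If r^((n-2)/2) u were unbounded, then around
    suitable points of nearly maximal u a ball of radius s << r would carry energy bounded below, by
    the mean value inequality for the rescaled equation: a contradiction. *)

Set Implicit Arguments.
Unset Strict Implicit.
Unset Printing Implicit Defensive.

(** * An integral for continuous functions of compact support *)

(** The bounds on K and on the radial derivative of u hold only far out. The Pohozaev cutoff
    therefore equals 1 on the whole inner ball: there only (x.grad K) u^q contributes, and every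
    other term carries the derivative of the cutoff, supported in the annulus. In the annulus u^q
    and u^2 / r^2 scale alike, so the u^2 terms can be absorbed by Young's inequality, provided that
    the cutoff factors are matching powers. Surface integrals and changes of variables are avoided.
    An integral is any positive linear functional that vanishes on derivatives, used with crude
    volume bounds on cubes; such functionals can be dilated without a Jacobian, and an arctangent
    weight replaces integration in polar coordinates. No regularity theory is needed at the end:
    choosing the point by a maximum bounds u on a ball by a multiple of its value at the centre,
    hence bounds the Laplacian there, and the mean value inequality becomes elementary. *)

Section SupNorm.
Context {R : realType} {n : nat}.
Implicit Types (x y : 'rV[R]_n).

Lemma coord_le_norm x i : `|x 0 i| <= `|x|.
Proof.
rewrite [leRHS]/Num.norm /= mx_normrE; apply/bigmax_geP; right => /=.
by exists (0, i).
Qed.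

Lemma norm_rV_le x h : 0 <= h -> (forall i, `|x 0 i| <= h) -> `|x| <= h.
Proof.
move=> h0 H; rewrite [leLHS]/Num.norm /= mx_normrE; apply/bigmax_leP; split => //=.
by move=> [a i] _ /=; rewrite ord1.
Qed.

Lemma continuous_dist a : continuous (fun x : 'rV[R]_n => `|x - a|).
Proof.
move=> x; apply: (@cvg_norm _ _ _ (nbhs x) _ (fun x => x - a)).
by apply: cvgB; [exact: cvg_id|exact: cvg_cst].
Qed.

Lemma compact_cube (a : 'rV[R]_n) L : compact [set x : 'rV[R]_n | `|x - a| <= L].
Proof.
apply: bounded_closed_compact.
  exists (L + `|a|); split; first exact: num_real.
  move=> M hM x /= hx; rewrite -(subrK a x).
  apply: (le_trans (ler_normD _ _)); apply: le_trans (ltW hM).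
  by rewrite lerD2r.
have -> : [set x : 'rV[R]_n | `|x - a| <= L] =
   (fun x : 'rV[R]_n => `|x - a|) @^-1` [set t | t <= L] by [].
apply: preimage_closed; last exact: closed_le.
by move=> x _; exact: continuous_dist.
Qed.

Lemma continuous_bounded_cube (f : 'rV[R]_n -> R) L : continuous f ->
  exists2 M, 0 < M & forall x, `|x| <= L -> `|f x| <= M.
Proof.
move=> cf; have [L0|L0] := leP 0 L; last first.
  by exists 1 => // x hx; have := le_lt_trans (le_trans (normr_ge0 _) hx) L0; rewrite ltxx.
have cK := @compact_cube 0 L.
have [c _ hc] : exists2 c, c \in [set x : 'rV[R]_n | `|x - 0| <= L] &
    forall t, t \in [set x : 'rV[R]_n | `|x - 0| <= L] -> `|f t| <= `|f c|.
  apply: (@compact_EVT_max _ _ (fun x => `|f x|) _ _ cK).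
    by exists 0 => /=; rewrite subr0 normr0.
  apply: continuous_subspaceT => x; apply: continuous_comp; first exact: cf.
  exact: norm_continuous.
exists (`|f c| + 1); first by rewrite ltr_wpDl.
move=> x hx; apply: (le_trans (hc x _)); last by rewrite lerDl.
by rewrite inE /= subr0.
Qed.

Lemma continuous_epsdelta (f : 'rV[R]_n -> R) x (e : R) : continuous f -> 0 < e ->
  exists2 d, 0 < d & forall y, `|y - x| < d -> `|f y - f x| < e.
Proof.
move=> cf e0; have /cvgrPdistC_lt/(_ e e0) := cf x.
move=> /nbhs_ballP[d /= d0 hd]; exists d => // y hy; apply: hd.
by rewrite mx_norm_ball /ball_ /= distrC.
Qed.

(** The increment may leave the cube, as happens for shifted grid points. Compactness enters as a
    near-covering property: near each point the estimate holds for all close points and all small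
    increments at once. *)
Lemma unif_continuous_cube (f : 'rV[R]_n -> R) L (e : R) : continuous f -> 0 < e ->
  exists2 d, 0 < d & forall x h, `|x| <= L -> `|h| < d -> `|f (x + h) - f x| < e.
Proof.
move=> cf e0.
have cK := @compact_cube 0 L.
have := (compact_near_coveringP _).1 cK _ (nbhs (0 : 'rV[R]_n))
   (fun h x => `|f (x + h) - f x| < e) _.
have H : forall x, [set x : 'rV[R]_n | `|x - 0| <= L] x ->
   \forall x' \near x & h \near (0 : 'rV[R]_n), `|f (x' + h) - f x'| < e.
  move=> x _.
  have e2 : 0 < e / 2 by rewrite divr_gt0.
  have [d d0 hd] := continuous_epsdelta x cf e2.
  have d2 : 0 < d / 2 by rewrite divr_gt0.
  exists (ball x (d / 2), ball (0 : 'rV[R]_n) (d / 2)).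
    by split; exact: nbhsx_ballx.
  move=> [y h] /= []; rewrite mx_norm_ball /ball_ /= sub0r normrN distrC => hy hh.
  have A : `|f y - f x| < e / 2.
    by apply: hd; rewrite (lt_trans hy)// ltr_pdivrMr// ltr_pMr// ltr1n.
  have B : `|f (y + h) - f x| < e / 2.
    apply: hd; rewrite addrAC (le_lt_trans (ler_normD _ _))//.
    by rewrite [d]splitr ltrD.
  rewrite [ltLHS](_ : _ = `|(f (y + h) - f x) - (f y - f x)|); last by congr `|_|; ring.
  by rewrite (le_lt_trans (ler_normB _ _))// [e]splitr ltrD.
move=> /(_ _ H) /nbhs_ballP[d /= d0 hd]; exists d => // x h hx hh.
apply: (hd h); last by rewrite /= subr0.
by rewrite mx_norm_ball /ball_ /= sub0r normrN.
Qed.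
End SupNorm.

(** * Riemann sums on finite grids *)

Section RiemannSums.
Context {R : realType} {n : nat}.
Implicit Types (x y : 'rV[R]_n) (m : nat).

(** Nodes of mesh 1/m from -m to m: a single parameter refines the mesh and exhausts the line. *)
Definition node m (k : nat) : R := (k%:R - (m * m)%:R) / m%:R.

Definition grid_size m := (m * m).*2.+1.

Definition grid m (k : {ffun 'I_n -> 'I_(grid_size m)}) : 'rV[R]_n :=
  \row_i node m (k i).

#[local] Arguments grid : clear implicits.

Definition riemann_sum m (f : 'rV[R]_n -> R) : R := m%:R ^- n * \sum_k f (grid m k).

Lemma node_step m k : node m k.+1 - node m k = m%:R^-1.
Proof. by rewrite /node -[k.+1]addn1 natrD; ring. Qed.

Lemma node0 m : (0 < m)%N -> node m 0 = - m%:R.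
Proof.
move=> m0; have : m%:R != 0 :> R by rewrite pnatr_eq0 -lt0n.
by move=> h; rewrite /node natrM; field.
Qed.

Lemma node_end m : (0 < m)%N -> node m (grid_size m) = m%:R + m%:R^-1.
Proof.
move=> m0; have : m%:R != 0 :> R by rewrite pnatr_eq0 -lt0n.
by move=> h; rewrite /node /grid_size -addnn mulrSr !natrD !natrM; field.
Qed.

Lemma sum_node_incr m (F : R -> R) :
  \sum_(k < grid_size m) (F (node m k.+1) - F (node m k)) =
  F (node m (grid_size m)) - F (node m 0).
Proof. by rewrite -(telescope_sumr (fun k => F (node m k)) (leq0n _)) big_mkord. Qed.

(** Its increments over consecutive nodes telescope to b - a once the nodes reach past both ends;
    this counts the nodes in an interval. *)
Definition clamp (a b t : R) := Num.min (Num.max a t) b.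

Lemma clamp_id a b t : a <= t <= b -> clamp a b t = t.
Proof. by move=> /andP[ha hb]; rewrite /clamp max_r // min_l. Qed.

Lemma clamp_itv a b t : a <= b -> a <= clamp a b t <= b.
Proof. by move=> ab; rewrite /clamp le_min le_max lexx ab /= ge_min lexx orbT. Qed.

Lemma clamp_left a b t : a <= b -> t <= a -> clamp a b t = a.
Proof. by move=> ab ta; rewrite /clamp max_l // min_l. Qed.

Lemma clamp_right a b t : a <= b -> b <= t -> clamp a b t = b.
Proof. by move=> ab bt; rewrite /clamp max_r ?min_r // (le_trans ab). Qed.

Lemma clamp_homo a b s t : s <= t -> clamp a b s <= clamp a b t.
Proof.
move=> st; rewrite /clamp !maxEle.
case: (leP a s) => ?; case: (leP a t) => ?; rewrite !minEle;
  case: (leP s b) => ?; case: (leP t b) => ?; case: (leP a b) => ?; lra.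
Qed.

Lemma clamp_lip a b s t : a <= b -> s <= t -> clamp a b t - clamp a b s <= t - s.
Proof.
move=> ab st; rewrite /clamp !maxEle.
case: (leP a s) => ?; case: (leP a t) => ?; rewrite !minEle;
  case: (leP s b) => ?; case: (leP t b) => ?; case: (leP a b) => ?; lra.
Qed.

(** A node in [-L, L] and its right neighbour both lie in [-L, L + 1/m], so it contributes a full
    mesh 1/m to a telescoping sum that is at most 2 L + 1/m. *)
Lemma node_count_upper m L : (0 < m)%N -> 1 <= L ->
  m%:R^-1 * \sum_(k < grid_size m) (`|node m k| <= L)%R%:R <= 4 * L.
Proof.
move=> m0 L1.
have mV : 0 < m%:R^-1 :> R by rewrite invr_gt0 ltr0n.
have mV1 : m%:R^-1 <= 1 :> R by rewrite invf_le1 ?ltr0n // ler1n.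
have ab : - L <= L + m%:R^-1 by lra.
have := sum_node_incr m (clamp (- L) (L + m%:R^-1)).
have := clamp_itv (node m (grid_size m)) ab.
have := clamp_itv (node m 0) ab.
move=> /andP[h1 h2] /andP[h3 h4] h.
apply: (@le_trans _ _ (\sum_(k < grid_size m)
  (clamp (- L) (L + m%:R^-1) (node m k.+1) - clamp (- L) (L + m%:R^-1) (node m k)))); last lra.
rewrite mulr_sumr; apply: ler_sum => k _.
have st := node_step m k.
have [hk|_] := boolP (`|node m k| <= L); last by rewrite mulr0 subr_ge0 clamp_homo //; lra.
move: hk; rewrite ler_norml => /andP[ha hb].
by rewrite mulr1 !clamp_id; [lra|apply/andP; split; lra|apply/andP; split; lra].
Qed.

(** The increments of the truncation to [a - h/2, a + h/2] add up to h. The mesh is at most h/2, so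
    only nodes within h of a contribute, each at most 1/m. *)
Lemma node_count_lower m a h : 0 < h -> 2 / h <= m%:R -> `|a| + h <= m%:R ->
  h <= m%:R^-1 * \sum_(k < grid_size m) (`|node m k - a| <= h)%R%:R.
Proof.
move=> h0 hm am.
have m0 : 0 < m%:R :> R by apply: lt_le_trans hm; rewrite divr_gt0.
have m0' : (0 < m)%N by rewrite -(ltr0n R).
have mV : 0 < m%:R^-1 :> R by rewrite invr_gt0.
have mh : m%:R^-1 <= h / 2.
  by rewrite -[h / 2]invrK invf_div lef_pV2 // posrE divr_gt0.
have ab : a - h / 2 <= a + h / 2 by lra.
have := sum_node_incr m (clamp (a - h / 2) (a + h / 2)).
move: am; rewrite addrC -lerBrDl ler_norml => /andP[a1 a2].
rewrite (clamp_right ab) ?node_end //; last lra.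
rewrite (clamp_left ab) ?node0 //; last lra.
move=> e; have {}e : \sum_(k < grid_size m) (clamp (a - h / 2) (a + h / 2) (node m k.+1) -
       clamp (a - h / 2) (a + h / 2) (node m k)) = h by rewrite e; lra.
rewrite -[leLHS]e mulr_sumr; apply: ler_sum => k _.
have st := node_step m k.
have [hk|] := boolP (`|node m k - a| <= h); rewrite ?mulr1 ?mulr0.
  by apply: le_trans (clamp_lip ab _) _; lra.
rewrite -ltNge ltr_normr => /orP[hk|hk].
  by rewrite !(clamp_right ab) ?subrr //; lra.
by rewrite !(clamp_left ab) ?subrr //; lra.
Qed.

(** The indicator of a product set is a product of indicators, and distributivity reduces the count
    of nodes to one dimension. *)
Lemma sum_grid_cube m (P : 'I_n -> R -> bool) :
  m%:R ^- n * \sum_k ([forall i, P i (grid m k 0 i)])%:R =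
  \prod_(i < n) (m%:R^-1 * \sum_(k < grid_size m) (P i (node m k))%:R) :> R.
Proof.
rewrite big_split /= prodr_const card_ord exprVn bigA_distr_bigA /=; congr (_ * _).
apply: eq_bigr => k _.
under eq_forallb => i do rewrite mxE.
have [/forallP h|/forallPn[i /negbTE h]] := boolP [forall i, P i (node m (k i))].
  by rewrite big1 // => i _; rewrite h.
by rewrite (bigD1 i) //= h mul0r.
Qed.

Lemma riemann_sum_le m f g : (forall x, f x <= g x) ->
  riemann_sum m f <= riemann_sum m g.
Proof.
move=> fg; rewrite /riemann_sum ler_wpM2l ?invr_ge0 ?exprn_ge0 //.
by apply: ler_sum.
Qed.

Lemma riemann_sum_lin m a f g :
  riemann_sum m (fun x => a * f x + g x) = a * riemann_sum m f + riemann_sum m g.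
Proof. by rewrite /riemann_sum big_split /= -mulr_sumr; ring. Qed.

Lemma riemann_sum_upper m f B L : (0 < m)%N -> 1 <= L -> 0 <= B ->
  (forall x, f x <= B) -> (forall x, L <= `|x| -> f x = 0) ->
  riemann_sum m f <= B * (4 * L) ^+ n.
Proof.
move=> m0 L1 B0 fB f0.
apply: (@le_trans _ _ (B * (m%:R ^- n *
    \sum_k ([forall i, `|(grid m k) 0 i| <= L]%R)%:R))).
  rewrite /riemann_sum mulrCA ler_wpM2l ?invr_ge0 ?exprn_ge0 // mulr_sumr ler_sum // => k _.
  have [h|h] := boolP [forall i, `|grid m k 0 i| <= L]; first by rewrite mulr1.
  rewrite mulr0 f0 //; move: h => /forallPn[i]; rewrite -ltNge => /ltW h.
  by apply: (le_trans h); apply: coord_le_norm.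
rewrite ler_wpM2l // (sum_grid_cube m (fun i t => `|t| <= L)) prodr_const card_ord.
rewrite lerXn2r ?nnegrE ?mulr_ge0 ?invr_ge0 ?ler0n ?sumr_ge0 //; last exact: node_count_upper.
by rewrite (le_trans _ L1).
Qed.

Lemma riemann_sum_lower m f b a h : 0 < h -> 2 / h <= m%:R -> `|a| + h <= m%:R ->
  0 <= b -> (forall x, 0 <= f x) -> (forall x, `|x - a| <= h -> b <= f x) ->
  b * h ^+ n <= riemann_sum m f.
Proof.
move=> h0 mh am b0 f0 fb.
apply: (@le_trans _ _ (b * (m%:R ^- n *
    \sum_k ([forall i, `|(grid m k) 0 i - a 0 i| <= h]%R)%:R))); last first.
  rewrite /riemann_sum mulrCA ler_wpM2l ?invr_ge0 ?exprn_ge0 // mulr_sumr ler_sum // => k _.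
  have [/forallP H|H] := boolP [forall i, `|grid m k 0 i - a 0 i| <= h]; last by rewrite mulr0.
  rewrite mulr1 fb //; apply: norm_rV_le; first exact: ltW.
  by move=> i; have := H i; rewrite !mxE.
rewrite ler_wpM2l // (sum_grid_cube m (fun i t => `|t - a 0 i| <= h)).
rewrite -[in leLHS](card_ord n) -prodr_const ler_prod // => i _.
rewrite ltW //= node_count_lower // (le_trans _ am) // lerD2r; exact: coord_le_norm.
Qed.

(* The cyclic shift of the i-th index permutes the grid; the nodes where it differs from the
   translation by one mesh width lie outside the support of [f]. *)
Lemma riemann_sum_shift m i f L : (0 < m)%N -> L <= m%:R ->
  (forall x, L <= `|x| -> f x = 0) ->
  riemann_sum m (fun x => f (x + m%:R^-1 *: delta_mx 0 i)) = riemann_sum m f.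
Proof.
move=> m0 Lm f0; rewrite /riemann_sum; congr (_ * _).
pose sg (k : {ffun 'I_n -> 'I_(grid_size m)}) :=
  [ffun j => if j == i then ordS (k j) else k j].
pose sg' (k : {ffun 'I_n -> 'I_(grid_size m)}) :=
  [ffun j => if j == i then ord_pred (k j) else k j].
have sgK : cancel sg sg'.
  by move=> k; apply/ffunP => j; rewrite !ffunE; case: eqP => // _; rewrite ordSK.
have sgK' : cancel sg' sg.
  by move=> k; apply/ffunP => j; rewrite !ffunE; case: eqP => // _; rewrite ord_predK.
rewrite [RHS](reindex sg) /=; last by exists sg' => ? _; [exact: sgK|exact: sgK'].
apply: eq_bigr => k _.
have [ki|ki] := eqVneq (k i).+1 (grid_size m).
  rewrite !f0 //; apply: (le_trans Lm).
    apply: le_trans (coord_le_norm _ i); rewrite mxE ffunE eqxx /= ki modnn node0 //.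
    by rewrite normrN ger0_norm.
  apply: le_trans (coord_le_norm _ i); rewrite !mxE !eqxx /= mulr1 -(node_step m (k i)).
  by rewrite addrC subrK ki node_end // ger0_norm ?lerDl ?addr_ge0 ?invr_ge0.
congr f; apply/rowP => j; rewrite !mxE ffunE eqxx /=.
case: (eqVneq j i) => [->|_]; last by rewrite mulr0 addr0.
rewrite mulr1 -(node_step m (k i)) addrC subrK /= modn_small //.
by rewrite ltn_neqAle ki ltn_ord.
Qed.

End RiemannSums.

(** * Derivatives along lines and discrete integration by parts *)

Section Lines.
Context {R : realType} {V : normedModType R}.
Implicit Types (F : V -> R) (x v : V).

(** Reduces derivatives along v to derivatives of functions of one real variable, to which the mean
    value theorem and the chain rule apply. *)
Lemma growth_rate_line F x v t :
  (fun h : R => h^-1 *: ((F \o shift (x + t *: v)) (h *: v) - F (x + t *: v))) =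
  (fun h : R => h^-1 *: (((fun s => F (x + s *: v)) \o shift t) (h *: (1 : R)) - F (x + t *: v))).
Proof.
apply/funext => h /=; congr (_ *: (F _ - _)).
by rewrite scalerDl [h *: 1]mulr1 addrCA.
Qed.

Lemma is_derive_line F x v t d :
  is_derive (x + t *: v) v F d -> is_derive t (1 : R) (fun s => F (x + s *: v)) d.
Proof.
move=> [h1 h2]; split; first by rewrite /derivable -growth_rate_line.
by rewrite -h2 /derive -growth_rate_line.
Qed.

Lemma is_derive_line0 F x v d :
  is_derive (0 : R) (1 : R) (fun s => F (x + s *: v)) d -> is_derive x v F d.
Proof.
move=> [h1 h2]; have := @growth_rate_line F x v 0; rewrite scale0r addr0 => e.
split; first by rewrite /derivable e; move: h1; rewrite /derivable scale0r addr0.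
by rewrite -h2 /derive e scale0r addr0.
Qed.

Lemma MVT_line F dF x v a b : a < b ->
  (forall t, a <= t <= b -> is_derive (x + t *: v) v F (dF (x + t *: v))) ->
  exists2 c, a < c < b & F (x + b *: v) - F (x + a *: v) = dF (x + c *: v) * (b - a).
Proof.
move=> ab dF'.
have D t : a <= t <= b -> is_derive t (1 : R) (fun s => F (x + s *: v)) (dF (x + t *: v)).
  by move=> /dF'; exact: is_derive_line.
have D1 t : t \in `]a, b[ -> is_derive t (1 : R) (fun s => F (x + s *: v)) (dF (x + t *: v)).
  by rewrite in_itv /= => /andP[h1 h2]; apply: D; rewrite !ltW.
have cF : {within `[a, b], continuous (fun s => F (x + s *: v))}.
  apply: derivable_within_continuous => t; rewrite in_itv /= => tab.
  by have [] := D t tab.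
have [c cab h] := MVT ab D1 cF; by exists c.
Qed.

Lemma derive_eq0_near F x v d : is_derive x v F d ->
  (\forall y \near x, F y = 0) -> d = 0.
Proof.
move=> dF F0; have -> : d = 'D_v F x by rewrite derive_val.
by rewrite (@near_eq_derive _ _ _ F (cst 0)) // derive_cst.
Qed.
End Lines.

Section Functional.
Context {R : realType} {n : nat}.
Implicit Types (f g : 'rV[R]_n -> R).

Definition bounded_support f := exists L, forall x, L <= `|x| -> f x = 0.

Lemma derive_support (F dF : 'rV[R]_n -> R) v L :
  (forall x, L <= `|x| -> F x = 0) -> (forall x, is_derive x v F (dF x)) ->
  forall x, L < `|x| -> dF x = 0.
Proof.
move=> F0 D x hx; apply: derive_eq0_near (D x) _.
apply/nbhs_ballP; exists (`|x| - L) => /=; first by rewrite subr_gt0.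
move=> y; rewrite mx_norm_ball /ball_ /= => h; apply: F0.
by have := ler_normD (x - y) y; rewrite subrK; lra.
Qed.

(** Discrete integration by parts: the Riemann sum of the forward difference quotient of F vanishes
    because the grid sum is invariant under a shift by one mesh, and by uniform continuity [dF]
    differs from this quotient by a uniformly small function supported in a fixed cube. *)
Lemma cvg_riemann_sum_derive i (F dF : 'rV[R]_n -> R) :
  bounded_support F -> continuous dF ->
  (forall x, is_derive x (delta_mx 0 i) F (dF x)) ->
  riemann_sum m dF @[m --> \oo] --> (0 : R).
Proof.
move=> [L0 F00] cdF D; pose L := Num.max 1 L0.
have L1 : 1 <= L by rewrite le_max lexx.
have F0 x : L <= `|x| -> F x = 0.
  by move=> h; apply: F00; apply: le_trans h; rewrite le_max lexx orbT.
have dF0 := derive_support F0 D.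
apply/cvgr0Pnorm_lt => e e0.
(* Volume bound for the cube |x| <= L + 2, outside of which the error [g] below vanishes. *)
pose C := (4 * (L + 2)) ^+ n.
have C0 : 0 < C by rewrite exprn_gt0 //; lra.
have e'0 : 0 < e / 2 / C by rewrite !divr_gt0.
have [d d0 hd] := unif_continuous_cube (L + 2) cdF e'0.
near=> m.
have Lm : L + 3 <= m%:R by near: m; exact: nbhs_infty_ger.
have dm : d^-1 < m%:R by near: m; exact: nbhs_infty_gtr.
have m0' : 0 < m%:R :> R by lra.
have m0 : (0 < m)%N by rewrite -(ltr0n R).
have mV : 0 < m%:R^-1 :> R by rewrite invr_gt0.
have mVd : m%:R^-1 < d by rewrite invf_plt ?posrE.
have mV1 : m%:R^-1 <= 1 :> R by rewrite invf_le1 ?ler1n.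
pose v : 'rV[R]_n := delta_mx 0 i.
have nv : `|v| <= 1.
  apply: norm_rV_le => // j; rewrite mxE eqxx /=.
  by case: eqP => _; rewrite ?normr1 ?normr0.
pose g x := dF x - m%:R * (F (x + m%:R^-1 *: v) - F x).
have Sg : riemann_sum m g = riemann_sum m dF.
  have -> : g = fun x => (- m%:R) * F (x + m%:R^-1 *: v) + (m%:R * F x + dF x).
    by apply/funext => x; rewrite /g; ring.
  rewrite riemann_sum_lin riemann_sum_lin (@riemann_sum_shift _ _ m i F L) //; last lra.
  by ring.
have small c x : 0 <= c <= m%:R^-1 -> `|x| - 1 <= `|x + c *: v|.
  move=> /andP[c0 c1]; have := ler_normB (x + c *: v) (c *: v).
  rewrite addrK => h; rewrite lerBlDr; apply: (le_trans h); rewrite lerD2l.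
  by rewrite normrZ ger0_norm // -[1]mulr1 ler_pM // (le_trans c1).
have g0 x : L + 2 <= `|x| -> g x = 0.
  move=> hx; have h : `|x| - 1 <= `|x + m%:R^-1 *: v| by apply: small; rewrite lexx ltW.
  rewrite /g dF0 ?F0 ?subrr ?mulr0 ?subr0 //; lra.
have gle x : `|g x| <= e / 2 / C.
  have [hx|hx] := leP (L + 2) `|x|; first by rewrite g0 // normr0 ltW.
  have [c cm hc] := @MVT_line _ _ F dF x v _ _ mV (fun t _ => D _).
  move: hc; rewrite scale0r addr0 subr0 => hc; move/andP: cm => [c0 c1].
  have -> : g x = - (dF (x + c *: v) - dF x).
    by rewrite /g hc mulrCA mulfV ?gt_eqF // mulr1 opprB.
  rewrite normrN ltW // hd ?ltW //.
  rewrite normrZ ger0_norm ?ltW // (le_lt_trans (ler_piMr _ nv)) ?ltW //.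
  exact: lt_trans mVd.
have A : riemann_sum m g <= (e / 2 / C) * C.
  apply: riemann_sum_upper => //; [lra|exact: ltW|].
  by move=> x; exact: le_trans (ler_norm _) (gle x).
have B : riemann_sum m (fun x => - g x) <= (e / 2 / C) * C.
  apply: riemann_sum_upper => //; [lra|exact: ltW| |].
    by move=> x; rewrite (le_trans (ler_norm _)) // normrN gle.
  by move=> x /g0 ->; rewrite oppr0.
have {}B : - riemann_sum m g <= (e / 2 / C) * C.
  apply: le_trans B; rewrite -[leRHS]/(riemann_sum m (fun x => - g x)).
  by rewrite /riemann_sum sumrN mulrN.
rewrite divfK ?gt_eqF // in A B; rewrite -Sg ltr_norml; apply/andP; split; lra.
Unshelve. all: end_near.
Qed.

End Functional.

(** Compactness gives a cluster point l. An ultrafilter contains the preimage of each neighbourhood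
    of l or the complement of it, and the latter is impossible at a cluster point. *)
Lemma ultra_bounded_cvg (R : realType) (U : set_system nat) (a : nat -> R) (M : R) :
  UltraFilter U -> (\forall k \near U, `|a k| <= M) -> exists l : R, a k @[k --> U] --> l.
Proof.
move=> UU aM.
have /(_ (a k @[k --> U]) _ _) := @segment_compact R (- M) M.
case; first by apply: filterS aM => k; rewrite /= in_itv /= ler_norml.
move=> l [_ cl]; exists l => A /= Al.
have [//|UA] := in_ultra_setVsetC (a @^-1` A) UU.
have [x [nA Ax]] := cl (~` A) A UA Al.
by [].
Qed.

Section Integral.
Context {R : realType} {n : nat}.
Implicit Types (f g F dF : 'rV[R]_n -> R) (I : ('rV[R]_n -> R) -> R).

Definition test_function f := continuous f /\ bounded_support f.

(* Positive functionals killing all derivatives: this is all that is used of the integral. *)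
Definition is_integral I :=
  [/\ forall (a : R) f g, test_function f -> test_function g ->
        I (fun x => a * f x + g x) = a * I f + I g,
      forall f g, test_function f -> test_function g ->
        (forall x, f x <= g x) -> I f <= I g &
      forall i F dF, bounded_support F -> continuous dF ->
        (forall x, is_derive x (delta_mx 0 i) F (dF x)) -> I dF = 0].

Lemma test_function_bounded f : test_function f ->
  exists2 M, 0 < M & forall x, `|f x| <= M.
Proof.
move=> [cf [L f0]]; have [M M0 hM] := continuous_bounded_cube L cf.
exists M => // x; have [/f0 ->|/ltW/hM//] := leP L `|x|.
by rewrite normr0 ltW.
Qed.

(* Limit of Riemann sums along an ultrafilter, so that convergence need not be proved. *)
Lemma integral_exists : exists I, [/\ is_integral I,
  (forall f B L, test_function f -> 1 <= L -> 0 <= B -> (forall x, f x <= B) ->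
    (forall x, L <= `|x| -> f x = 0) -> I f <= B * (4 * L) ^+ n) &
  (forall f b a h, test_function f -> 0 < h -> 0 <= b -> (forall x, 0 <= f x) ->
    (forall x, `|x - a| <= h -> b <= f x) -> b * h ^+ n <= I f)].
Proof.
have [U [UU ooU]] := @ultraFilterLemma nat \oo _.
have UP := @ultra_proper _ _ UU.
pose I f : R := lim (riemann_sum m f @[m --> U]).
have cvgI f : test_function f -> riemann_sum m f @[m --> U] --> I f.
  move=> tf; apply/cvg_ex.
  have [M M0 hM] := test_function_bounded tf.
  have [cf [L0 f00]] := tf; pose L := Num.max 1 L0.
  have L1 : 1 <= L by rewrite le_max lexx.
  have f0 x : L <= `|x| -> f x = 0.
    by move=> h; apply: f00; apply: le_trans h; rewrite le_max lexx orbT.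
  have [] := @ultra_bounded_cvg R U (riemann_sum ^~ f) (M * (4 * L) ^+ n) UU; last first.
    by move=> l hl; exists l.
  apply: ooU; exists 1%N => // m /= m0; rewrite ler_norml; apply/andP; split; last first.
    apply: riemann_sum_upper => //; [exact: ltW|].
    by move=> x; exact: le_trans (ler_norm _) (hM x).
  have : riemann_sum m (fun x => - f x) <= M * (4 * L) ^+ n.
    apply: riemann_sum_upper => //; [exact: ltW| |by move=> x /f0 ->; rewrite oppr0].
    by move=> x; rewrite (le_trans (ler_norm _)) // normrN hM.
  by rewrite /riemann_sum sumrN mulrN lerNl.
exists I; split; first split.
- move=> a f g tf tg.
  have h : riemann_sum m (fun x => a * f x + g x) @[m --> U] --> a * I f + I g.
    under eq_fun do rewrite riemann_sum_lin.
    by apply: cvgD; [apply: cvgMr; exact: cvgI|exact: cvgI].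
  exact: cvg_lim h.
- move=> f g tf tg fg.
  by apply: ler_cvg_to (cvgI _ tf) (cvgI _ tg) _; apply: nearW => m; exact: riemann_sum_le.
- move=> i F dF sF cdF D; apply: cvg_lim => //.
  have h := cvg_riemann_sum_derive sF cdF D.
  by move=> A hA; apply: ooU; exact: h.
- move=> f B L tf L1 B0 fB f0.
  apply: cvgr_to_le (cvgI _ tf) _; apply: ooU; exists 1%N => // m /= m0.
  exact: riemann_sum_upper.
- move=> f b a h tf h0 b0 f0 fb.
  apply: cvgr_to_ge (cvgI _ tf) _; apply: ooU.
  near=> m; apply: (@riemann_sum_lower _ _ _ _ _ a) => //.
  + by near: m; exact: nbhs_infty_ger.
  + by near: m; exact: nbhs_infty_ger.
Unshelve. all: end_near.
Qed.
End Integral.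

(** * Differential calculus *)

Section Rules.
Context {R : realType} {V : normedModType R}.
Implicit Types (f g : V -> R) (x v : V).

Lemma cvg_is_derive f x v d :
  h^-1 *: (f (h *: v + x) - f x) @[h --> (0 : R)^'] --> d -> is_derive x v f d.
Proof. by move=> h; split; [apply/cvg_ex; exists d|exact: cvg_lim]. Qed.

Lemma is_derive_cvg f x v d : is_derive x v f d ->
  h^-1 *: (f (h *: v + x) - f x) @[h --> (0 : R)^'] --> d.
Proof. by move=> [/cvg_ex[l h] <-]; rewrite /derive (cvg_lim _ h). Qed.

Lemma derE f x v a b : is_derive x v f a -> a = b -> is_derive x v f b.
Proof. by move=> ? <-. Qed.

Lemma derD f g x v a b : is_derive x v f a -> is_derive x v g b ->
  is_derive x v (fun y => f y + g y) (a + b).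
Proof. by move=> h1 h2; exact: is_deriveD. Qed.

Lemma derB f g x v a b : is_derive x v f a -> is_derive x v g b ->
  is_derive x v (fun y => f y - g y) (a - b).
Proof. by move=> h1 h2; exact: is_deriveB. Qed.

Lemma derM f g x v a b : is_derive x v f a -> is_derive x v g b ->
  is_derive x v (fun y => f y * g y) (f x * b + g x * a).
Proof. by move=> h1 h2; exact: is_deriveM. Qed.

Lemma derZ f x v (k : R) a : is_derive x v f a ->
  is_derive x v (fun y => k * f y) (k * a).
Proof. by move=> h1; exact: is_deriveZ. Qed.

Lemma derC x v (k : R) : is_derive x v (fun=> k) 0.
Proof. exact: is_derive_cst. Qed.

Lemma derX f k x v a : is_derive x v f a ->
  is_derive x v (fun y => f y ^+ k.+1) (k.+1%:R * f x ^+ k * a).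
Proof.
move=> h; have -> : (fun y => f y ^+ k.+1) = f ^+ k.+1.
  by apply/funext => y; rewrite exprfctE.
exact: (@is_deriveX _ _ f k.+1 x v a h).
Qed.

Lemma derS k (h : 'I_k -> V -> R) x v (dh : 'I_k -> R) :
  (forall i, is_derive x v (h i) (dh i)) ->
  is_derive x v (fun y => \sum_(i < k) h i y) (\sum_(i < k) dh i).
Proof.
move=> H; have := is_derive_sum H.
by have -> : \sum_(i < k) h i = (fun y => \sum_(i < k) h i y) by apply/funext => y; rewrite fct_sumE.
Qed.

Lemma der_comp (phi : R -> R) f x v a b :
  is_derive (f x) (1 : R) phi a -> is_derive x v f b ->
  is_derive x v (fun y => phi (f y)) (a * b).
Proof.
move=> h1 h2; apply: is_derive_line0.
have h3 : is_derive (0 : R) (1 : R) (fun s => f (x + s *: v)) b.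
  by apply: is_derive_line; rewrite scale0r addr0.
by apply: (@is_derive1_comp _ phi (fun s => f (x + s *: v))); rewrite ?scale0r ?addr0.
Qed.

End Rules.

Section RealFunctions.
Context {R : realType}.

(** Meant for the square of [pos] at its kink, where the quadratic error bound follows by cases on
    signs. *)
Lemma is_derive_quadratic (f : R -> R) t d (C : R) :
  (forall h, `|f (t + h) - f t - h * d| <= C * h ^+ 2) -> is_derive t (1 : R) f d.
Proof.
move=> H; apply: cvg_is_derive; apply/cvgrPdist_lt => e e0.
have C1 : 0 < `|C| + 1 by rewrite ltr_wpDl.
exists (e / (`|C| + 1)) => /=; first by rewrite divr_gt0.
move=> h /=; rewrite sub0r normrN => he h0.
have -> : d - h^-1 *: (f (h *: 1 + t) - f t) = - h^-1 * (f (t + h) - f t - h * d).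
  by rewrite [h *: 1]mulr1 [h + t]addrC /GRing.scale /=; field.
rewrite normrM normrN normfV ltr_pdivrMl ?normr_gt0 //.
apply: (le_lt_trans (H h)); rewrite -(real_normK (num_real h)).
have k0 : 0 < `|h| by rewrite normr_gt0.
move: he; rewrite ltr_pdivlMr // => he; have CC := ler_norm C.
have a1 := mulr_gt0 k0 k0; have := ler_wpM2r (ltW a1) CC.
have := mulr_gt0 k0 (_ : 0 < e - `|h| * (`|C| + 1)); rewrite subr_gt0 => /(_ he).
by rewrite expr2; nra.
Qed.

(** Positive part. Its powers from the square on are C^1, so cutoffs and kernels of compact support
    can be polynomial in it. *)
Definition pos (t : R) := Num.max t 0.

Lemma pos_ge0 t : 0 <= pos t. Proof. by rewrite le_max lexx orbT. Qed.

Lemma pos_id t : 0 <= t -> pos t = t. Proof. exact: max_l. Qed.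

Lemma pos_eq0 t : t <= 0 -> pos t = 0. Proof. exact: max_r. Qed.

Lemma is_derive_pos k t :
  is_derive t (1 : R) (fun s => pos s ^+ k.+2) (k.+2%:R * pos t ^+ k.+1).
Proof.
elim: k t => [|k IH] t.
  apply: (@is_derive_quadratic _ _ _ 1) => h; rewrite mul1r expr1 /pos !maxEle.
  rewrite ler_norml; have := sqr_ge0 h; have := sqr_ge0 t; have := sqr_ge0 (t + h).
  by case: (leP t 0) => ?; case: (leP (t + h) 0) => ? *; apply/andP; split; nra.
have -> : (fun s : R => pos s ^+ k.+3) = (fun s => s * pos s ^+ k.+2).
  by apply/funext => s; case: (leP 0 s) => [/pos_id ->|/ltW/pos_eq0 ->]; rewrite -?exprS // !expr0n mulr0.
have := (derM (is_derive_id t (1 : R)) (IH t)) => H; apply: (derE H).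
rewrite mulrCA mulr1; suff -> : t * pos t ^+ k.+1 = pos t ^+ k.+2.
  by rewrite [k.+3%:R]mulrSr; ring.
by case: (leP 0 t) => [/pos_id ->|/ltW/pos_eq0 ->]; rewrite -?exprS // !expr0n mulr0.
Qed.

Lemma continuous_pos : continuous pos.
Proof.
move=> t; apply: (@continuous_max _ _ id (cst 0)); [exact: cvg_id|exact: cvg_cst].
Qed.
End RealFunctions.

Section ContinuityRules.
Context {R : realType} {T : topologicalType}.
Implicit Types f g : T -> R.

Lemma contD f g : continuous f -> continuous g -> continuous (fun x => f x + g x).
Proof. by move=> cf cg x; apply: cvgD; [exact: cf|exact: cg]. Qed.

Lemma contN f : continuous f -> continuous (fun x => - f x).
Proof. by move=> cf x; apply: cvgN; exact: cf. Qed.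

Lemma contB f g : continuous f -> continuous g -> continuous (fun x => f x - g x).
Proof. by move=> cf cg x; apply: cvgB; [exact: cf|exact: cg]. Qed.

Lemma contM f g : continuous f -> continuous g -> continuous (fun x => f x * g x).
Proof. by move=> cf cg x; apply: cvgM; [exact: cf|exact: cg]. Qed.

Lemma contC (k : R) : continuous (fun _ : T => k).
Proof. by move=> x; exact: cvg_cst. Qed.

Lemma contX f k : continuous f -> continuous (fun x => f x ^+ k).
Proof.
move=> cf; elim: k => [|k IH]; first exact: contC.
by under eq_fun do rewrite exprS; exact: contM.
Qed.

Lemma contS k (f : 'I_k -> T -> R) : (forall i, continuous (f i)) ->
  continuous (fun x => \sum_(i < k) f i x).
Proof.
move=> cf; elim: (index_enum _) => [|i s IH].
  by under eq_fun do rewrite big_nil; exact: contC.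
by under eq_fun do rewrite big_cons; exact: contD.
Qed.

Lemma cont_comp (phi : R -> R) f : continuous phi -> continuous f ->
  continuous (fun x => phi (f x)).
Proof. by move=> cp cf x; apply: continuous_comp; [exact: cf|exact: cp]. Qed.

End ContinuityRules.

(** * Directional derivatives and symmetry of second derivatives *)

Section Partials.
Context {R : realType} {n : nat}.
Implicit Types (f g : 'rV[R]_n -> R) (x y v w : 'rV[R]_n).

Definition e_ (i : 'I_n) : 'rV[R]_n := delta_mx 0 i.

Lemma e_E i j : e_ i 0 j = (j == i)%:R.
Proof. by rewrite mxE eqxx. Qed.

Lemma cont_coord i : continuous (fun x : 'rV[R]_n => x 0 i).
Proof. exact: coord_continuous. Qed.

Lemma der_coord i x v : is_derive x v (fun y : 'rV[R]_n => y 0 i) (v 0 i).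
Proof.
apply: is_derive_line0.
have -> : (fun s : R => (x + s *: v) 0 i) = (fun s => x 0 i + s * v 0 i).
  by apply/funext => s; rewrite !mxE.
have H := derD (derC (0 : R) 1 (x 0 i)) (derM (is_derive_id (0 : R) 1) (derC (0 : R) 1 (v 0 i))).
by apply: derE H _; rewrite add0r mul0r mulr1 add0r.
Qed.

Lemma MVT_two_sided f df x v b :
  (forall y, is_derive y v f (df y)) ->
  exists2 c, `|c| <= `|b| & f (x + b *: v) - f x = df (x + c *: v) * b.
Proof.
move=> D; case: (ltgtP b 0) => [b0|b0|->]; last first.
- by exists 0; rewrite ?scale0r ?addr0 ?subrr ?mulr0.
- have [c /andP[c0 cb]] := @MVT_line _ _ f df x v _ _ b0 (fun t _ => D _).
  rewrite scale0r addr0 subr0 => h; exists c => //.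
  by rewrite (gtr0_norm c0) (gtr0_norm b0) ltW.
have [c /andP[c0 cb]] := @MVT_line _ _ f df x v _ _ b0 (fun t _ => D _).
rewrite scale0r addr0 sub0r => h; exists c; last by rewrite -opprB h mulrN opprK.
by rewrite (ler0_norm (ltW cb)) (ler0_norm (ltW b0)) lerN2 ltW.
Qed.

(** The point is moved by h w, then by h c along the axis. The mean value theorem writes the second
    increment as a value of [df] near x, and continuity of [df] yields the limit. *)
Lemma der_add_dir f df i x w d (c : R) : continuous df ->
  (forall y, is_derive y (e_ i) f (df y)) -> is_derive x w f d ->
  is_derive x (w + c *: e_ i) f (d + c * df x).
Proof.
move=> cdf D Dw; apply: cvg_is_derive.
have -> : (fun h : R => h^-1 *: (f (h *: (w + c *: e_ i) + x) - f x)) =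
   (fun h : R => h^-1 *: (f (h *: w + x) - f x) +
      h^-1 *: (f ((h *: w + x) + (h * c) *: e_ i) - f (h *: w + x))).
  apply/funext => h; rewrite -scalerDr; congr (_ *: _).
  rewrite [RHS]addrC subrKA; congr (f _ - _).
  by rewrite scalerDr scalerA addrAC.
apply: cvgD; first exact: is_derive_cvg.
apply/cvgrPdist_lt => e e0.
have c1 : 0 < `|c| + 1 by rewrite ltr_wpDl.
have e'0 : 0 < e / (`|c| + 1) by rewrite divr_gt0.
have [d' d'0 hd] := continuous_epsdelta x cdf e'0.
have M0 : 0 < `|w| + `|c| * `|e_ i| + 1 by rewrite ltr_wpDl // addr_ge0 // mulr_ge0.
exists (d' / (`|w| + `|c| * `|e_ i| + 1)) => /=; first by rewrite divr_gt0.
move=> h /=; rewrite sub0r normrN ltr_pdivlMr // => he h0.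
have [t tb ->] := MVT_two_sided (h *: w + x) (h * c) D.
have -> : c * df x - h^-1 *: (df (h *: w + x + t *: e_ i) * (h * c)) =
   - c * (df (h *: w + x + t *: e_ i) - df x).
  by rewrite /GRing.scale /=; field.
rewrite normrM normrN.
have hh : `|df (h *: w + x + t *: e_ i) - df x| < e / (`|c| + 1).
  apply: hd; rewrite addrAC addrK; apply: le_lt_trans he.
  rewrite (le_trans (ler_normD _ _)) // !normrZ !mulrDr mulr1 -addrA lerD2l.
  by apply: ler_wpDr => //; rewrite mulrA -normrM ler_wpM2r.
rewrite (le_lt_trans (ler_wpM2l _ (ltW hh))) // mulrCA -[ltRHS]mulr1 ltr_pM2l //.
by rewrite ltr_pdivrMr // mul1r ltrDl.
Qed.

Lemma der_dir f (df : 'I_n -> 'rV[R]_n -> R) x v :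
  (forall i, continuous (df i)) ->
  (forall i y, is_derive y (e_ i) f (df i y)) ->
  is_derive x v f (\sum_(i < n) v 0 i * df i x).
Proof.
move=> cdf D; rewrite [v in is_derive _ v _ _]row_sum_delta.
elim: (index_enum _) => [|i s IH]; first by rewrite !big_nil; exact: is_derive0.
rewrite !big_cons addrC [X in is_derive _ _ _ X]addrC.
exact: der_add_dir.
Qed.

Lemma second_difference f (dif djif : 'rV[R]_n -> R) i j x h : 0 < h ->
  (forall y, is_derive y (e_ i) f (dif y)) ->
  (forall y, is_derive y (e_ j) dif (djif y)) ->
  exists s t, [/\ `|s| <= h, `|t| <= h &
    f (x + h *: e_ i + h *: e_ j) - f (x + h *: e_ i) - f (x + h *: e_ j) + f x =
    h ^+ 2 * djif (x + s *: e_ i + t *: e_ j)].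
Proof.
move=> h0 Di Dj.
pose g y := f (y + h *: e_ j) - f y.
have Dg y : is_derive y (e_ i) g (dif (y + h *: e_ j) - dif y).
  suff H : is_derive y (e_ i) (fun y => f (y + h *: e_ j)) (dif (y + h *: e_ j)).
    exact: (derB H (Di y)).
  apply: is_derive_line0; have := Di (y + h *: e_ j).
  rewrite -[X in is_derive X _ _ _]addr0 -(scale0r (e_ i)) => /is_derive_line.
  by have -> : (fun s : R => f (y + h *: e_ j + s *: e_ i)) =
     (fun s : R => f (y + s *: e_ i + h *: e_ j)) by apply/funext => s; rewrite addrAC.
have [s sh] := MVT_two_sided x h Dg.
have [t th] := MVT_two_sided (x + s *: e_ i) h Dj.
rewrite (gtr0_norm h0) in sh th.
move=> h1 h2; exists s, t; split => //.
by rewrite mulrC expr2 mulrA -h1 -h2 /g; ring.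
Qed.

(** Both orders of differentiation represent the same second difference of f, each at a point that
    tends to x with the step. *)
Lemma schwarz f (di dj dij dji : 'rV[R]_n -> R) i j x :
  continuous dij -> continuous dji ->
  (forall y, is_derive y (e_ i) f (di y)) -> (forall y, is_derive y (e_ j) di (dji y)) ->
  (forall y, is_derive y (e_ j) f (dj y)) -> (forall y, is_derive y (e_ i) dj (dij y)) ->
  dij x = dji x.
Proof.
move=> c1 c2 D1 D2 D3 D4; apply/eqP; rewrite -subr_eq0 -normr_le0; apply/ler_addgt0Pl => e e0.
rewrite addr0; have e2 : 0 < e / 2 by rewrite divr_gt0.
have [d1 d10 h1] := continuous_epsdelta x c1 e2.
have [d2 d20 h2] := continuous_epsdelta x c2 e2.
pose M := `|e_ i| + `|e_ j| + 1.
have M0 : 0 < M by rewrite ltr_wpDl // addr_ge0.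
pose d := Num.min d1 d2; have d0 : 0 < d by rewrite lt_min d10.
pose h := d / M / 2; have h0 : 0 < h by rewrite !divr_gt0.
have small s t k l : `|s| <= h -> `|t| <= h -> (k == i) && (l == j) || (k == j) && (l == i) ->
    `|x + s *: e_ k + t *: e_ l - x| < d.
  move=> sh th kl; rewrite -(addrA x (s *: e_ k)) addrAC subrr add0r.
  apply: (le_lt_trans (ler_normD _ _)); rewrite !normrZ.
  apply: (@le_lt_trans _ _ (h * (`|e_ k| + `|e_ l|))).
    by rewrite mulrDr lerD // ler_wpM2r.
  apply: (@lt_le_trans _ _ (d / M * M)); last by rewrite divfK ?gt_eqF.
  apply: (@lt_le_trans _ _ (d / M * (`|e_ k| + `|e_ l| + 1))).
    rewrite /h -mulrA ltr_pM2l ?divr_gt0 //.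
    by have := normr_ge0 (e_ k); have := normr_ge0 (e_ l); lra.
  rewrite ler_pM2l ?divr_gt0 // /M lerD2r.
  by case/orP: kl => /andP[/eqP-> /eqP->] //; rewrite addrC.
have [s [t [sh th E1]]] := second_difference x h0 D1 D2.
have [s' [t' [sh' th' E2]]] := second_difference x h0 D3 D4.
have E : dij (x + s' *: e_ j + t' *: e_ i) = dji (x + s *: e_ i + t *: e_ j).
  have h2n : h ^+ 2 != 0 by rewrite expf_neq0 ?gt_eqF.
  apply: (mulfI h2n); rewrite -E1 -E2 [x + h *: e_ j + _]addrAC; ring.
have A : `|dij (x + s' *: e_ j + t' *: e_ i) - dij x| < e / 2.
  by apply: h1; rewrite (lt_le_trans (small _ _ _ _ sh' th' _)) ?eqxx ?orbT // ge_min lexx.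
have B : `|dji (x + s *: e_ i + t *: e_ j) - dji x| < e / 2.
  by apply: h2; rewrite (lt_le_trans (small _ _ _ _ sh th _)) ?eqxx // ge_min lexx orbT.
move: A B; rewrite E !ltr_norml ler_norml => /andP[? ?] /andP[? ?].
by apply/andP; split; lra.
Qed.

End Partials.

Section Smooth.
Context {R : realType} {n : nat}.
Implicit Types (f g : 'rV[R]_n -> R) (x y : 'rV[R]_n) (i j : 'I_n).

Lemma smooth_cont f : smooth f -> continuous f.
Proof. by move=> /(_ [::])[]. Qed.

Lemma smooth_der f i x : smooth f -> is_derive x (e_ i) f (partial i f x).
Proof. by move=> /(_ [::])[_ /(_ i x) /derivableP]. Qed.

Lemma smooth_partial f i : smooth f -> smooth (partial i f).
Proof. by move=> sf s; have := sf (rcons s i); rewrite foldr_rcons. Qed.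

Lemma smooth_schwarz f i j x : smooth f ->
  partial i (partial j f) x = partial j (partial i f) x.
Proof.
move=> sf; apply: (@schwarz _ _ f (partial i f) (partial j f) _ _ i j).
- by apply: smooth_cont; do 2 apply: smooth_partial.
- by apply: smooth_cont; do 2 apply: smooth_partial.
- by move=> y; apply: smooth_der.
- by move=> y; apply: smooth_der; apply: smooth_partial.
- by move=> y; apply: smooth_der.
- by move=> y; apply: smooth_der; apply: smooth_partial.
Qed.

End Smooth.

Section Powers.
Context {R : realType}.

Lemma cont_powR {T : topologicalType} (f : T -> R) a :
  continuous f -> (forall x, 0 < f x) -> continuous (fun x => f x `^ a).
Proof.
move=> cf f0 x; apply: (@continuous_comp _ _ _ f (@powR R ^~ a)); first exact: cf.
by apply: differentiable_continuous; apply/derivable1_diffP; have [] := is_derive1_powR a (f0 x).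
Qed.

Lemma der_powR {V : normedModType R} (f : V -> R) a x v d : 0 < f x ->
  is_derive x v f d -> is_derive x v (fun y => f y `^ a) (a * f x `^ (a - 1) * d).
Proof. by move=> f0 df; apply: (@der_comp _ _ (@powR R ^~ a)) => //; exact: is_derive1_powR. Qed.

End Powers.

Section Rho.
Context {R : realType} {n : nat}.
Implicit Types (x y : 'rV[R]_n).

(** Squared Euclidean length. Radial functions are written in terms of it, which keeps them
    differentiable at the origin. *)
Definition rho x := \sum_(i < n) x 0 i ^+ 2.

Lemma rho_ge0 x : 0 <= rho x.
Proof. by apply: sumr_ge0 => i _; exact: sqr_ge0. Qed.

Lemma enorm_ge0 x : 0 <= enorm x. Proof. exact: sqrtr_ge0. Qed.

Lemma sqr_enorm x : enorm x ^+ 2 = rho x.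
Proof. by rewrite sqr_sqrtr // rho_ge0. Qed.

Lemma sqr_norm_le_rho x : `|x| ^+ 2 <= rho x.
Proof.
rewrite -sqr_enorm lerXn2r ?nnegrE ?enorm_ge0 //.
apply: norm_rV_le; first exact: enorm_ge0.
move=> i; rewrite -sqrtr_sqr ler_wsqrtr // (bigD1 i) //= lerDl.
by apply: sumr_ge0 => j _; exact: sqr_ge0.
Qed.

Lemma rho_le x : rho x <= n%:R * `|x| ^+ 2.
Proof.
have -> : n%:R * `|x| ^+ 2 = \sum_(i < n) `|x| ^+ 2 by rewrite sumr_const card_ord mulr_natl.
apply: ler_sum => i _.
rewrite -real_normK ?num_real // lerXn2r ?nnegrE //; exact: coord_le_norm.
Qed.

Lemma cont_rho : continuous (rho : 'rV[R]_n -> R).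
Proof. by apply: contS => i; apply: contX; exact: cont_coord. Qed.

Lemma der_rho i x : is_derive x (e_ i) (rho : 'rV[R]_n -> R) (2 * x 0 i).
Proof.
have H j := derX 1 (der_coord j x (e_ i)).
apply: derE (derS H) _; rewrite (bigD1 i) //= big1 => [|j ji].
  by rewrite e_E eqxx expr1 mulr1 addr0.
by rewrite e_E (negbTE ji) mulr0.
Qed.

Lemma der_radial (phi : R -> R) d i x : is_derive (rho x) (1 : R) phi d ->
  is_derive x (e_ i) (fun y => phi (rho y)) (2 * d * x 0 i).
Proof. by move=> D; apply: derE (der_comp D (der_rho i x)) _; ring. Qed.

Lemma sum_sqr_coord x : \sum_(i < n) x 0 i * x 0 i = rho x.
Proof. by apply: eq_bigr => i _; rewrite expr2. Qed.

Lemma radial_support (phi : R -> R) (r : R) : 0 < r ->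
  (forall t, 2 * r ^+ 2 <= t -> phi t = 0) ->
  forall x, 2 * r <= `|x| -> phi (rho x) = 0.
Proof.
move=> r0 H x hx; apply: H; apply: le_trans (sqr_norm_le_rho x); nra.
Qed.

End Rho.

(** * Cutoff profiles *)

Section Cutoff.
Context {R : realType} (n : nat).
Hypothesis n2 : (2 <= n)%N.
Implicit Types t : R.

(* [cutoff] is 1 up to 1 and 0 from 2 on; it is built so that its derivative is
   [-(n+1)^2 bump^n], an n-th power: this makes the Young inequality below scale correctly. *)
Definition rise t := pos (t - 1).
Definition fall t := pos (1 - rise t ^+ n.+1).
Definition bump t := rise t * fall t.
Definition cutoff t := fall t ^+ n.+1.
(** For 1 < t < 2 this is the derivative of [bump]; elsewhere it only occurs multiplied by powers of
    [bump], which vanish. *)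
Definition dbump t := fall t - n.+1%:R * rise t ^+ n.+1.

Lemma rise_ge0 t : 0 <= rise t. Proof. exact: pos_ge0. Qed.
Lemma fall_ge0 t : 0 <= fall t. Proof. exact: pos_ge0. Qed.

Lemma fall_le1 t : fall t <= 1.
Proof. by rewrite /fall /pos ge_max ler01 andbT lerBlDr lerDl exprn_ge0 ?rise_ge0. Qed.

Lemma rise_id t : 1 <= t -> rise t = t - 1.
Proof. by move=> h; rewrite /rise pos_id ?subr_ge0. Qed.

Lemma rise_eq0 t : t <= 1 -> rise t = 0.
Proof. by move=> h; rewrite /rise pos_eq0 ?subr_le0. Qed.

Lemma fall_eq0 t : 2 <= t -> fall t = 0.
Proof.
move=> h; rewrite /fall pos_eq0 // subr_le0 exprn_ege1 // rise_id; lra.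
Qed.

Lemma fall_eq1 t : t <= 1 -> fall t = 1.
Proof. by move=> h; rewrite /fall rise_eq0 // expr0n subr0 pos_id. Qed.

Lemma rise_le1 t : t <= 2 -> rise t <= 1.
Proof. by move=> h; rewrite /rise /pos ge_max ler01 andbT; lra. Qed.

Lemma bump_ge0 t : 0 <= bump t.
Proof. by rewrite mulr_ge0 ?rise_ge0 ?fall_ge0. Qed.

Lemma bump_eq0 t : (t <= 1) || (2 <= t) -> bump t = 0.
Proof.
by rewrite /bump => /orP[/rise_eq0 ->|/fall_eq0 ->]; rewrite ?mul0r ?mulr0.
Qed.

Lemma bump_le1 t : bump t <= 1.
Proof.
have [h|h] := leP t 2; last by rewrite bump_eq0 ?ler01 // (ltW h) orbT.
by rewrite mulr_ile1 ?rise_ge0 ?fall_ge0 ?fall_le1 ?rise_le1.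
Qed.

(** In the middle of the transition zone both [rise] and [fall] are at least 1/4. The balls of the
    concentration argument are placed there. *)
Lemma bump_ge t : 5 / 4 <= t <= 7 / 4 -> 1 / 16 <= bump t.
Proof.
move=> /andP[h1 h2]; have t1 : 1 <= t by lra.
have rt := rise_id t1.
have r1 : rise t ^+ n.+1 <= 3 / 4.
  apply: (@le_trans _ _ (rise t)); last by rewrite rt; lra.
  by rewrite ler_iXnr // ?rise_ge0 // rt; lra.
have f1 : 1 / 4 <= fall t by rewrite /fall /pos le_max; apply/orP; left; lra.
by rewrite /bump; nra.
Qed.

Lemma cutoff_ge0 t : 0 <= cutoff t.
Proof. by rewrite exprn_ge0 ?fall_ge0. Qed.

Lemma cutoff_le1 t : cutoff t <= 1.
Proof. by rewrite exprn_ile1 ?fall_ge0 ?fall_le1. Qed.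

Lemma cutoff_eq1 t : t <= 1 -> cutoff t = 1.
Proof. by move=> h; rewrite /cutoff fall_eq1 ?expr1n. Qed.

Lemma cutoff_eq0 t : 2 <= t -> cutoff t = 0.
Proof. by move=> h; rewrite /cutoff fall_eq0 // expr0n. Qed.

Lemma cont_rise : continuous rise.
Proof.
by apply: (@cont_comp _ _ pos); [exact: continuous_pos|apply: contB; [move=> t; exact: cvg_id|exact: contC]].
Qed.

Lemma cont_fall : continuous fall.
Proof.
apply: (@cont_comp _ _ pos); first exact: continuous_pos.
by apply: contB; [exact: contC|apply: contX; exact: cont_rise].
Qed.

Lemma cont_bump : continuous bump.
Proof. by apply: contM; [exact: cont_rise|exact: cont_fall]. Qed.

Lemma cont_dbump : continuous dbump.
Proof.
apply: contB; first exact: cont_fall.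
by apply: contM; [exact: contC|apply: contX; exact: cont_rise].
Qed.

Lemma cont_cutoff : continuous cutoff.
Proof. by apply: contX; exact: cont_fall. Qed.

Lemma dbump_bound t : t <= 2 -> `|dbump t| <= n.+2%:R.
Proof.
move=> t2; have f0 := fall_ge0 t; have f1 := fall_le1 t.
have r0 : 0 <= rise t ^+ n.+1 by rewrite exprn_ge0 ?rise_ge0.
have r1 : rise t ^+ n.+1 <= 1 by rewrite exprn_ile1 ?rise_ge0 ?rise_le1.
have n0 : 0 <= n.+1%:R :> R by [].
by rewrite /dbump [n.+2%:R]mulrSr ler_norml; apply/andP; split; nra.
Qed.

Lemma der_rise k t : is_derive t (1 : R) (fun s => rise s ^+ k.+2) (k.+2%:R * rise t ^+ k.+1).
Proof.
have h := derB (is_derive_id t (1 : R)) (derC t (1 : R) 1).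
by apply: derE (der_comp (is_derive_pos k _) h) _; rewrite subr0 mulr1.
Qed.

Lemma der_fall k t : is_derive t (1 : R) (fun s => fall s ^+ k.+2)
  (- (k.+2%:R * n.+1%:R * fall t ^+ k.+1 * rise t ^+ n)).
Proof.
have [m nE] : exists m, n = m.+1 by case: (n) n2 => // m _; exists m.
have D := der_rise m t; rewrite -nE in D.
have h := derB (derC t (1 : R) 1) D.
by apply: derE (der_comp (is_derive_pos k _) h) _; rewrite /fall; ring.
Qed.

Lemma der_cutoff t : is_derive t (1 : R) cutoff (- (n.+1%:R ^+ 2 * bump t ^+ n)).
Proof.
have [m nE] : exists m, n = m.+1 by case: (n) n2 => // m _; exists m.
have := der_fall m t; rewrite -nE => D; apply: derE D _.
by rewrite /bump exprMn; ring.
Qed.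

Lemma der_bumpX k t : is_derive t (1 : R) (fun s => bump s ^+ k.+2)
  (k.+2%:R * bump t ^+ k.+1 * dbump t).
Proof.
have -> : (fun s => bump s ^+ k.+2) = (fun s => rise s ^+ k.+2 * fall s ^+ k.+2).
  by apply/funext => s; rewrite exprMn.
apply: derE (derM (der_rise k t) (der_fall k t)) _.
rewrite /dbump /bump exprMn (exprS _ k.+1) [fall t ^+ k.+2]exprS (exprS _ n); ring.
Qed.

End Cutoff.

Lemma sum_mul_delta (R : realType) (n : nat) (a : 'I_n -> R) (i : 'I_n) :
  \sum_(j < n) a j * e_ i 0 j = a i.
Proof.
rewrite (bigD1 i) //= big1 => [|j ji]; first by rewrite e_E eqxx mulr1 addr0.
by rewrite e_E (negbTE ji) mulr0.
Qed.

(** * Integral identities *)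

Section TestFunctions.
Context {R : realType} {n : nat}.
Implicit Types (f g : 'rV[R]_n -> R) (x y : 'rV[R]_n).

Lemma bsuppM f g : bounded_support g -> bounded_support (fun x => g x * f x).
Proof. by move=> [L h]; exists L => x /h ->; rewrite mul0r. Qed.

Lemma testM f g : continuous f -> test_function g -> test_function (fun x => g x * f x).
Proof. by move=> cf [cg sg]; split; [exact: contM|exact: bsuppM]. Qed.

Lemma testMl f g : continuous f -> test_function g -> test_function (fun x => f x * g x).
Proof. by move=> cf tg; under eq_fun do rewrite mulrC; exact: testM. Qed.

Lemma testD f g : test_function f -> test_function g -> test_function (fun x => f x + g x).
Proof.
move=> [cf [L hL]] [cg [M hM]]; split; first exact: contD.
exists (Num.max L M) => x; rewrite ge_max => /andP[/hL -> /hM ->].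
by rewrite addr0.
Qed.

Lemma test0 : test_function (fun _ : 'rV[R]_n => 0).
Proof. by split; [exact: contC|exists 0]. Qed.

Lemma testZ (a : R) f : test_function f -> test_function (fun x => a * f x).
Proof. by move=> tf; apply: testMl => //; exact: contC. Qed.

Lemma testN f : test_function f -> test_function (fun x => - f x).
Proof. by move=> tf; under eq_fun do rewrite -mulN1r; exact: testZ. Qed.

Lemma testB f g : test_function f -> test_function g -> test_function (fun x => f x - g x).
Proof. by move=> tf tg; apply: testD => //; exact: testN. Qed.

Lemma test_derive v (F dF : 'rV[R]_n -> R) : bounded_support F -> continuous dF ->
  (forall x, is_derive x v F (dF x)) -> test_function dF.
Proof.
move=> [L F0] cdF D; split => //; exists (L + 1) => x hx.
by apply: (derive_support F0 D); lra.
Qed.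

Lemma bsupp_radial (phi : R -> R) B : (forall t, B <= t -> phi t = 0) ->
  bounded_support (fun x : 'rV[R]_n => phi (rho x)).
Proof.
move=> h; exists (`|B| + 1) => x hx; apply: h.
apply: le_trans (sqr_norm_le_rho x); have := ler_norm B; have := normr_ge0 B; nra.
Qed.

Lemma test_radial (phi : R -> R) B : continuous phi -> (forall t, B <= t -> phi t = 0) ->
  test_function (fun x : 'rV[R]_n => phi (rho x)).
Proof.
by move=> c h; split; [exact: cont_comp cont_rho|exact: bsupp_radial h].
Qed.

End TestFunctions.

Section IntegralRules.
Context {R : realType} {n : nat} (I : ('rV[R]_n -> R) -> R).
Hypothesis II : is_integral I.
Implicit Types (f g : 'rV[R]_n -> R) (x y : 'rV[R]_n).

Lemma int_lin a f g : test_function f -> test_function g ->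
  I (fun x => a * f x + g x) = a * I f + I g.
Proof. by case: II => h _ _; exact: h. Qed.

Lemma int_le f g : test_function f -> test_function g -> (forall x, f x <= g x) ->
  I f <= I g.
Proof. by case: II => _ h _; exact: h. Qed.

Lemma intD f g : test_function f -> test_function g ->
  I (fun x => f x + g x) = I f + I g.
Proof.
by move=> tf tg; rewrite -[I f]mul1r -int_lin //; congr I; apply/funext => x; rewrite mul1r.
Qed.

Lemma int0 : I (fun=> 0) = 0.
Proof.
have := intD (@test0 R n) (@test0 R n).
by rewrite (_ : (fun x : 'rV[R]_n => _) = fun=> 0); [lra|apply/funext => x; rewrite addr0].
Qed.

Lemma intZ a f : test_function f -> I (fun x => a * f x) = a * I f.
Proof.
move=> tf; rewrite -[RHS]addr0 -int0 -int_lin //; last exact: test0.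
by congr I; apply/funext => x; rewrite addr0.
Qed.

Lemma intN f : test_function f -> I (fun x => - f x) = - I f.
Proof. by move=> tf; rewrite -mulN1r -intZ //; congr I; apply/funext => x; rewrite mulN1r. Qed.

Lemma intB f g : test_function f -> test_function g ->
  I (fun x => f x - g x) = I f - I g.
Proof. by move=> tf tg; rewrite intD ?intN //; exact: testN. Qed.

Lemma intS k (f : 'I_k -> 'rV[R]_n -> R) : (forall i, test_function (f i)) ->
  I (fun x => \sum_(i < k) f i x) = \sum_(i < k) I (f i).
Proof.
move=> tf; elim: (index_enum _) => [|i s IH].
  by under eq_fun do rewrite big_nil; rewrite big_nil int0.
rewrite big_cons -IH -intD //.
  by congr I; apply/funext => x; rewrite big_cons.
elim: (s) => [|j r IHr]; first by under eq_fun do rewrite big_nil; exact: test0.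
by under eq_fun do rewrite big_cons; exact: testD.
Qed.

Lemma int_ge0 f : test_function f -> (forall x, 0 <= f x) -> 0 <= I f.
Proof. by move=> tf f0; rewrite -int0; apply: int_le => //; exact: test0. Qed.

Lemma int_div (F dF : 'I_n -> 'rV[R]_n -> R) :
  (forall i, bounded_support (F i)) -> (forall i, continuous (dF i)) ->
  (forall i x, is_derive x (e_ i) (F i) (dF i x)) ->
  I (fun x => \sum_(i < n) dF i x) = 0.
Proof.
move=> sF cF D; rewrite intS => [|i]; last exact: test_derive (sF i) (cF i) (D i).
by rewrite big1 // => i _; case: II => _ _ h; exact: h (sF i) (cF i) (D i).
Qed.

(** Divergence theorem for the field phi(rho) F, with grad rho = 2 x. *)
Lemma int_radial_div (phi dphi : R -> R) B (F : 'I_n -> 'rV[R]_n -> R)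
    (dF : 'I_n -> 'rV[R]_n -> R) :
  (forall t, is_derive t (1 : R) phi (dphi t)) -> continuous dphi ->
  (forall t, B <= t -> phi t = 0) ->
  (forall i, continuous (F i)) -> (forall i, continuous (dF i)) ->
  (forall i x, is_derive x (e_ i) (F i) (dF i x)) ->
  I (fun x => phi (rho x) * (\sum_(i < n) dF i x) + 2 * dphi (rho x) * (\sum_(i < n) x 0 i * F i x)) = 0.
Proof.
move=> D cd hB cF cdF DF.
have cphi : continuous phi.
  move=> t; apply: differentiable_continuous; apply/derivable1_diffP.
  by have [] := D t.
have sF i : bounded_support (fun x => phi (rho x) * F i x).
  by apply: bsuppM; exact: bsupp_radial hB.
pose dG i x := phi (rho x) * dF i x + F i x * (2 * dphi (rho x) * x 0 i).
have cG i : continuous (dG i).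
  apply: contD; apply: contM => //; first exact: cont_comp cont_rho.
  apply: contM; last exact: cont_coord.
  by apply: contM; [exact: contC|exact: cont_comp cont_rho].
have DG i x : is_derive x (e_ i) (fun x => phi (rho x) * F i x) (dG i x).
  exact: (derM (der_radial i (D (rho x))) (DF i x)).
rewrite -[RHS](int_div sF cG DG); congr I; apply/funext => x.
rewrite big_split /= !mulr_sumr; congr (_ + _).
by apply: eq_bigr => i _; ring.
Qed.

End IntegralRules.

Definition sobolev_exp (R : realType) (n : nat) : R := (n%:R + 2) / (n%:R - 2).
Definition critical_exp (R : realType) (n : nat) : R := 2 * n%:R / (n%:R - 2).
#[global] Arguments sobolev_exp : clear implicits.
#[global] Arguments critical_exp : clear implicits.

Section Identities.
Context {R : realType} {n : nat} (I : ('rV[R]_n -> R) -> R).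
Hypothesis II : is_integral I.
Hypothesis n3 : (3 <= n)%N.
Variables (u K : 'rV[R]_n -> R) (u1 K1 : 'I_n -> 'rV[R]_n -> R)
  (u2 : 'I_n -> 'I_n -> 'rV[R]_n -> R).
Hypotheses (u_cont : continuous u) (u1_cont : forall i, continuous (u1 i))
  (u2_cont : forall i j, continuous (u2 i j)).
Hypotheses (K_cont : continuous K) (K1_cont : forall i, continuous (K1 i)).
Hypotheses (u_der : forall i (x : 'rV[R]_n), is_derive x (e_ i) u (u1 i x))
  (u1_der : forall i j (x : 'rV[R]_n), is_derive x (e_ j) (u1 i) (u2 i j x))
  (K_der : forall i (x : 'rV[R]_n), is_derive x (e_ i) K (K1 i x)).
Hypothesis u2_sym : forall i j x, u2 i j x = u2 j i x.
Hypothesis u_pos : forall x, 0 < u x.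
Let N : R := n%:R.
Let expo := sobolev_exp R n.
Let crit := critical_exp R n.
Implicit Types (f : 'rV[R]_n -> R) (x y : 'rV[R]_n) (i j : 'I_n).

Definition radial_part (u1 : 'I_n -> 'rV[R]_n -> R) x : R := \sum_(i < n) x 0 i * u1 i x.
Definition grad_sqr (u1 : 'I_n -> 'rV[R]_n -> R) x : R := \sum_(i < n) u1 i x ^+ 2.
Let T := radial_part u1.
Let G2 := grad_sqr u1.
Let P x := u x `^ crit.

Lemma N_gt2 : 2 < n%:R :> R.
Proof. by rewrite ltr_nat. Qed.

Lemma crit_expo : crit = expo + 1.
Proof. by rewrite /crit /expo /critical_exp /sobolev_exp; have := N_gt2 => h; field; lra. Qed.

Lemma crit_mul x : P x = u x * u x `^ expo.
Proof.
have u0 : u x != 0 by rewrite gt_eqF.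
by rewrite /P crit_expo powRD ?u0 ?implybT // powRr1 ?ltW // mulrC.
Qed.

Lemma crit_gt0 : 0 < crit.
Proof. by have := N_gt2; rewrite /crit /critical_exp => h; rewrite divr_gt0 ?mulr_gt0 ?subr_gt0 //; lra. Qed.

Lemma cont_radial_part (f1 : 'I_n -> 'rV[R]_n -> R) :
  (forall i, continuous (f1 i)) -> continuous (radial_part f1).
Proof. by move=> cf; apply: contS => i; apply: contM; [exact: cont_coord|exact: cf]. Qed.

Lemma cont_grad_sqr : continuous G2.
Proof. by apply: contS => i; apply: contX; exact: u1_cont. Qed.

Lemma cont_P : continuous P.
Proof. exact: cont_powR. Qed.

Lemma cont_expo : continuous (fun x => u x `^ expo).
Proof. exact: cont_powR. Qed.

Lemma der_P i x : is_derive x (e_ i) P (crit * u x `^ expo * u1 i x).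
Proof.
have -> : expo = crit - 1 by rewrite crit_expo addrK.
exact: der_powR.
Qed.

Lemma der_radial_part i x : is_derive x (e_ i) T
  (u1 i x + \sum_(j < n) x 0 j * u2 i j x).
Proof.
have H j := derM (der_coord j x (e_ i)) (u1_der j i x).
apply: derE (derS H) _; rewrite big_split /= sum_mul_delta addrC; congr (_ + _).
by apply: eq_bigr => j _; rewrite u2_sym.
Qed.

Lemma der_grad_sqr i x : is_derive x (e_ i) G2 (2 * \sum_(j < n) u1 j x * u2 i j x).
Proof.
have H j := derX 1 (u1_der j i x).
apply: derE (derS H) _; rewrite mulr_sumr; apply: eq_bigr => j _.
by rewrite u2_sym expr1 mulrA.
Qed.

Section Profile.
Variables (phi dphi : R -> R) (B : R).
Hypotheses (D : forall t, is_derive t (1 : R) phi (dphi t)) (cd : continuous dphi)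
  (hB : forall t, B <= t -> phi t = 0).

(** Divergence theorem for phi(rho) x. *)
Lemma volume_identity : I (fun x => N * phi (rho x) + 2 * dphi (rho x) * rho x) = 0.
Proof.
rewrite -[RHS](@int_radial_div _ _ _ II _ _ _ (fun i x => x 0 i) (fun i x => 1) D cd hB).
- by congr I; apply/funext => x; rewrite sumr_const card_ord sum_sqr_coord [phi _ * _]mulrC.
- by move=> i; exact: cont_coord.
- by move=> i; exact: contC.
- by move=> i x; apply: derE (der_coord i x (e_ i)) _; rewrite e_E eqxx.
Qed.

(** Divergence theorem for phi(rho) u^q x. No equation for u is used: this is how the energy moves
    along rays. *)
Lemma transport_identity :
  I (fun x => phi (rho x) * (N * P x + crit * u x `^ expo * T x)
              + 2 * dphi (rho x) * (rho x * P x)) = 0.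
Proof.
rewrite -[RHS](@int_radial_div _ _ _ II _ _ _ (fun i x => x 0 i * P x)
  (fun i x => x 0 i * (crit * u x `^ expo * u1 i x) + P x) D cd hB).
- congr I; apply/funext => x; congr (_ * _ + _ * _).
    rewrite big_split /= sumr_const card_ord mulr_natl addrC; congr (_ + _).
    by rewrite /T /radial_part mulr_sumr; apply: eq_bigr => i _; ring.
  by rewrite -sum_sqr_coord mulr_suml; apply: eq_bigr => i _; rewrite mulrA.
- by move=> i; apply: contM; [exact: cont_coord|exact: cont_P].
- move=> i; apply: contD; last exact: cont_P.
  apply: contM; first exact: cont_coord.
  apply: contM; last exact: u1_cont.
  by apply: contM; [exact: contC|exact: cont_expo].
- move=> i x; apply: derE (derM (der_coord i x (e_ i)) (der_P i x)) _.
  by rewrite e_E eqxx mulr1.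
Qed.

Hypothesis u_sol : forall x, (\sum_(i < n) u2 i i x) + K x * u x `^ expo = 0.

(** Divergence theorem for phi(rho) u grad u, with the Laplacian replaced through the equation. *)
Lemma energy_identity :
  I (fun x => phi (rho x) * (G2 x - K x * P x)
              + 2 * dphi (rho x) * (u x * T x)) = 0.
Proof.
rewrite -[RHS](@int_radial_div _ _ _ II _ _ _ (fun i x => u x * u1 i x)
  (fun i x => u x * u2 i i x + u1 i x * u1 i x) D cd hB).
- congr I; apply/funext => x.
  have L : \sum_(i < n) u2 i i x = - (K x * u x `^ expo) by have := u_sol x; lra.
  have E : \sum_(i < n) u1 i x * u1 i x = G2 x by apply: eq_bigr => i _; rewrite expr2.
  have E' : \sum_(i < n) x 0 i * (u x * u1 i x) = u x * T x.
    by rewrite /T /radial_part mulr_sumr; apply: eq_bigr => i _; ring.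
  by rewrite big_split /= -mulr_sumr L E E' crit_mul; ring.
- by move=> i; exact: contM.
- by move=> i; apply: contD; exact: contM.
Qed.

(** The field is phi(rho) times (x.grad u) grad u - |grad u|^2 x / 2 + K u^q x / q + (N - 2)/2 u
    grad u. Apart from the cutoff its divergence is (x.grad K) u^q / q: the terms in |grad u|^2
    cancel as 1 - N/2 + (N - 2)/2 = 0, those in K u^q because N / q = (N - 2)/2, and those in x.grad
    u by the equation. *)
Lemma pohozaev_identity :
  I (fun x => phi (rho x) * (radial_part K1 x * P x / crit)
      + 2 * dphi (rho x) * (T x ^+ 2 - rho x * G2 x / 2 + rho x * K x * P x / crit
                            + (N - 2) / 2 * (u x * T x))) = 0.
Proof.
have q0 := crit_gt0; have N2 := N_gt2.
pose S2 i x := \sum_(j < n) x 0 j * u2 i j x.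
pose S3 i x := \sum_(j < n) u1 j x * u2 i j x.
have cS2 i : continuous (S2 i).
  by apply: contS => j; apply: contM; [exact: cont_coord|].
have cS3 i : continuous (S3 i) by apply: contS => j; exact: contM.
pose F i x := T x * u1 i x - 1 / 2 * (x 0 i * G2 x)
     + 1 / crit * (x 0 i * (K x * P x)) + (N - 2) / 2 * (u x * u1 i x).
pose dF i x := (T x * u2 i i x + u1 i x * (u1 i x + S2 i x))
     - 1 / 2 * (x 0 i * (2 * S3 i x) + G2 x * e_ i 0 i)
     + 1 / crit * (x 0 i * (K x * (crit * u x `^ expo * u1 i x) + P x * K1 i x)
                     + K x * P x * e_ i 0 i)
     + (N - 2) / 2 * (u x * u2 i i x + u1 i x * u1 i x).
have cT := cont_radial_part u1_cont; have cG := cont_grad_sqr; have cP := cont_P.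
have cX i : continuous (fun x : 'rV[R]_n => x 0 i) := @cont_coord R n i.
have cE := cont_expo.
have cc (k : R) := @contC R 'rV[R]_n k.
have cF i : continuous (F i).
  have c1 := contB (contM cT (@u1_cont i)) (contM (cc (1 / 2)) (contM (cX i) cG)).
  have c2 := contM (cc (1 / crit)) (contM (cX i) (contM K_cont cP)).
  have c3 := contM (cc ((N - 2) / 2)) (contM u_cont (@u1_cont i)).
  exact: contD (contD c1 c2) c3.
have cdF i : continuous (dF i).
  have c1 := contD (contM cT (@u2_cont i i)) (contM (@u1_cont i) (contD (@u1_cont i) (cS2 i))).
  have c2 := contM (cc (1 / 2)) (contD (contM (cX i) (contM (cc 2) (cS3 i))) (contM cG (cc (e_ i 0 i)))).
  have c3 := contD (contM K_cont (contM (contM (cc crit) cE) (@u1_cont i))) (contM cP (@K1_cont i)).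
  have c4 := contM (cc (1 / crit)) (contD (contM (cX i) c3) (contM (contM K_cont cP) (cc (e_ i 0 i)))).
  have c5 := contM (cc ((N - 2) / 2)) (contD (contM u_cont (@u2_cont i i)) (contM (@u1_cont i) (@u1_cont i))).
  exact: contD (contD (contB c1 c2) c4) c5.
have DF i x : is_derive x (e_ i) (F i) (dF i x).
  have d1 := derM (der_radial_part i x) (u1_der i i x).
  have d2 := derZ (1 / 2) (derM (der_coord i x (e_ i)) (der_grad_sqr i x)).
  have d3 := derZ (1 / crit) (derM (der_coord i x (e_ i)) (derM (K_der i x) (der_P i x))).
  have d4 := derZ ((N - 2) / 2) (derM (u_der i x) (u1_der i i x)).
  exact: derD (derD (derB d1 d2) d3) d4.
rewrite -[RHS](@int_radial_div _ _ _ II _ _ _ F dF D cd hB cF cdF DF).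
congr I; apply/funext => x.
have L : \sum_(i < n) u2 i i x = - (K x * u x `^ expo) by have := u_sol x; lra.
have E1 : \sum_(i < n) dF i x = radial_part K1 x * P x / crit.
  pose A i := u2 i i x; pose B0 i := u1 i x ^+ 2; pose A1 i := x 0 i * u1 i x.
  have -> : \sum_(i < n) dF i x = \sum_(i < n) ((T x + (N - 2) / 2 * u x) * A i
      + N / 2 * B0 i + (u1 i x * S2 i x - x 0 i * S3 i x)
      + (K x * P x / crit - G2 x / 2) + K x * u x `^ expo * A1 i + P x / crit * (x 0 i * K1 i x)).
    apply: eq_bigr => i _; rewrite /dF /A /B0 /A1 e_E eqxx /=; field.
    by rewrite gt_eqF.
  rewrite !big_split /= !sumrN -!mulr_sumr !sumr_const card_ord L.
  rewrite -/(radial_part K1 x) -/(T x) -/(G2 x).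
  (* The two contractions of the Hessian with x and grad u agree by its symmetry, so no second
     derivative other than the Laplacian survives. *)
  have -> : \sum_(i < n) u1 i x * S2 i x = \sum_(i < n) x 0 i * S3 i x.
    rewrite /S2 /S3; under eq_bigr do rewrite mulr_sumr.
    under [RHS]eq_bigr do rewrite mulr_sumr.
    rewrite exchange_big; apply: eq_bigr => i _; apply: eq_bigr => j _.
    by rewrite u2_sym; ring.
  have N0 : N - 2 != 0 by rewrite gt_eqF // subr_gt0.
  have N0' : N != 0 by rewrite gt_eqF // (lt_trans _ N2).
  have -> : \sum_(i < n) B0 i = G2 x by [].
  have -> : \sum_(i < n) A1 i = T x by [].
  rewrite -(mulr_natr crit^-1) -(mulr_natr 2^-1) -/N crit_mul /crit /critical_exp -/N; field.
  by rewrite N0 N0'.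
have E2 : \sum_(i < n) x 0 i * F i x = T x ^+ 2 - rho x * G2 x / 2 + rho x * K x * P x / crit
                            + (N - 2) / 2 * (u x * T x).
  have -> : \sum_(i < n) x 0 i * F i x = \sum_(i < n) ((T x + (N - 2) / 2 * u x) * (x 0 i * u1 i x)
      + (K x * P x / crit - G2 x / 2) * (x 0 i * x 0 i)).
    by apply: eq_bigr => i _; rewrite /F; field; rewrite gt_eqF.
  rewrite big_split /= -!mulr_sumr sum_sqr_coord.
  have -> : \sum_(i < n) x 0 i * u1 i x = T x by [].
  ring.
by rewrite E1 E2.
Qed.

End Profile.
End Identities.

(** * An integrable radial weight *)

Section ScaledCutoffs.
Context {R : realType} (m : nat).
Let n := m.+3.
Implicit Types (t r : R).

Lemma der_scale (phi : R -> R) d r t : is_derive (t / r) (1 : R) phi d ->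
  is_derive t (1 : R) (fun s => phi (s / r)) (d / r).
Proof.
move=> D; have H := derM (is_derive_id t (1 : R)) (derC t (1 : R) r^-1).
have H2 := @der_comp _ _ phi (fun s : R => s * r^-1) t 1 _ _ D H.
by apply: (derE H2); rewrite mulr0 add0r mulr1.
Qed.

Lemma cont_id : continuous (fun t : R => t).
Proof. by move=> t; exact: cvg_id. Qed.

Lemma cont_scale (phi : R -> R) r : continuous phi -> continuous (fun t => phi (t / r)).
Proof. by move=> c; exact: (cont_comp c (contM cont_id (@contC R R r^-1))). Qed.

(** At t = [rho x] this is a substitute for |x|^(4 a) that is smooth at the origin. The exponent
    -N/4 - 1 gives decay like |x|^(-N-4), which is integrable. *)
Definition decay a t := (1 + t ^+ 2) `^ a.

Lemma decay_base_gt0 t : 0 < 1 + t ^+ 2.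
Proof. by rewrite ltr_wpDr ?sqr_ge0. Qed.

Lemma decay_ge0 a t : 0 <= decay a t. Proof. exact: powR_ge0. Qed.

Lemma cont_decay a : continuous (decay a).
Proof.
apply: cont_powR => [|t]; last exact: decay_base_gt0.
by apply: contD; [exact: contC|apply: contX; exact: cont_id].
Qed.

Lemma der_decay a t : is_derive t (1 : R) (decay a) (2 * a * t * decay (a - 1) t).
Proof.
have H := derD (derC t (1 : R) 1) (derX 1 (is_derive_id t (1 : R))).
have H2 := @der_powR _ _ (fun s : R => 1 + s ^+ 2) a t 1 _ (decay_base_gt0 t) H.
by apply: (derE H2); rewrite /decay expr1; ring.
Qed.

Lemma decay_pred a t : decay a t = (1 + t ^+ 2) * decay (a - 1) t.
Proof.
have h := decay_base_gt0 t; rewrite /decay -{2}[1 + t ^+ 2]powRr1 ?ltW // -powRD ?(gt_eqF h) ?implybT //.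
by congr (_ `^ _); ring.
Qed.

Lemma decay_le r t : 0 < r -> r ^+ 2 <= t -> decay (- (n%:R / 4)) t <= r ^- n.
Proof.
move=> r0 rt; have t0 : 0 <= t by apply: le_trans rt; rewrite sqr_ge0.
have -> : r ^- n = (r ^+ 4) `^ (- (n%:R / 4)).
  rewrite powRN -[r ^+ 4]powR_mulrn ?ltW // -powRrM; congr _^-1.
  by rewrite mulrC divfK // powR_mulrn // ltW.
rewrite /decay !powRN lef_pV2 ?posrE ?powR_gt0 ?decay_base_gt0 ?exprn_gt0 //.
apply: ge0_ler_powR; rewrite ?nnegrE ?divr_ge0 ?ltW ?exprn_gt0 ?decay_base_gt0 //.
apply: (@le_lt_trans _ _ (t ^+ 2)); last by rewrite ltrDr.
by rewrite (_ : r ^+ 4 = (r ^+ 2) ^+ 2); [rewrite lerXn2r ?nnegrE ?sqr_ge0|ring].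
Qed.

End ScaledCutoffs.

Section Estimates.
Context {R : realType} (m : nat).
Local Notation n := m.+3.
Variable (I : ('rV[R]_n -> R) -> R).
Hypothesis II : is_integral I.
Hypothesis I_upper : forall f (B L : R), test_function f -> 1 <= L -> 0 <= B ->
  (forall x : 'rV[R]_n, f x <= B) -> (forall x, L <= `|x| -> f x = 0) ->
  I f <= B * (4 * L) ^+ n.
Let N : R := n%:R.
Let c0 : R := 2 * n.+1%:R ^+ 2.
Implicit Types (x y : 'rV[R]_n) (r : R).

Lemma c0_gt0 : 0 < c0. Proof. by rewrite mulr_gt0 // exprn_gt0. Qed.
Lemma N_gt0 : 0 < N. Proof. by rewrite ltr0n. Qed.

Lemma scaled_ge r t : 0 < r -> 2 * r ^+ 2 <= t -> 2 <= t / r ^+ 2.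
Proof. by move=> r0 h; rewrite ler_pdivlMr ?exprn_gt0. Qed.

(** With k(t) = (1 + t^2)^(-N/4) one has N k + 2 t k' = N (1 + t^2)^(-N/4-1), so N times the weight
    is the divergence of k(rho) x. After cutting off, only a term on the annulus is left, where k <=
    r^(-n) compensates the volume; hence a bound independent of r. *)
Lemma int_decay r : 1 <= r ->
  I (fun x => cutoff n (rho x / r ^+ 2) * decay (- (N / 4) - 1) (rho x)) <= 2 * c0 * 8 ^+ n / N.
Proof.
move=> r1; have r0 : 0 < r by lra.
have r20 : 0 < r ^+ 2 by rewrite exprn_gt0.
have NN := N_gt0; have c00 := c0_gt0.
pose g t : R := cutoff n (t / r ^+ 2); pose k := decay (R := R) (- (N / 4)).
pose dg t : R := - (n.+1%:R ^+ 2 * bump n (t / r ^+ 2) ^+ n) / r ^+ 2.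
have Dg t : is_derive t (1 : R) g (dg t) by apply: der_scale; exact: der_cutoff.
have cg : continuous g by apply: cont_scale; exact: cont_cutoff.
have cdg : continuous dg.
  apply: contM; last exact: contC.
  by apply/contN/contM; [exact: contC|apply: contX; apply: cont_scale; exact: cont_bump].
have D t := derM (Dg t) (der_decay (- (N / 4)) t).
have ck := @cont_decay R (- (N / 4)); have ch := @cont_decay R (- (N / 4) - 1).
have cd : continuous (fun t => g t * (2 * - (N / 4) * t * decay (- (N / 4) - 1) t) + k t * dg t).
  apply: contD; apply: contM => //; apply: contM => //.
  by apply: contM; [exact: contC|exact: cont_id].
have hB t : 2 * r ^+ 2 <= t -> g t * k t = 0.
  by move=> h; rewrite /g cutoff_eq0 ?mul0r // scaled_ge.
have VI := volume_identity II D cd hB.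
have tgh : test_function (fun x : 'rV[R]_n => g (rho x) * decay (- (N / 4) - 1) (rho x)).
  apply: (@test_radial R n (fun t => g t * decay (- (N / 4) - 1) t) (2 * r ^+ 2)); first exact: contM.
  by move=> t h; rewrite /g cutoff_eq0 ?mul0r // scaled_ge.
pose w t : R := - (2 * t * dg t * k t).
have cw : continuous w.
  apply/contN/contM => //; apply: contM => //.
  by apply: contM; [exact: contC|exact: cont_id].
have w0 t : 2 * r ^+ 2 <= t -> w t = 0.
  by move=> h; rewrite /w /dg bump_eq0 ?scaled_ge ?orbT // expr0n /=; ring.
have tw : test_function (fun x : 'rV[R]_n => w (rho x)) by exact: test_radial w0.
pose psi t : R := N * (g t * k t) +
  2 * (g t * (2 * - (N / 4) * t * decay (- (N / 4) - 1) t) + k t * dg t) * t.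
have tpsi : test_function (fun x : 'rV[R]_n => psi (rho x)).
  apply: (@test_radial R n psi (2 * r ^+ 2)).
    apply: contD; first by apply: contM; [exact: contC|exact: contM].
    by apply: contM; [apply: contM; [exact: contC|exact: cd]|exact: cont_id].
  move=> t h; rewrite /psi hB // /g cutoff_eq0 ?scaled_ge // /dg bump_eq0 ?scaled_ge ?orbT //.
  by rewrite expr0n /=; ring.
have E : N * I (fun x => g (rho x) * decay (- (N / 4) - 1) (rho x)) = I (fun x => w (rho x)).
  rewrite -(intZ II) // -[RHS]add0r -VI -(intD II) //.
  congr I; apply/funext => x; rewrite /w /k (decay_pred (- (N / 4))) -/N.
  by field.
have w_le x : w (rho x) <= 2 * c0 * r ^- n.
  have kr0 : 0 <= r ^- n by rewrite invr_ge0 exprn_ge0 ?ltW.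
  have -> : w (rho x) = c0 * (rho x / r ^+ 2 * bump n (rho x / r ^+ 2) ^+ n) * k (rho x).
    by rewrite /w /dg /c0; ring.
  have [h|/negbTE h] := boolP ((rho x / r ^+ 2 <= 1) || (2 <= rho x / r ^+ 2)).
    rewrite bump_eq0 // expr0n /= !mulr0 mul0r; apply: mulr_ge0 => //.
    by apply: mulr_ge0 => //; exact: ltW.
  move: h => /negbT; rewrite negb_or -!ltNge => /andP[h1 h2].
  have kx : k (rho x) <= r ^- n by apply: decay_le => //; rewrite ltW // -[ltLHS]mul1r -ltr_pdivlMr.
  have k0 : 0 <= k (rho x) by exact: decay_ge0.
  have b0 : 0 <= bump n (rho x / r ^+ 2) ^+ n by rewrite exprn_ge0 ?bump_ge0.
  have b1 : bump n (rho x / r ^+ 2) ^+ n <= 1 by rewrite exprn_ile1 ?bump_ge0 ?bump_le1.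
  have t0 : 0 <= rho x / r ^+ 2 by apply: le_trans (ltW h1).
  have H : rho x / r ^+ 2 * bump n (rho x / r ^+ 2) ^+ n * k (rho x) <= 2 * r ^- n.
    apply: ler_pM => //; first exact: mulr_ge0.
    by rewrite -[leRHS]mulr1; apply: ler_pM => //; exact: ltW.
  by have := ler_wpM2l (ltW c00) H; lra.
have w_supp x : 2 * r <= `|x| -> w (rho x) = 0.
  exact: (radial_support r0 w0).
rewrite -(ler_pM2l NN) E mulrC divfK ?gt_eqF //.
apply: le_trans (I_upper tw _ _ w_le w_supp) _; [lra|by rewrite mulr_ge0 ?mulr_ge0 ?invr_ge0 ?exprn_ge0 ?ltW|].
have -> : 4 * (2 * r) = 8 * r by ring.
have e : r ^- n * r ^+ n = 1 by rewrite mulVf // expf_neq0 ?gt_eqF.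
have -> : 2 * c0 * r ^- n * (8 * r) ^+ n = 2 * c0 * 8 ^+ n * (r ^- n * r ^+ n).
  by rewrite exprMn; ring.
by rewrite e mulr1.
Qed.

End Estimates.

Ltac nneg := repeat first [ done | by apply: ltW | exact: normr_ge0 | apply: divr_ge0 | apply: exprn_ge0
  | apply: mulr_ge0 | apply: addr_ge0 ].

(** * Energy bound on annuli *)

Section RealInequalities.
Context {R : realType}.

(** Whichever of s and l is larger decides which term dominates. With s = [bump] times U this trades
    u^2 = U^(n-2) for the energy density U^n and a constant. *)
Lemma young_power (s l : R) m : 0 <= s -> 0 < l ->
  s ^+ m.+1 <= s ^+ m.+3 / l ^+ 2 + l ^+ m.+1.
Proof.
move=> s0 l0; have [h|/ltW h] := leP s l.
  apply: (@le_trans _ _ (l ^+ m.+1)); first by rewrite lerXn2r ?nnegrE // ltW.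
  by rewrite lerDr divr_ge0 ?exprn_ge0 // ltW.
apply: (@le_trans _ _ (s ^+ m.+3 / l ^+ 2)); last by rewrite lerDl exprn_ge0 ?ltW.
rewrite ler_pdivlMr ?exprn_gt0 // -[m.+3]addn2 exprD.
by rewrite ler_wpM2l ?exprn_ge0 // lerXn2r ?nnegrE // ltW.
Qed.

Lemma expr_le_lower (b : R) i j : 0 <= b <= 1 -> (i <= j)%N -> b ^+ j <= b ^+ i.
Proof.
move=> /andP[b0 b1] ij; rewrite -(subnKC ij) exprD ler_piMr ?exprn_ge0 //.
exact: exprn_ile1.
Qed.

Lemma combine (a x y b d d' f f' : R) : - x <= y -> a <= b -> d <= d' -> f <= f' ->
  a - x - (d' + f') <= y + b - d - f.
Proof. by move=> *; lra. Qed.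

(** The main term is 2 z, and one half of it swallows the share w of the error y. *)
Lemma absorb (z x y z2 z3 w : R) : 2 * z - x - y <= 0 -> x <= z2 -> y <= w + z3 ->
  w <= z -> z <= z2 + z3.
Proof. by move=> *; lra. Qed.

(* Pohozaev identity minus half the energy identity: the gradient terms cancel and
   [1/2 - 1/q = 1/N] is left in front of [K u^q]. *)
Lemma pohozaev_algebra (s M N g TK P T G K u t bn bm db : R)
    (q := 2 * N / (N - 2)) (c := 2 * M ^+ 2) :
  s != 0 -> M != 0 -> N != 0 -> N - 2 != 0 ->
  s / c * (g * (TK * P / q) + 2 * (- (M ^+ 2 * bn) / s) *
    (T ^+ 2 - t * G / 2 + t * K * P / q + (N - 2) / 2 * (u * T))) +
  - (1 / 2) * (t * bn * (G - K * P) + 2 * (t * (N * bm * db / s) + bn * 1) * (u * T)) =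
  s / (c * q) * (g * (TK * P)) + 1 / N * (t * bn * K * P) - bn * T ^+ 2
   - (N / 2 * bn + N * (t / s) * bm * db) * (u * T).
Proof. by move=> s0 M0 N0 N20; rewrite /q /c; field; rewrite s0 M0 N0 N20. Qed.

End RealInequalities.

Section AnnulusEnergy.
Context {R : realType} (m : nat).
Local Notation n := m.+3.
Variable (I : ('rV[R]_n -> R) -> R).
Hypothesis II : is_integral I.
Hypothesis I_upper : forall f (B L : R), test_function f -> 1 <= L -> 0 <= B ->
  (forall x : 'rV[R]_n, f x <= B) -> (forall x : 'rV[R]_n, L <= `|x| -> f x = 0) ->
  I f <= B * (4 * L) ^+ n.
Variables (u K : 'rV[R]_n -> R) (u1 K1 : 'I_n -> 'rV[R]_n -> R)
  (u2 : 'I_n -> 'I_n -> 'rV[R]_n -> R).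
Hypotheses (u_cont : continuous u) (u1_cont : forall i, continuous (u1 i))
  (u2_cont : forall i j, continuous (u2 i j)).
Hypotheses (K_cont : continuous K) (K1_cont : forall i, continuous (K1 i)).
Hypotheses (u_der : forall i (x : 'rV[R]_n), is_derive x (e_ i) u (u1 i x))
  (u1_der : forall i j (x : 'rV[R]_n), is_derive x (e_ j) (u1 i) (u2 i j x))
  (K_der : forall i (x : 'rV[R]_n), is_derive x (e_ i) K (K1 i x)).
Hypothesis u2_sym : forall i j x, u2 i j x = u2 j i x.
Hypothesis u_pos : forall x, 0 < u x.
Hypothesis u_sol : forall x,
  (\sum_(i < n) u2 i i x) + K x * u x `^ sobolev_exp R n = 0.
Let N : R := n%:R.
Let q : R := critical_exp R n.
Let c0 : R := 2 * n.+1%:R ^+ 2.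
Implicit Types (x y : 'rV[R]_n) (r t : R) (i j : 'I_n).
Let T x : R := radial_part u1 x.
Let TK x : R := radial_part K1 x.
Let P x : R := u x `^ q.
Let n3 : (3 <= n)%N. Proof. by []. Qed.

(* [U = u^(2/(n-2))] scales like an inverse length and turns the exponents into integers:
   [u^q = U^n] and [u^2 = U^(n-2)]. *)
Definition conf x : R := u x `^ (2 / (n%:R - 2)).

Let N2 : 2 < N. Proof. exact: N_gt2. Qed.
Let q0 : 0 < q. Proof. exact: crit_gt0. Qed.
Let c00 : 0 < c0. Proof. by rewrite mulr_gt0 // exprn_gt0. Qed.

Lemma conf_crit x : conf x ^+ n = u x `^ critical_exp R n.
Proof.
rewrite -powR_mulrn ?powR_ge0 // -powRrM; congr (_ `^ _).
by rewrite /critical_exp; ring.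
Qed.

Lemma conf_sqr x : conf x ^+ m.+1 = u x ^+ 2.
Proof.
rewrite -powR_mulrn ?powR_ge0 // -powRrM -powR_mulrn ?ltW //; congr (_ `^ _).
have -> : m.+1%:R = n%:R - 2 :> R by rewrite -[n]addn2 natrD addrK.
by rewrite divfK // gt_eqF // subr_gt0.
Qed.

Variables (a r1 C' C4 : R).
Hypotheses (a_gt0 : 0 < a) (r1_ge1 : 1 <= r1) (C'_ge0 : 0 <= C') (C4_ge0 : 0 <= C4).
Hypothesis K_low : forall x, r1 ^+ 2 <= rho x -> a <= K x.
Hypothesis T_bound : forall x, r1 ^+ 2 <= rho x -> `|radial_part u1 x| <= C' * u x.
Hypothesis KP_low : forall x,
  - (C4 * decay (- (N / 4) - 1) (rho x)) <= radial_part K1 x * u x `^ critical_exp R n.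

(** [C' ^+ 2] stems from the term in T^2, the rest from the term in u T, with rho / r^2 <= 2 and
    |dbump| <= n + 2 on the annulus. *)
Let C6 := C' ^+ 2 + (N / 2 + 2 * N * n.+2%:R) * C'.
Let C5 : R := 2 * c0 * 8 ^+ n / N.

Lemma bump_dom r x : 1 <= r -> bump n (rho x / r ^+ 2) != 0 ->
  (1 <= rho x / r ^+ 2 <= 2) /\ r ^+ 2 <= rho x.
Proof.
move=> r1'; have r20 : 0 < r ^+ 2 by rewrite exprn_gt0 //; lra.
have [h|] := boolP ((rho x / r ^+ 2 <= 1) || (2 <= rho x / r ^+ 2)).
  by rewrite bump_eq0 // eqxx.
rewrite negb_or -!ltNge => /andP[h1 h2] _; split; first by rewrite !ltW.
by move: (ltW h1); rewrite ler_pdivlMr // mul1r.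
Qed.

(** The right side is the combined integrand of [pohozaev_algebra], which integrates to zero. In the
    error terms bump^n and bump^(n-1) are weakened to bump^(n-2), as 0 <= bump <= 1, in order to
    pair with u^2 = U^(n-2). *)
Lemma pohozaev_pointwise r x (b : R := bump n (rho x / r ^+ 2))
    (g : R := cutoff n (rho x / r ^+ 2)) : r1 <= r ->
  a * r ^+ 2 / N * (b ^+ n * P x)
    - r ^+ 2 * C4 / (c0 * q) * (g * decay (- (N / 4) - 1) (rho x))
    - C6 * (b ^+ m.+1 * u x ^+ 2) <=
  r ^+ 2 / (c0 * q) * (g * (TK x * P x)) + 1 / N * (rho x * b ^+ n * K x * P x)
   - b ^+ n * T x ^+ 2
   - (N / 2 * b ^+ n + N * (rho x / r ^+ 2) * b ^+ m.+2 * dbump n (rho x / r ^+ 2)) * (u x * T x).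
Proof.
move=> rr.
have r1' : 1 <= r by apply: le_trans rr.
have r20 : 0 < r ^+ 2 by rewrite exprn_gt0 //; lra.
have g0 : 0 <= g by exact: cutoff_ge0.
have A : - (r ^+ 2 * C4 / (c0 * q) * (g * decay (- (N / 4) - 1) (rho x))) <=
    r ^+ 2 / (c0 * q) * (g * (TK x * P x)).
  have h := ler_wpM2l g0 (KP_low x).
  have h0 : 0 <= r ^+ 2 / (c0 * q) by apply: divr_ge0; [exact: ltW|apply: mulr_ge0; exact: ltW].
  have := ler_wpM2l h0 h; rewrite -/(TK x) -/(P x); lra.
(* Off the support of [bump] only the term in x.grad K is left; on it rho >= r^2, so the bounds on K
   and T are available. *)
have [b0|bn0] := eqVneq b 0.
  have z k : b ^+ k.+1 = 0 by rewrite b0 expr0n.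
  by move: A; rewrite !z !(mulr0, mul0r, addr0, subr0, sub0r).
have [/andP[t1 t2] rx] := bump_dom r1' bn0.
have rx1 : r1 ^+ 2 <= rho x by apply: le_trans rx; have := r1_ge1; nra.
have NN : 0 < N by rewrite ltr0n.
have CC := C'_ge0.
have b0 : 0 <= b by exact: bump_ge0.
have b1 : b <= 1 by exact: bump_le1.
have db := @dbump_bound R n _ t2.
have P0 : 0 <= P x by exact: powR_ge0.
have bn : 0 <= b ^+ n by rewrite exprn_ge0.
have B : a * r ^+ 2 / N * (b ^+ n * P x) <= 1 / N * (rho x * b ^+ n * K x * P x).
  have h : a * r ^+ 2 <= rho x * K x.
    rewrite [leLHS]mulrC; apply: ler_pM => //; [exact: ltW|exact: ltW|exact: K_low].
  have h0 : 0 <= 1 / N * (b ^+ n * P x) by apply: mulr_ge0; [apply: divr_ge0 => //; exact: ltW|exact: mulr_ge0].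
  have H := ler_wpM2r h0 h.
  have e1 : a * r ^+ 2 / N * (b ^+ n * P x) = a * r ^+ 2 * (1 / N * (b ^+ n * P x)) by ring.
  have e2 : 1 / N * (rho x * b ^+ n * K x * P x) = rho x * K x * (1 / N * (b ^+ n * P x)) by ring.
  by rewrite e1 e2.
have Tb := T_bound rx1; rewrite -/(T x) in Tb.
have u0 := u_pos x.
have bm0 : 0 <= b ^+ m.+1 by rewrite exprn_ge0.
have bb : 0 <= b <= 1 by rewrite b0.
have bn1 : b ^+ n <= b ^+ m.+1 by exact: expr_le_lower bb (leqW (leqnSn _)).
have bn2 : b ^+ m.+2 <= b ^+ m.+1 by exact: expr_le_lower bb (leqnSn _).
have D : b ^+ n * T x ^+ 2 <= C' ^+ 2 * (b ^+ m.+1 * u x ^+ 2).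
  have h : T x ^+ 2 <= C' ^+ 2 * u x ^+ 2.
    by rewrite -exprMn -[T x ^+ 2]real_normK ?num_real // lerXn2r ?nnegrE // mulr_ge0 // ltW.
  have := ler_pM bn (sqr_ge0 (T x)) bn1 h; lra.
have F : (N / 2 * b ^+ n + N * (rho x / r ^+ 2) * b ^+ m.+2 * dbump n (rho x / r ^+ 2)) * (u x * T x)
   <= (N / 2 + 2 * N * n.+2%:R) * C' * (b ^+ m.+1 * u x ^+ 2).
  apply: (le_trans (ler_norm _)); rewrite normrM [`|u x * _|]normrM (gtr0_norm u0).
  have h : `|N / 2 * b ^+ n + N * (rho x / r ^+ 2) * b ^+ m.+2 * dbump n (rho x / r ^+ 2)|
      <= (N / 2 + 2 * N * n.+2%:R) * b ^+ m.+1.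
    apply: (le_trans (ler_normD _ _)).
    have -> : (N / 2 + 2 * N * n.+2%:R) * b ^+ m.+1 =
        N / 2 * b ^+ m.+1 + 2 * N * n.+2%:R * b ^+ m.+1 by ring.
    apply: lerD.
      have h2 : 0 <= N / 2 by rewrite divr_ge0 // ltW.
      by rewrite ger0_norm ?ler_wpM2l // mulr_ge0.
    rewrite normrM ger0_norm; last first.
      apply: mulr_ge0; last by rewrite exprn_ge0.
      by apply: mulr_ge0; [exact: ltW|exact: le_trans t1].
    have -> : 2 * N * n.+2%:R * b ^+ m.+1 = N * 2 * b ^+ m.+1 * n.+2%:R by ring.
    have t0 : 0 <= rho x / r ^+ 2 by exact: le_trans t1.
    apply: ler_pM => //; first by apply: mulr_ge0; [exact: mulr_ge0 (ltW NN) t0|rewrite exprn_ge0].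
    apply: ler_pM => //; [exact: mulr_ge0 (ltW NN) t0|by rewrite exprn_ge0|].
    by rewrite ler_pM2l.
  have h2 : u x * `|T x| <= C' * u x ^+ 2.
    by rewrite [leRHS](_ : _ = u x * (C' * u x)); [rewrite ler_pM2l|ring].
  have := ler_pM (normr_ge0 _) (mulr_ge0 (ltW u0) (normr_ge0 (T x))) h h2.
  lra.
have -> : C6 * (b ^+ m.+1 * u x ^+ 2) = C' ^+ 2 * (b ^+ m.+1 * u x ^+ 2) +
    (N / 2 + 2 * N * n.+2%:R) * C' * (b ^+ m.+1 * u x ^+ 2) by rewrite /C6; ring.
exact: combine A B D F.
Qed.

Lemma test_scaled (phi : R -> R) (f : 'rV[R]_n -> R) s b : continuous phi -> continuous f ->
  0 < s -> (forall t, b <= t -> phi t = 0) ->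
  test_function (fun x => phi (rho x / s) * f x).
Proof.
move=> cp cf s0 h; apply: testM => //.
apply: (@test_radial R n (fun t => phi (t / s)) (b * s)); first exact: cont_scale.
by move=> t ht; apply: h; rewrite ler_pdivlMr.
Qed.

Lemma annulus_energy : exists2 E0, 0 < E0 & forall r, r1 <= r ->
  I (fun x => bump n (rho x / r ^+ 2) ^+ n * P x) <= E0.
Proof.
have NN : 0 < N by rewrite ltr0n.
have cc0 := c00; have qq0 := q0; have aa0 := a_gt0; have CC4 := C4_ge0.
have C60 : 0 <= C6.
  have CC := C'_ge0; rewrite /C6; apply: addr_ge0; first exact: sqr_ge0.
  by apply: mulr_ge0 => //; apply: addr_ge0; [apply: divr_ge0 => //; exact: ltW|apply: mulr_ge0 => //; apply: mulr_ge0 => //; exact: ltW].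
(* Threshold in Young's inequality, so large that C6 / l^2 <= a / (2 N): the energy it produces is
   at most half of the main term. *)
pose l := 1 + 2 * N * C6 / a.
have l1 : 1 <= l by rewrite lerDl divr_ge0 ?mulr_ge0 // ltW.
have l0 : 0 < l by lra.
have Cl : C6 / l ^+ 2 <= a / (2 * N).
  have h : 2 * N * C6 / a <= l ^+ 2.
    have -> : 2 * N * C6 / a = l - 1 by rewrite /l addrC addKr.
    by nra.
  rewrite ler_pdivrMr ?exprn_gt0 //; move: h; rewrite ler_pdivrMr // => h.
  have N20 : 0 < 2 * N by rewrite mulr_gt0.
  by rewrite mulrAC ler_pdivlMr // mulrC [a * _]mulrC.
pose D0 := C4 * C5 / (c0 * q) + C6 * l ^+ m.+1 * 8 ^+ n.
have D00 : 0 <= D0.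
  have h5 : 0 <= C5 by rewrite /C5; nneg.
  by rewrite /D0; nneg.
exists (2 * N * D0 / a + 1); first by rewrite ltr_wpDl //; nneg.
move=> r rr; have r1' : 1 <= r := le_trans r1_ge1 rr.
have r0 : 0 < r by lra.
pose s := r ^+ 2; have s0 : 0 < s by rewrite exprn_gt0.
pose g t : R := cutoff n (t / s).
pose dg t : R := - (n.+1%:R ^+ 2 * bump n (t / s) ^+ n) / s.
pose bn t : R := bump n (t / s) ^+ n.
(* With this weight half the energy identity has the gradient term rho bump^n |grad u|^2 / 2, the
   same as s / c0 times the Pohozaev identity. *)
pose phi t : R := t * bn t.
pose dphi t : R := t * (N * bump n (t / s) ^+ m.+2 * dbump n (t / s) / s) + bn t * 1.
have Dg t : is_derive t (1 : R) g (dg t) by apply: der_scale; exact: der_cutoff.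
have Dp t : is_derive t (1 : R) phi (dphi t).
  have h := der_scale (@der_bumpX R n isT m.+1 (t / s)).
  exact: (derM (is_derive_id t (1 : R)) h).
have cb : continuous (fun t => bump n (t / s)) by apply: cont_scale; exact: cont_bump.
have cbn : continuous bn by exact: contX.
have cdg : continuous dg.
  by apply: contM; [apply/contN/contM => //; exact: contC|exact: contC].
have cdp : continuous dphi.
  apply: contD; last by apply: contM => //; exact: contC.
  apply: contM; first exact: cont_id.
  apply: contM; last exact: contC.
  apply: contM; last by apply: cont_scale; exact: cont_dbump.
  by apply: contM; [exact: contC|exact: contX].
have b0 t : 2 * s <= t -> bump n (t / s) = 0.
  by move=> h; rewrite bump_eq0 // ler_pdivlMr // h orbT.
have hg t : 2 * s <= t -> g t = 0.
  by move=> h; rewrite /g cutoff_eq0 // ler_pdivlMr.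
have hp t : 2 * s <= t -> phi t = 0.
  by move=> h; rewrite /phi /bn b0 // expr0n mulr0.
have hdg t : 2 * s <= t -> 2 * dg t = 0.
  by move=> h; rewrite /dg b0 // expr0n /=; ring.
have hdp t : 2 * s <= t -> 2 * dphi t = 0.
  by move=> h; rewrite /dphi /bn b0 // !expr0n /=; ring.
have PI := pohozaev_identity II n3 u_cont u1_cont u2_cont K_cont K1_cont u_der u1_der K_der
  u2_sym u_pos Dg cdg hg u_sol.
have EI := energy_identity II n3 u_cont u1_cont u2_cont u_der u1_der u_pos Dp cdp hp u_sol.
have cT : continuous T := cont_radial_part u1_cont.
have cTK : continuous TK := cont_radial_part K1_cont.
have cG := cont_grad_sqr u1_cont.
have cP : continuous P := cont_P u_cont u_pos.
have cr := @cont_rho R n.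
have cuT := contM u_cont cT.
pose X1 x : R := g (rho x) * (TK x * P x / q) + 2 * dg (rho x) *
   (T x ^+ 2 - rho x * grad_sqr u1 x / 2 + rho x * K x * P x / q + (N - 2) / 2 * (u x * T x)).
pose X2 x : R := phi (rho x) * (grad_sqr u1 x - K x * P x) + 2 * dphi (rho x) * (u x * T x).
have cg : continuous g by apply: cont_scale; exact: cont_cutoff.
have cphi : continuous phi by apply: contM => //; exact: cont_id.
have c2dg : continuous (fun t => 2 * dg t) by apply: contM => //; exact: contC.
have c2dp : continuous (fun t => 2 * dphi t) by apply: contM => //; exact: contC.
have tg := @test_radial R n g (2 * s) cg hg.
have tp := @test_radial R n phi (2 * s) cphi hp.
have t2dg := @test_radial R n (fun t => 2 * dg t) (2 * s) c2dg hdg.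
have t2dp := @test_radial R n (fun t => 2 * dphi t) (2 * s) c2dp hdp.
have cc (k : R) := @contC R 'rV[R]_n k.
have cTP : continuous (fun x => TK x * P x / q) by exact: contM (contM cTK cP) (cc q^-1).
have cQ : continuous (fun x => T x ^+ 2 - rho x * grad_sqr u1 x / 2 + rho x * K x * P x / q
    + (N - 2) / 2 * (u x * T x)).
  have q1 := contB (@contX _ _ _ 2 cT) (contM (contM cr cG) (cc 2^-1)).
  have q2 := contM (contM (contM cr K_cont) cP) (cc q^-1).
  exact: contD (contD q1 q2) (contM (cc ((N - 2) / 2)) cuT).
have cE : continuous (fun x => grad_sqr u1 x - K x * P x) by exact: contB cG (contM K_cont cP).
have tX1 : test_function X1 by exact: testD (testM cTP tg) (testM cQ t2dg).
have tX2 : test_function X2 by exact: testD (testM cE tp) (testM cuT t2dp).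
pose L1 x := bump n (rho x / s) ^+ n * P x.
pose L2 x := cutoff n (rho x / s) * decay (- (N / 4) - 1) (rho x).
pose L3 x := bump n (rho x / s) ^+ m.+1 * u x ^+ 2.
have tL1 : test_function L1.
  apply: (@test_scaled (fun t => bump n t ^+ n) P s 2) => //.
    by apply: contX; exact: cont_bump.
  by move=> t h; rewrite bump_eq0 ?h ?orbT // expr0n.
have tL2 : test_function L2.
  apply: (@test_scaled (cutoff n) (fun x => decay (- (N / 4) - 1) (rho x)) s 2) => //.
  - exact: cont_cutoff.
  - by apply: cont_comp => //; exact: cont_decay.
  - by move=> t h; rewrite cutoff_eq0.
have tL3 : test_function L3.
  apply: (@test_scaled (fun t => bump n t ^+ m.+1) (fun x => u x ^+ 2) s 2) => //.
  - by apply: contX; exact: cont_bump.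
  - exact: contX.
  - by move=> t h; rewrite bump_eq0 ?h ?orbT // expr0n.
have t1 := testZ (a * s / N) tL1.
have t2 := testZ (s * C4 / (c0 * q)) tL2.
have t3 := testZ C6 tL3.
have key : a * s / N * I L1 - s * C4 / (c0 * q) * I L2 - C6 * I L3 <= 0.
  have IX : I (fun x => s / c0 * X1 x + (- (1 / 2)) * X2 x) = 0.
    have I1 : I X1 = 0 := PI.
    have I2 : I X2 = 0 := EI.
    by rewrite (int_lin II) ?(intZ II) ?I1 ?I2 ?mulr0 ?addr0 //; exact: testZ.
  rewrite -IX -!(intZ II) // -!(intB II) //; last exact: testB.
  apply: (int_le II).
  - by apply: testB => //; exact: testB.
  - by apply: testD; exact: testZ.
  move=> x; rewrite /X1 /X2 /phi /dg /dphi /bn pohozaev_algebra.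
  - exact: pohozaev_pointwise.
  - by rewrite gt_eqF.
  - by rewrite pnatr_eq0.
  - by rewrite gt_eqF.
  - by rewrite gt_eqF // subr_gt0.
have IL2 : I L2 <= C5 by exact: int_decay.
have IL1 : 0 <= I L1.
  by apply: (int_ge0 II) => // x; rewrite mulr_ge0 ?exprn_ge0 ?bump_ge0 ?powR_ge0.
have IL3 : I L3 <= s / l ^+ 2 * I L1 + l ^+ m.+1 * 8 ^+ n * s.
  (* A compactly supported stand-in for the constant 1: it equals 1 wherever [bump] is nonzero.
     Young's inequality is applied at the threshold l / r, an inverse length like U, so the constant
     term integrates to l^(n-2) 8^n r^2. *)
  pose g2 x : R := cutoff n (rho x / (2 * s)) * 1.
  have s20 : 0 < 2 * s by rewrite mulr_gt0.
  have tg2 : test_function g2.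
    exact: (@test_scaled (cutoff n) (fun=> 1) (2 * s) 2 (@cont_cutoff R n) (cc 1) s20
      (@cutoff_eq0 R n)).
  have Ig2 : I g2 <= 1 * (4 * (2 * r)) ^+ n.
    apply: I_upper => //; first lra.
      by move=> x; rewrite /g2 mulr1 cutoff_le1.
    move=> x hx; rewrite /g2 cutoff_eq0 ?mul0r // ler_pdivlMr //.
    by apply: le_trans (sqr_norm_le_rho x); rewrite /s; nra.
  have lr0 : 0 < l / r by rewrite divr_gt0.
  have h : I L3 <= I (fun x => s / l ^+ 2 * L1 x + (l / r) ^+ m.+1 * g2 x).
    apply: (int_le II) => //; first by apply: testD; exact: testZ.
    move=> x; have eP : P x = conf x ^+ n by rewrite conf_crit.
    rewrite /L3 /L1 -conf_sqr eP -!exprMn /g2 mulr1.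
    have [z|z] := eqVneq (bump n (rho x / s)) 0.
      rewrite z !mul0r !expr0n /= mulr0 add0r.
      by apply: mulr_ge0; [apply: exprn_ge0; exact: ltW|exact: cutoff_ge0].
    have [/andP[_ t2'] _] := bump_dom r1' z.
    rewrite cutoff_eq1 ?mulr1; last first.
      by rewrite ler_pdivrMr // mul1r; move: t2'; rewrite ler_pdivrMr.
    have y0 : 0 <= bump n (rho x / s) * conf x by rewrite mulr_ge0 ?bump_ge0 ?powR_ge0.
    apply: le_trans (young_power m y0 lr0) _; rewrite lerD2r.
    by rewrite expr_div_n invf_div mulrC -/s.
  apply: (le_trans h); rewrite (int_lin II) ?(intZ II) //; last exact: testZ.
  rewrite lerD2l; have := ler_wpM2l (exprn_ge0 m.+1 (ltW lr0)) Ig2 => h'.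
  apply: (le_trans h'); rewrite mul1r expr_div_n.
  have -> : 4 * (2 * r) = 8 * r by ring.
  rewrite exprMn -[in r ^+ n]addn2 exprD -/s.
  have -> : l ^+ m.+1 / r ^+ m.+1 * (8 ^+ n * (r ^+ m.+1 * s)) =
     l ^+ m.+1 * 8 ^+ n * s * (r ^- m.+1 * r ^+ m.+1) by ring.
  by rewrite mulVf ?mulr1 // expf_neq0 // gt_eqF.
(* Every term is proportional to s = r^2; dividing by it leaves a bound independent of r. *)
have main : s * (a / (2 * N) * I L1) <= s * D0.
  have h1 := ler_wpM2l C60 IL3.
  have k2 : 0 <= s * C4 / (c0 * q) by nneg.
  have h2 := ler_wpM2l k2 IL2.
  have k3 : 0 <= s * I L1 by nneg.
  have h3 := ler_wpM2r k3 Cl.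
  have e1 : C6 * (s / l ^+ 2 * I L1 + l ^+ m.+1 * 8 ^+ n * s) =
     C6 / l ^+ 2 * (s * I L1) + s * (C6 * l ^+ m.+1 * 8 ^+ n) by ring.
  have e2 : a * s / N * I L1 = 2 * (a / (2 * N) * (s * I L1)) by field; rewrite gt_eqF.
  have e3 : s * C4 / (c0 * q) * C5 = s * (C4 * C5 / (c0 * q)) by ring.
  have e4 : s * (a / (2 * N) * I L1) = a / (2 * N) * (s * I L1) by ring.
  have e5 : s * D0 = s * (C4 * C5 / (c0 * q)) + s * (C6 * l ^+ m.+1 * 8 ^+ n) by rewrite /D0; ring.
  rewrite e4 e5; rewrite e1 in h1; rewrite e3 in h2; rewrite e2 in key.
  exact: absorb key h2 h1 h3.
rewrite ler_pM2l // in main.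
have -> : I (fun x => bump n (rho x / r ^+ 2) ^+ n * P x) = I L1 by [].
rewrite -(@ler_pM2l _ (a / (2 * N))) ?divr_gt0 ?mulr_gt0 //.
apply: (le_trans main); rewrite mulrDr mulr1.
have -> : a / (2 * N) * (2 * N * D0 / a) = D0 by field; rewrite !gt_eqF.
by rewrite lerDl; nneg.
Qed.

End AnnulusEnergy.

(** * Energy of thin shells *)

Section ShellEstimate.
Context {R : realType} (m : nat).
Local Notation n := m.+3.
Variable (I : ('rV[R]_n -> R) -> R).
Hypothesis II : is_integral I.
Variables (u : 'rV[R]_n -> R) (u1 : 'I_n -> 'rV[R]_n -> R).
Hypotheses (u_cont : continuous u) (u1_cont : forall i, continuous (u1 i)).
Hypothesis u_der : forall i (x : 'rV[R]_n), is_derive x (e_ i) u (u1 i x).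
Hypothesis u_pos : forall x, 0 < u x.
Let N : R := n%:R.
Let q : R := critical_exp R n.
Implicit Types (x y : 'rV[R]_n) (r t : R) (i j : 'I_n).
Let T x : R := radial_part u1 x.
Let P x : R := u x `^ q.
Let n3 : (3 <= n)%N. Proof. by []. Qed.

Let N2 : 2 < N. Proof. exact: N_gt2. Qed.
Let q0 : 0 < q. Proof. exact: crit_gt0. Qed.

Variables (r1 C' E0 : R).
Hypotheses (r1_ge1 : 1 <= r1) (C'_ge0 : 0 <= C') (E0_gt0 : 0 < E0).
Hypothesis T_bound : forall x, r1 ^+ 2 <= rho x -> `|radial_part u1 x| <= C' * u x.
Hypothesis energy : forall r, r1 <= r ->
  I (fun x => bump n (rho x / r ^+ 2) ^+ n * u x `^ critical_exp R n) <= E0.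

Let C9 := 2 * (N + q * C') + 8 * n.+1%:R * n.+2%:R.

Lemma atan_bound (z : R) : `|atan z| <= 2.
Proof.
have h1 := atan_gtNpi2 z; have h2 := atan_ltpi2 z.
have h3 : pi <= 4 :> R by have := pihalf_02 R; lra.
by rewrite ler_norml; apply/andP; split; lra.
Qed.

(** Bounds what remains of the transport identity when the derivative does not fall on the
    arctangent. Here x' stands for N u^q plus the derivative of u^q along x, t for rho / r^2 and d
    for [dbump]; the 8 collects the factor 2 and the bounds 2 on A and on t. *)
Lemma shell_pointwise (A b bk t d p x' : R) :
  `|A| <= 2 -> 0 <= b <= 1 -> 0 <= bk -> 0 <= t <= 2 -> `|d| <= n.+2%:R -> 0 <= p ->
  `|x'| <= (N + q * C') * p ->
  - (A * (bk * b) * x' + 2 * (A * (n.+1%:R * bk * d)) * (t * p)) <= C9 * (bk * p).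
Proof.
move=> hA /andP[b0 b1] bk0 /andP[t0 t2] hd p0 hx.
have X0 : 0 <= (N + q * C') * p by exact: le_trans hx.
have H1 : `|A * (bk * b) * x'| <= 2 * (N + q * C') * (bk * p).
  rewrite !normrM (ger0_norm b0) (ger0_norm bk0).
  have -> : 2 * (N + q * C') * (bk * p) = 2 * (bk * 1) * ((N + q * C') * p) by ring.
  apply: ler_pM => //; try by nneg.
  by apply: ler_pM => //; [nneg|rewrite ler_wpM2l].
have H2 : `|2 * (A * (n.+1%:R * bk * d)) * (t * p)| <= 8 * n.+1%:R * n.+2%:R * (bk * p).
  rewrite !normrM (ger0_norm bk0) (ger0_norm t0) (ger0_norm p0) !normr_nat.
  have -> : 8 * n.+1%:R * n.+2%:R * (bk * p) = 2 * (2 * (n.+1%:R * bk * n.+2%:R)) * (2 * p) by ring.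
  apply: ler_pM; [by nneg|by nneg| |by rewrite ler_wpM2r].
  rewrite ler_wpM2l //; apply: ler_pM; [by nneg|by nneg|by []|].
  by apply: ler_wpM2l => //; nneg.
have := ler_norm (- (A * (bk * b) * x' + 2 * (A * (n.+1%:R * bk * d)) * (t * p))).
rewrite normrN => h; apply: (le_trans h); apply: (le_trans (ler_normD _ _)).
have -> : C9 * (bk * p) = 2 * (N + q * C') * (bk * p) + 8 * n.+1%:R * n.+2%:R * (bk * p).
  by rewrite /C9; ring.
exact: lerD.
Qed.

(* The transport field carries the bounded weight [atan ((rho - t0) / sg)], whose derivative
   concentrates on the shell [|rho - t0| <= sg] with height [1 / sg]. *)
Lemma shell_estimate r sg t0 f : r1 <= r -> 0 < sg -> test_function f ->
  (forall x, f x <= 2 * rho x * P x *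
     ((1 + ((rho x - t0) / sg) ^+ 2)^-1 / sg) * bump n (rho x / r ^+ 2) ^+ n.+1) ->
  I f <= C9 * E0.
Proof.
move=> rr sg0 tf hf; have r1' : 1 <= r := le_trans r1_ge1 rr.
have rp : 0 < r by lra.
pose s := r ^+ 2; have s0 : 0 < s by rewrite exprn_gt0.
pose A t : R := atan ((t - t0) / sg).
pose dA t : R := (1 + ((t - t0) / sg) ^+ 2)^-1 / sg.
(* Differentiating the power n + 1 leaves bump^n, the weight in the energy bound. *)
pose bk t : R := bump n (t / s) ^+ n.+1.
pose dbk t : R := n.+1%:R * bump n (t / s) ^+ n * dbump n (t / s) / s.
pose phi t : R := A t * bk t.
pose dphi t : R := A t * dbk t + bk t * dA t.
have DA t : is_derive t (1 : R) A (dA t).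
  have h := derM (derB (is_derive_id t (1 : R)) (derC t (1 : R) t0)) (derC t (1 : R) sg^-1).
  have h2 := @der_comp _ _ (@atan R) (fun z : R => (z - t0) * sg^-1) t 1 _ _
     (is_derive1_atan _) h.
  by apply: (derE h2); rewrite /dA mulr0 add0r subr0 mulr1.
have Dbk t : is_derive t (1 : R) bk (dbk t).
  exact: der_scale (@der_bumpX R n isT m.+2 (t / s)).
have Dp t : is_derive t (1 : R) phi (dphi t) := derM (DA t) (Dbk t).
have cz : continuous (fun t : R => (t - t0) / sg).
  by apply: contM; [apply: contB; [exact: cont_id|exact: contC]|exact: contC].
have cA : continuous A by move=> t; apply: continuous_comp; [exact: cz|exact: continuous_atan].
have cb : continuous (fun t => bump n (t / s)) by apply: cont_scale; exact: cont_bump.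
have cbk : continuous bk by exact: contX.
have cdA : continuous dA.
  apply: contM; last exact: contC.
  move=> t; apply: cvgV; first by rewrite gt_eqF // ltr_wpDr ?sqr_ge0.
  have h : continuous (fun t => 1 + ((t - t0) / sg) ^+ 2).
    by apply: contD; [exact: contC|exact: contX].
  exact: h.
have cdbk : continuous dbk.
  apply: contM; last exact: contC.
  apply: contM; last by apply: cont_scale; exact: cont_dbump.
  by apply: contM; [exact: contC|exact: contX].
have cdp : continuous dphi by apply: contD; exact: contM.
have b0 t : 2 * s <= t -> bump n (t / s) = 0.
  by move=> h; rewrite bump_eq0 // ler_pdivlMr // h orbT.
have hp t : 2 * s <= t -> phi t = 0.
  by move=> h; rewrite /phi /bk b0 // expr0n mulr0.
have hdp t : 2 * s <= t -> 2 * dphi t = 0.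
  by move=> h; rewrite /dphi /dbk /bk b0 // !expr0n /=; ring.
have TI := transport_identity II n3 u_cont u1_cont u_der u_pos Dp cdp hp.
have cT : continuous T := cont_radial_part u1_cont.
have cP : continuous P := cont_P u_cont u_pos.
have cE := cont_expo u_cont u_pos.
have cr := @cont_rho R n.
have cphi : continuous phi by exact: contM.
have c2dp : continuous (fun t => 2 * dphi t) by apply: contM => //; exact: contC.
have tp := @test_radial R n phi (2 * s) cphi hp.
have t2dp := @test_radial R n (fun t => 2 * dphi t) (2 * s) c2dp hdp.
have cc (k : R) := @contC R 'rV[R]_n k.
have cF : continuous (fun x => N * P x + q * u x `^ sobolev_exp R n * T x).
  exact: contD (contM (cc N) cP) (contM (contM (cc q) cE) cT).
pose X x : R := phi (rho x) * (N * P x + q * u x `^ sobolev_exp R n * T x)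
   + 2 * dphi (rho x) * (rho x * P x).
have tX : test_function X by exact: testD (testM cF tp) (testM (contM cr cP) t2dp).
pose L1 x := bump n (rho x / s) ^+ n * P x.
have tL1 : test_function L1.
  apply: (@test_scaled R m (fun t => bump n t ^+ n) P s 2) => //.
    by apply: contX; exact: cont_bump.
  by move=> t h; rewrite bump_eq0 ?h ?orbT // expr0n.
have C90 : 0 <= C9.
  by have h := C'_ge0; have h' := q0; rewrite /C9 /N; nneg.
have IX : I X = 0 := TI.
(* X integrates to zero. The shell term is X minus the terms in which the arctangent is
   undifferentiated, and these are bounded by the annulus energy whatever the thickness sg. *)
apply: (@le_trans _ _ (I (fun x => C9 * L1 x + X x))).
  apply: (int_le II) => //; first by apply: testD => //; exact: testZ.
  move=> x; apply: (le_trans (hf x)); rewrite -/s.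
  pose b := bump n (rho x / s); pose Y := N * P x + q * u x `^ sobolev_exp R n * T x.
  have e1 : 2 * rho x * P x * ((1 + ((rho x - t0) / sg) ^+ 2)^-1 / sg) * b ^+ n.+1 =
     X x - (A (rho x) * (b ^+ n * b) * Y
        + 2 * (A (rho x) * (n.+1%:R * b ^+ n * dbump n (rho x / s))) * (rho x / s * P x)).
    rewrite /X -/Y /phi /dphi /bk /dbk -/b /dA -exprSr; ring.
  rewrite e1 addrC lerD2r /L1 -/b.
  have [z|z] := eqVneq b 0.
    by rewrite z !expr0n /= !(mul0r, mulr0) addr0 oppr0.
  have [t12 rx] := bump_dom r1' z; have /andP[t1 t2] := t12.
  have rx1 : r1 ^+ 2 <= rho x by apply: le_trans rx; have := r1_ge1; nra.
  apply: shell_pointwise.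
  - exact: atan_bound.
  - by rewrite bump_ge0 bump_le1.
  - by rewrite exprn_ge0 ?bump_ge0.
  - by rewrite t2 andbT (le_trans _ t1).
  - exact: (@dbump_bound R n).
  - exact: powR_ge0.
  have Tb := T_bound rx1.
  have hE : 0 <= u x `^ sobolev_exp R n by exact: powR_ge0.
  have hq := q0; have hN : 0 <= N by [].
  have hP : 0 <= P x by exact: powR_ge0.
  have -> : (N + q * C') * P x = N * P x + q * C' * P x by ring.
  apply: (le_trans (ler_normD _ _)); apply: lerD.
    by rewrite ger0_norm //; exact: mulr_ge0.
  have -> : `|q * u x `^ sobolev_exp R n * T x| = q * (u x `^ sobolev_exp R n * `|T x|).
    by rewrite normrM (ger0_norm (mulr_ge0 (ltW hq) hE)) mulrA.
  have -> : P x = u x * u x `^ sobolev_exp R n := crit_mul n3 u_pos x.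
  have -> : q * C' * (u x * u x `^ sobolev_exp R n) = q * (u x `^ sobolev_exp R n * (C' * u x)) by ring.
  by apply: ler_wpM2l; [exact: ltW|exact: ler_wpM2l].
rewrite (int_lin II) // IX addr0; apply: ler_wpM2l => //.
exact: energy.
Qed.

End ShellEstimate.

(** * Mean value inequality *)

Section Affine.
Context {R : realType} {n : nat}.
Implicit Types (f g : 'rV[R]_n -> R) (x y v : 'rV[R]_n) (t s : R).

Lemma cont_affine f y s : continuous f -> continuous (fun x => f (s *: (x - y))).
Proof.
move=> cf x; apply: (@continuous_comp _ _ _ (fun x : 'rV[R]_n => s *: (x - y)) f); last exact: cf.
apply: (@cvgZ R 'rV[R]_n _ (nbhs x) _ (fun=> s) (fun x : 'rV[R]_n => x - y) s (x - y)); first exact: cvg_cst.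
by apply: cvgB; [exact: cvg_id|exact: cvg_cst].
Qed.

Lemma der_affine f df y s v : (forall x, is_derive x v f (df x)) ->
  forall x, is_derive x v (fun x => f (s *: (x - y))) (s * df (s *: (x - y))).
Proof.
move=> D x; apply: is_derive_line0.
have h1 : is_derive (0 : R) (1 : R) (fun t => f (s *: (x - y) + t *: v)) (df (s *: (x - y))).
  by apply: is_derive_line; rewrite scale0r addr0.
have h2 := derM (derC (0 : R) 1 s) (is_derive_id (0 : R) 1).
have h3 : is_derive (s * 0) (1 : R) (fun t => f (s *: (x - y) + t *: v)) (df (s *: (x - y))).
  by rewrite mulr0.
have h4 := @der_comp _ _ (fun t => f (s *: (x - y) + t *: v)) (fun t : R => s * t) 0 1 _ _ h3 h2.
have -> : (fun t : R => f (s *: (x + t *: v - y))) =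
    (fun t => f (s *: (x - y) + (s * t) *: v)).
  by apply/funext => t; rewrite addrAC scalerDr scalerA.
by apply: (derE h4); rewrite mulr1 mulr0 addr0 mulrC.
Qed.

Lemma test_affine f y s : 0 < s -> test_function f ->
  test_function (fun x => f (s *: (x - y))).
Proof.
move=> s0 [cf [L hL]]; split; first exact: cont_affine.
exists (`|L| / s + `|y|) => x hx; apply: hL.
rewrite normrZ (gtr0_norm s0); have h := ler_normD (x - y) y; rewrite subrK in h.
have : `|L| / s <= `|x - y| by lra.
by rewrite ler_pdivrMr // mulrC; apply: le_trans; exact: ler_norm.
Qed.

(** The notion carries no normalization, so rescaling needs no Jacobian; the chain rule factor s is
    nonzero and can be divided out. *)
Lemma is_integral_affine (I : ('rV[R]_n -> R) -> R) y s : 0 < s -> is_integral I ->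
  is_integral (fun f => I (fun x => f (s *: (x - y)))).
Proof.
move=> s0 II; split.
- by move=> a f g tf tg; apply: (int_lin II); exact: test_affine.
- by move=> f g tf tg fg; apply: (int_le II); try exact: test_affine.
move=> i F dF sF cdF D.
have tdF : test_function dF := test_derive sF cdF D.
have H := der_affine y s D.
case: (II) => _ _ /(_ i (fun x => F (s *: (x - y))) (fun x => s * dF (s *: (x - y)))).
case: sF => L hL; move=> /(_ _ _ H) h.
have {}h : I (fun x => s * dF (s *: (x - y))) = 0.
  apply: h.
    exists (`|L| / s + `|y|) => x hx; apply: hL.
    rewrite normrZ (gtr0_norm s0); have h' := ler_normD (x - y) y; rewrite subrK in h'.
    have : `|L| / s <= `|x - y| by lra.
    by rewrite ler_pdivrMr // mulrC; apply: le_trans; exact: ler_norm.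
  by apply: contM; [exact: contC|exact: cont_affine].
move: h; rewrite (intZ II); last exact: test_affine.
by move/eqP; rewrite mulf_eq0 gt_eqF //= => /eqP.
Qed.

End Affine.

Section MeanValue.
Context {R : realType} {n : nat} (J : ('rV[R]_n -> R) -> R).
Hypothesis JJ : is_integral J.
Variables (v : 'rV[R]_n -> R) (v1 : 'I_n -> 'rV[R]_n -> R)
  (v2 : 'I_n -> 'I_n -> 'rV[R]_n -> R).
Hypotheses (v_cont : continuous v) (v1_cont : forall i, continuous (v1 i))
  (v2_cont : forall i j, continuous (v2 i j)).
Hypotheses (v_der : forall i (x : 'rV[R]_n), is_derive x (e_ i) v (v1 i x))
  (v1_der : forall i j (x : 'rV[R]_n), is_derive x (e_ j) (v1 i) (v2 i j x)).
Implicit Types (x y : 'rV[R]_n) (t h : R) (i j : 'I_n).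

Definition kernel x : R := pos (1 - rho x) ^+ 2.
Definition kernel' x : R := pos (1 - rho x) ^+ 3 / 6.

Lemma cont_pos_rho : continuous (fun x : 'rV[R]_n => pos (1 - rho x)).
Proof.
apply: (@cont_comp _ _ pos); first exact: continuous_pos.
by apply: contB; [exact: contC|exact: cont_rho].
Qed.

Lemma pos_rho_eq0 x : 1 <= `|x| -> pos (1 - rho x) = 0.
Proof.
move=> h; rewrite pos_eq0 // subr_le0; apply: le_trans (sqr_norm_le_rho x).
by rewrite exprn_ege1.
Qed.

Lemma test_kernel : test_function kernel.
Proof.
split; first by apply: contX; exact: cont_pos_rho.
by exists 1 => x h; rewrite /kernel pos_rho_eq0 // expr0n.
Qed.

Lemma test_kernel' : test_function kernel'.
Proof.
split; first by apply: contM; [apply: contX; exact: cont_pos_rho|exact: contC].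
by exists 1 => x h; rewrite /kernel' pos_rho_eq0 // expr0n mul0r.
Qed.

Lemma kernel_ge0 x : 0 <= kernel x. Proof. exact: sqr_ge0. Qed.

Lemma kernel'_ge0 x : 0 <= kernel' x.
Proof. by rewrite /kernel' divr_ge0 // exprn_ge0 ?pos_ge0. Qed.

Lemma kernel_eq0 x : 1 <= `|x| -> kernel x = 0.
Proof. by move=> h; rewrite /kernel pos_rho_eq0 // expr0n. Qed.

Lemma kernel'_eq0 x : 1 <= `|x| -> kernel' x = 0.
Proof. by move=> h; rewrite /kernel' pos_rho_eq0 // expr0n mul0r. Qed.

Lemma kernel'_le x : kernel' x <= kernel x.
Proof.
have h0 := pos_ge0 (1 - rho x).
have h1 : pos (1 - rho x) <= 1.
  by rewrite /pos ge_max ler01 andbT; have := rho_ge0 x; lra.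
have := sqr_ge0 (pos (1 - rho x)); rewrite /kernel' /kernel => h2.
rewrite ler_pdivrMr // exprS; nra.
Qed.

(* [kernel'] is a potential of [x * kernel x]; it turns the radial derivative of a mean value
   into a mean of the Laplacian. *)
Lemma der_kernel' i x : is_derive x (e_ i) kernel' (- (x 0 i * kernel x)).
Proof.
have h1 := derB (derC (rho x) (1 : R) 1) (is_derive_id (rho x) (1 : R)).
have h2 := @der_comp _ _ (fun t : R => pos t ^+ 3) (fun t : R => 1 - t) (rho x) 1 _ _
   (is_derive_pos 1 _) h1.
have h3 := derM h2 (derC (rho x) (1 : R) 6^-1).
by apply: (derE (der_radial i h3)); rewrite /kernel; field.
Qed.

Let dv y x : R := \sum_(i < n) x 0 i * v1 i y.
Let m t := J (fun x => v (t *: x) * kernel x).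

Lemma cont_dilate f t : continuous f -> continuous (fun x : 'rV[R]_n => f (t *: x) : R).
Proof.
move=> cf; have := @cont_affine R n f 0 t cf.
by under eq_fun do rewrite subr0.
Qed.

Lemma der_dilate f df t w : (forall x, is_derive x w f (df x)) ->
  forall x, is_derive x w (fun x : 'rV[R]_n => f (t *: x) : R) (t * df (t *: x)).
Proof.
move=> D x; have := @der_affine R n f df 0 t w D x.
by under eq_fun do rewrite subr0; rewrite subr0.
Qed.

(** The left side is the formal derivative in t of the mean [m]. As [kernel'] has gradient - x times
    [kernel], integration by parts brings in the Laplacian. *)
Lemma mean_derivative t :
  J (fun x => dv (t *: x) x * kernel x) =
  t * J (fun x => (\sum_(i < n) v2 i i (t *: x)) * kernel' x).
Proof.
pose F i x := v1 i (t *: x) * kernel' x.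
pose dF i x := v1 i (t *: x) * - (x 0 i * kernel x) + kernel' x * (t * v2 i i (t *: x)).
have [ck _] := test_kernel; have [ck' sk'] := test_kernel'.
have c1 i := @cont_dilate (v1 i) t (@v1_cont i); have c2 i := @cont_dilate (v2 i i) t (@v2_cont i i).
have sF i : bounded_support (F i).
  by exists 1 => x h; rewrite /F kernel'_eq0 // mulr0.
have cc (k : R) := @contC R 'rV[R]_n k.
have cX i : continuous (fun x : 'rV[R]_n => x 0 i) := @cont_coord R n i.
have cdF i : continuous (dF i).
  exact: contD (contM (@c1 i) (contN (contM (@cX i) ck))) (contM ck' (contM (cc t) (@c2 i))).
have DF i x : is_derive x (e_ i) (F i) (dF i x).
  exact: derM (@der_dilate (v1 i) (v2 i i) t (e_ i) (v1_der i i) x) (der_kernel' i x).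
have := int_div JJ sF cdF DF.
have tdv : test_function (fun x => dv (t *: x) x * kernel x).
  apply: testMl; last exact: test_kernel.
  by apply: contS => i; exact: contM.
have tL : test_function (fun x => (\sum_(i < n) v2 i i (t *: x)) * kernel' x).
  apply: testMl; last exact: test_kernel'.
  by apply: contS => i.
have -> : (fun x => \sum_(i < n) dF i x) =
  (fun x => t * ((\sum_(i < n) v2 i i (t *: x)) * kernel' x) - dv (t *: x) x * kernel x).
  apply/funext => x; rewrite /dF /dv mulr_suml mulr_suml mulr_sumr -sumrB.
  by apply: eq_bigr => i _; ring.
rewrite (intB JJ) ?(intZ JJ) //; last exact: testZ.
by move/eqP; rewrite subr_eq0 => /eqP ->.
Qed.

(** Taylor's lower bound, uniform in x. It replaces differentiation under the integral, so [m] is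
    never shown to be differentiable. *)
Lemma second_order : exists2 C, 0 <= C & forall x t h, `|x| <= 1 -> 0 <= t -> 0 <= h ->
  t + h <= 1 -> v (t *: x) + h * dv (t *: x) x - C * h ^+ 2 <= v ((t + h) *: x).
Proof.
pose ddv y x : R := \sum_(i < n) x 0 i * \sum_(j < n) x 0 j * v2 i j y.
have D1 y x : is_derive y x v (dv y x) by exact: der_dir.
have D2 y x : is_derive y x (fun y => dv y x) (ddv y x).
  apply: derS => i; apply: derZ; exact: der_dir.
pose S y : R := \sum_(i < n) \sum_(j < n) `|v2 i j y|.
have cS : continuous S.
  apply: contS => i; apply: contS => j y.
  by apply: (@cvg_norm _ _ _ (nbhs y) _ (v2 i j)); exact: v2_cont.
have [M M0 hM] := continuous_bounded_cube 1 cS.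
have hdd y x : `|x| <= 1 -> `|y| <= 1 -> `|ddv y x| <= M.
  move=> hx hy; apply: (@le_trans _ _ (S y)); last first.
    exact: le_trans (ler_norm _) (hM y hy).
  have xi i : `|x 0 i| <= 1 by exact: le_trans (coord_le_norm x i) hx.
  apply: (le_trans (ler_norm_sum _ _ _)); apply: ler_sum => i _.
  rewrite normrM; apply: (le_trans (ler_piMl (normr_ge0 _) (xi i))).
  apply: (le_trans (ler_norm_sum _ _ _)); apply: ler_sum => j _.
  by rewrite normrM; exact: ler_piMl (normr_ge0 _) (xi j).
exists M; first exact: ltW.
move=> x t h hx t0; rewrite le_eqVlt => /orP[/eqP <- _|h0 th].
  by rewrite expr0n /= mul0r mulr0 subr0 !addr0.
have lt_th : t < t + h by rewrite ltrDl.
have [c /andP[c1 c2]] := @MVT_line _ _ v (fun y => dv y x) 0 x _ _ lt_th (fun s _ => D1 _ x).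
rewrite !add0r addrAC subrr add0r => E1.
have [d /andP[d1 d2]] := @MVT_line _ _ (fun y => dv y x) (fun y => ddv y x) 0 x _ _ c1 (fun s _ => D2 _ x).
rewrite !add0r => E2.
have hdx : `|d *: x| <= 1.
  by rewrite normrZ ger0_norm ?mulr_ile1 //; lra.
have B := hdd (d *: x) x hx hdx; rewrite ler_norml in B.
have /andP[B1 B2] := B.
have F1 : v ((t + h) *: x) = v (t *: x) + h * (dv (t *: x) x + ddv (d *: x) x * (c - t)).
  by rewrite -E2 addrCA subrr addr0 mulrC -E1 addrCA subrr addr0.
rewrite F1; have e : 0 <= c - t <= h by apply/andP; split; lra.
have /andP[e1 e2] := e.
have G : - (M * h) <= ddv (d *: x) x * (c - t) by nra.
have := ler_wpM2l (ltW h0) G; rewrite expr2; lra.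
Qed.

(** The mean is followed from t = 0, where it is v(0) times the mass of [kernel], to t = 1 in N
    equal steps. Each step loses at most E J(kernel') / N, by the lower bound on the Laplacian, and
    a Taylor error of order 1 / N^2; the errors add up to O(1/N), and N is arbitrary. *)
Lemma mean_value E : 0 <= E ->
  (forall x, `|x| <= 1 -> - E <= \sum_(i < n) v2 i i x) ->
  v 0 * J kernel - E * J kernel' <= J (fun x => v x * kernel x).
Proof.
move=> E0 hE; have [C C0 hC] := second_order.
have tk := test_kernel; have tk' := test_kernel'.
have tv t : test_function (fun x => v (t *: x) * kernel x).
  by apply: testMl => //; exact: cont_dilate.
have cX i : continuous (fun x : 'rV[R]_n => x 0 i) := @cont_coord R n i.
have tdv t : test_function (fun x => dv (t *: x) x * kernel x).
  apply: testMl => //; apply: contS => i; apply: contM; first exact: cX.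
  by apply: cont_dilate; exact: v1_cont.
have tL t : test_function (fun x => (\sum_(i < n) v2 i i (t *: x)) * kernel' x).
  by apply: testMl => //; apply: contS => i; apply: cont_dilate; exact: v2_cont.
have Jk0 := int_ge0 JJ tk kernel_ge0; have Jk'0 := int_ge0 JJ tk' kernel'_ge0.
have step t h : 0 <= t -> 0 <= h -> t + h <= 1 ->
    m t - h * (E * J kernel') - h ^+ 2 * (C * J kernel) <= m (t + h).
  move=> t0 h0 th.
  have A : J (fun x => (h * (dv (t *: x) x * kernel x) + v (t *: x) * kernel x) +
      (- (C * h ^+ 2)) * kernel x) <= m (t + h).
    apply: (int_le JJ) => //.
      by apply: testD; [apply: testD => //; exact: testZ|exact: testZ].
    move=> x; have [h1|h1] := leP 1 `|x|; first by rewrite kernel_eq0 // !mulr0 !addr0.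
    have := ler_wpM2r (kernel_ge0 x) (hC x t h (ltW h1) t0 h0 th); lra.
  rewrite (intD JJ) ?(int_lin JJ) ?(intZ JJ) ?mean_derivative // in A; try exact: testZ; last first.
    by apply: testD => //; exact: testZ.
  have B : - (E * J kernel') <= J (fun x => (\sum_(i < n) v2 i i (t *: x)) * kernel' x).
    rewrite -mulNr -(intZ JJ) //; apply: (int_le JJ) => //; first exact: testZ.
    move=> x; have [h1|h1] := leP 1 `|x|; first by rewrite kernel'_eq0 // !mulr0.
    apply: ler_wpM2r; first exact: kernel'_ge0.
    by apply: hE; rewrite normrZ ger0_norm // mulr_ile1 //; [lra|exact: ltW].
  have t1 : t <= 1 by lra.
  have B' : - (h * (E * J kernel')) <= h * (t * J (fun x => (\sum_(i < n) v2 i i (t *: x)) * kernel' x)).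
    rewrite -mulrN ler_wpM2l //.
    have z0 : 0 <= E * J kernel' by exact: mulr_ge0.
    by move: B z0; set a := E * _; set b := J _ => B z0; nra.
  by rewrite -/(m t) in A; lra.
have iter N : (0 < N)%N -> forall k, (k <= N)%N ->
    m 0 - k%:R / N%:R * (E * J kernel') - k%:R / N%:R ^+ 2 * (C * J kernel) <= m (k%:R / N%:R).
  move=> N0; elim=> [|k IH] kN; first by rewrite !mul0r !subr0.
  have NR : 0 < N%:R :> R by rewrite ltr0n.
  have e : k%:R / N%:R + N%:R^-1 = k.+1%:R / N%:R :> R by rewrite mulrSr mulrDl mul1r.
  have := @step (k%:R / N%:R) N%:R^-1; rewrite e => /(_ _ _ _) st.
  have st' : m (k%:R / N%:R) - N%:R^-1 * (E * J kernel') - N%:R^-1 ^+ 2 * (C * J kernel) <= m (k.+1%:R / N%:R).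
    apply: st; [by rewrite divr_ge0|by rewrite invr_ge0|].
    by rewrite ler_pdivrMr // mul1r ler_nat.
  apply: le_trans st'; have := IH (ltnW kN); rewrite mulrSr exprVn; lra.
have fin N : (0 < N)%N -> m 0 - E * J kernel' - (C * J kernel) / N%:R <= m 1.
  move=> N0; have := iter N N0 N (leqnn N).
  have NR : N%:R != 0 :> R by rewrite pnatr_eq0 -lt0n.
  rewrite divff // mul1r (_ : N%:R / N%:R ^+ 2 * (C * J kernel) = C * J kernel / N%:R) //.
  by field.
have m0 : m 0 = v 0 * J kernel.
  by rewrite /m -(intZ JJ) //; congr J; apply/funext => x; rewrite scale0r.
have m1 : m 1 = J (fun x => v x * kernel x).
  by rewrite /m; congr J; apply/funext => x; rewrite scale1r.
rewrite -m0 -m1; apply/ler_addgt0Pr => e e0.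
have CJ : 0 <= C * J kernel by exact: mulr_ge0.
pose N := (Num.bound (C * J kernel / e)).+1.
have N0 : 0 < N%:R :> R by rewrite ltr0n.
have : C * J kernel / N%:R <= e.
  rewrite ler_pdivrMr // [leRHS]mulrC -ler_pdivrMr //.
  have h : 0 <= C * J kernel / e by rewrite divr_ge0 // ltW.
  by apply: ltW; apply: (lt_trans (archi_boundP h)); rewrite ltr_nat.
by have := fin N isT; lra.
Qed.

End MeanValue.

(** * Concentration *)

Section LocalBound.
Context {R : realType} (m : nat).
Local Notation n := m.+3.
Variable (I : ('rV[R]_n -> R) -> R).
Hypothesis II : is_integral I.
Hypothesis I_lower : forall f (b : R) a h, test_function f -> 0 < h -> 0 <= b ->
  (forall x : 'rV[R]_n, 0 <= f x) -> (forall x : 'rV[R]_n, `|x - a| <= h -> b <= f x) ->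
  b * h ^+ n <= I f.
Variables (u K : 'rV[R]_n -> R) (u1 : 'I_n -> 'rV[R]_n -> R)
  (u2 : 'I_n -> 'I_n -> 'rV[R]_n -> R).
Hypotheses (u_cont : continuous u) (u1_cont : forall i, continuous (u1 i))
  (u2_cont : forall i j, continuous (u2 i j)).
Hypotheses (u_der : forall i (x : 'rV[R]_n), is_derive x (e_ i) u (u1 i x))
  (u1_der : forall i j (x : 'rV[R]_n), is_derive x (e_ j) (u1 i) (u2 i j x)).
Hypothesis u_pos : forall x, 0 < u x.
Hypothesis u_sol : forall x,
  (\sum_(i < n) u2 i i x) + K x * u x `^ sobolev_exp R n = 0.
Let N : R := n%:R.
Implicit Types (x y z : 'rV[R]_n) (r s : R) (i j : 'I_n).
Let P x : R := u x `^ critical_exp R n.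
Let n3 : (3 <= n)%N. Proof. by []. Qed.
Variables (b r1 : R).
Hypotheses (b_gt0 : 0 < b) (r1_ge1 : 1 <= r1).
Hypothesis K_bound : forall x, r1 ^+ 2 <= rho x -> 0 <= K x <= b.

Lemma conf_mul x : u x `^ sobolev_exp R n = u x * conf u x ^+ 2.
Proof.
have u0 := u_pos x; have N2 := @N_gt2 R n n3.
rewrite -powR_mulrn ?powR_ge0 // -powRrM -{2}[u x]powRr1 ?ltW // -powRD; last first.
  by rewrite (gt_eqF u0) implybT.
congr (_ `^ _); rewrite /sobolev_exp; field.
by rewrite gt_eqF // subr_gt0.
Qed.

(** Since U^(n-2) = u^2, the sharp factor would be c^((n-2)/2); as c >= 1, the integer power
    suffices. *)
Lemma conf_le_mul x y (c : R) : 1 <= c -> conf u x <= c * conf u y -> u x <= c ^+ m.+1 * u y.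
Proof.
move=> c1 h; have ux := u_pos x; have uy := u_pos y.
have cx : 0 < conf u x by exact: powR_gt0.
have cy : 0 < conf u y by exact: powR_gt0.
have c0 : 0 < c by lra.
have h2 : conf u x ^+ m.+1 <= (c * conf u y) ^+ m.+1.
  by rewrite lerXn2r ?nnegrE //; nneg.
rewrite exprMn !conf_sqr // in h2.
have c2 : 1 <= c ^+ m.+1 by exact: exprn_ege1.
rewrite -(@ler_pXn2r _ 2) ?nnegrE //; [|by nneg|by nneg].
apply: (le_trans h2); rewrite exprMn ler_wpM2r ?sqr_ge0 // expr2 ler_peMl //; lra.
Qed.

(** Otherwise u(x)^2 = U(x)^(n-2) would be below u(y)^2 / 16^(n-2), hence below u(y)^2 / 16, as n -
    2 >= 1. *)
Lemma conf_lower x y : u y / 4 <= u x -> conf u y / 16 <= conf u x.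
Proof.
move=> h; rewrite leNgt; apply/negP => h2.
have ux := u_pos x; have uy := u_pos y.
have cx : 0 < conf u x by exact: powR_gt0.
have cy : 0 < conf u y by exact: powR_gt0.
have h3 : conf u x ^+ m.+1 < (conf u y / 16) ^+ m.+1.
  by rewrite ltrXn2r ?nnegrE //; nneg.
have h4 : (conf u y / 16) ^+ m.+1 <= u y ^+ 2 / 16.
  rewrite exprMn conf_sqr // exprVn ler_wpM2l ?sqr_ge0 //.
  have o : 1 <= 16 :> R by rewrite ler1n.
  have h16 : 16 <= 16 ^+ m.+1 :> R by rewrite exprS ler_peMr // exprn_ege1.
  by rewrite lef_pV2 ?posrE ?exprn_gt0.
have := lt_le_trans h3 h4; rewrite conf_sqr // => h5.
have h6 : (u y / 4) ^+ 2 <= u x ^+ 2 by rewrite lerXn2r ?nnegrE //; nneg.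
by lra.
Qed.

(* On a ball of radius [bubble_scale / U(y0)] the Laplacian is too small to halve the mean of [u]. *)
Definition bubble_scale : R := (1 + 2 * b * 2 ^+ m.+3)^-1.
Lemma bubble_scale_gt0 : 0 < bubble_scale.
Proof. by have h := b_gt0; rewrite /bubble_scale invr_gt0 ltr_wpDr //; nneg. Qed.

Lemma bubble_scale_le1 : bubble_scale <= 1.
Proof.
have h := b_gt0; rewrite /bubble_scale invf_le1 ?lerDl; [nneg|rewrite ltr_wpDr //; nneg].
Qed.

Lemma bubble_scale_small : bubble_scale ^+ 2 * (b * 2 ^+ m.+3) <= 1 / 2.
Proof.
have h := b_gt0; have k0 := bubble_scale_gt0; have k1 := bubble_scale_le1.
have p0 : 0 < b * 2 ^+ m.+3 by rewrite mulr_gt0 // exprn_gt0.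
have e : bubble_scale * (1 + 2 * (b * 2 ^+ m.+3)) = 1.
  by rewrite /bubble_scale mulrA mulVf // gt_eqF // ltr_wpDr //; nneg.
have : bubble_scale ^+ 2 * (b * 2 ^+ m.+3) <= bubble_scale * (b * 2 ^+ m.+3).
  by rewrite ler_pM2r // expr2 ler_piMl // ltW.
by move: e; rewrite mulrDr mulr1; nra.
Qed.

Lemma kernel_le1 x : kernel x <= 1.
Proof.
rewrite /kernel exprn_ile1 ?pos_ge0 // /pos ge_max ler01 andbT.
by have := rho_ge0 x; lra.
Qed.

Lemma kernel_ge x : `|x| <= (2 * N)^-1 -> 1 / 4 <= kernel x.
Proof.
move=> h; have N0 : 1 <= N by rewrite ler1n.
have h2 : rho x <= 1 / 2.
  apply: (le_trans (rho_le x)).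
  have : `|x| ^+ 2 <= (2 * N)^-1 ^+ 2 by rewrite lerXn2r ?nnegrE ?invr_ge0 ?mulr_ge0 //; lra.
  move=> h3; apply: (@le_trans _ _ (N * (2 * N)^-1 ^+ 2)); first by rewrite ler_wpM2l //; lra.
  have -> : N * (2 * N)^-1 ^+ 2 = (4 * N)^-1 by field; rewrite gt_eqF //; lra.
  by rewrite -[1 / 2]invf_div divr1 lef_pV2 ?posrE //; lra.
have : 1 / 2 <= pos (1 - rho x) by rewrite /pos le_max; apply/orP; left; lra.
by rewrite /kernel expr2; nra.
Qed.

(** The first factor comes from u <= 2^(n-2) u(y0), the second from U >= U(y0) / 16 where u >= u(y0)
    / 4. *)
Let c : R := 2 ^+ m.+1 * 16 ^+ n.

(** By the mean value inequality the [kernel] mean of u over the ball is at least half of u(y0)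
    times the mass. Values below u(y0) / 4 account for at most half of that; the others are
    dominated by a multiple of u^q. The resulting bound is a multiple of (s U(y0))^n, a fixed
    number. *)
Lemma ball_lower y0 s : 0 < s -> s * conf u y0 = bubble_scale ->
  (forall z, `|z - y0| <= s -> conf u z <= 2 * conf u y0 /\ r1 ^+ 2 <= rho z) ->
  bubble_scale ^+ n / (16 * c * (2 * N) ^+ n) <=
    I (fun x => P x * kernel (s^-1 *: (x - y0))).
Proof.
move=> s0 sM ball.
have sV0 : 0 < s^-1 by rewrite invr_gt0.
have sn0 : s != 0 by rewrite gt_eqF.
pose J f := I (fun x => f (s^-1 *: (x - y0))).
have JJ : is_integral J by exact: is_integral_affine.
(* Chosen so that s (x - w) = s x + y0: the function [v] is u recentred at y0 and rescaled by s. *)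
pose w : 'rV[R]_n := - (s^-1 *: y0).
have wE x : s *: (x - w) = s *: x + y0.
  by rewrite /w opprK scalerDr scalerA divff // scale1r.
pose v x := u (s *: (x - w)).
pose v1 i x := s * u1 i (s *: (x - w)).
pose v2 i j x := s * (s * u2 i j (s *: (x - w))).
have cv : continuous v by exact: cont_affine.
have cv1 i : continuous (v1 i) by apply: contM; [exact: contC|exact: cont_affine].
have cv2 i j : continuous (v2 i j).
  by apply: contM; [exact: contC|apply: contM; [exact: contC|exact: cont_affine]].
have Dv i x : is_derive x (e_ i) v (v1 i x) by exact: der_affine.
have Dv1 i j x : is_derive x (e_ j) (v1 i) (v2 i j x) by apply: derZ; exact: der_affine.
pose M := conf u y0; have M0 : 0 < M by exact: powR_gt0.
pose u0 := u y0; have u00 : 0 < u0 := u_pos y0.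
have inball x : `|x| <= 1 -> `|s *: (x - w) - y0| <= s.
  by move=> hx; rewrite wE addrK normrZ gtr0_norm // ler_piMr // ltW.
(* The rescaled Laplacian is at most s^2 b u U^2 in size, with u <= 2^(n-2) u(y0), U <= 2 U(y0) and
   s U(y0) = [bubble_scale]. *)
pose E := bubble_scale ^+ 2 * (b * 2 ^+ m.+3) * u0.
have bb := b_gt0; have k0 := bubble_scale_gt0.
have E0 : 0 <= E by rewrite /E; nneg.
have hE x : `|x| <= 1 -> - E <= \sum_(i < n) v2 i i x.
  move=> hx; have [h1 h2] := ball _ (inball x hx).
  set z := s *: (x - w) in h1 h2 *.
  have -> : \sum_(i < n) v2 i i x = - (s ^+ 2 * (K z * (u z * conf u z ^+ 2))).
    rewrite /v2 -!mulr_sumr -conf_mul -/z.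
    have -> : \sum_(i < n) u2 i i z = - (K z * u z `^ sobolev_exp R n) by have := u_sol z; lra.
    by ring.
  rewrite lerN2; have /andP[K0 Kb] := K_bound h2.
  have uz := u_pos z; have cz : 0 < conf u z by exact: powR_gt0.
  have h3 : u z <= 2 ^+ m.+1 * u0 by apply: conf_le_mul => //; lra.
  have h4 : conf u z ^+ 2 <= (2 * M) ^+ 2 by rewrite lerXn2r ?nnegrE //; nneg.
  have -> : E = s ^+ 2 * (b * (2 ^+ m.+1 * u0 * (2 * M) ^+ 2)).
    by rewrite /E -sM -/M [2 ^+ m.+3]exprS [2 ^+ m.+2]exprS; ring.
  rewrite ler_wpM2l ?sqr_ge0 //; apply: ler_pM => //; first by nneg.
  by apply: ler_pM => //; [exact: ltW|exact: sqr_ge0].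
have MV := mean_value JJ cv cv1 cv2 Dv Dv1 E0 hE.
have tk : test_function (@kernel R n) := test_kernel.
have tk' : test_function (@kernel' R n) := test_kernel'.
have Jk' : J kernel' <= J kernel by apply: (int_le JJ) => // x; exact: kernel'_le.
have v0 : v 0 = u0 by rewrite /v wE scaler0 add0r.
rewrite v0 in MV.
have Jk0 : 0 <= J kernel by apply: (int_ge0 JJ) => //; exact: kernel_ge0.
have MV2 : u0 / 2 * J kernel <= J (fun x => v x * kernel x).
  apply: le_trans MV.
  have h : E * J kernel' <= (u0 / 2) * J kernel.
    apply: (@le_trans _ _ (E * J kernel)); first exact: ler_wpM2l.
    apply: ler_wpM2r => //; rewrite /E; have := bubble_scale_small => h.
    by have := ler_wpM2r (ltW u00) h; lra.
  by lra.
pose Pv x := P (s *: (x - w)).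
have cP : continuous P := cont_P u_cont u_pos.
have cPv : continuous Pv by exact: cont_affine.
have tv : test_function (fun x => v x * kernel x) by exact: testMl.
have tPv : test_function (fun x => Pv x * kernel x) by exact: testMl.
have c0 : 0 < c by rewrite mulr_gt0 ?exprn_gt0.
have Mn0 : 0 < M ^+ n by rewrite exprn_gt0.
(* Where u <= u(y0) / 4 the first term suffices; elsewhere U >= U(y0) / 16, so M^n <= 16^n u^q and
   the second term dominates. *)
have ptw x : v x * kernel x <= (u0 / 4) * kernel x + (c * u0 / M ^+ n) * (Pv x * kernel x).
  have [h|/ltW h] := leP 1 `|x|; first by rewrite kernel_eq0 // !mulr0 addr0.
  rewrite mulrA -mulrDl; apply: ler_wpM2r; first exact: kernel_ge0.
  have [h1 h2] := ball _ (inball x h).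
  rewrite /v /Pv; set z := s *: (x - w) in h1 h2 *.
  have uz := u_pos z; have cz : 0 < conf u z by exact: powR_gt0.
  have Pz : P z = conf u z ^+ n by rewrite conf_crit.
  have [hz|/ltW hz] := leP (u z) (u0 / 4).
    by apply: (le_trans hz); rewrite lerDl Pz; nneg.
  have h3 : u z <= 2 ^+ m.+1 * u0 by apply: conf_le_mul => //; lra.
  have h4 := conf_lower hz; rewrite -/M in h4.
  have h5 : M ^+ n <= 16 ^+ n * P z.
    rewrite Pz -exprMn lerXn2r ?nnegrE //; [by nneg|by nneg|].
    by move: h4; rewrite ler_pdivrMr // mulrC.
  apply: (le_trans h3); apply: (@le_trans _ _ (c * u0 / M ^+ n * P z)); last first.
    by rewrite lerDr; nneg.
  have -> : c * u0 / M ^+ n * P z = 2 ^+ m.+1 * u0 * ((16 ^+ n * P z) / M ^+ n).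
    by rewrite /c; ring.
  by rewrite ler_peMr //; [nneg|rewrite ler_pdivlMr // mul1r].
have MV3 : u0 / 2 * J kernel <= (u0 / 4) * J kernel + (c * u0 / M ^+ n) * J (fun x => Pv x * kernel x).
  have tcP := testZ (c * u0 / M ^+ n) tPv.
  have e := int_lin JJ (u0 / 4) tk tcP; rewrite (intZ JJ (c * u0 / M ^+ n) tPv) in e.
  rewrite -e; apply: (le_trans MV2); apply: (int_le JJ) => //.
  by apply: testD => //; exact: testZ.
have JPv : J (fun x => Pv x * kernel x) = I (fun x => P x * kernel (s^-1 *: (x - y0))).
  rewrite /J; congr I; apply/funext => x; congr (_ * _).
  by rewrite /Pv wE scalerA divff // scale1r subrK.
rewrite -JPv.
have NN : 0 < N by rewrite ltr0n.
have N20 : 0 < 2 * N by rewrite mulr_gt0.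
(* [kernel] is at least 1/4 for |x| <= 1 / (2 N), and before rescaling this is a cube of half-side s
   / (2 N). *)
have low : (1 / 4) * (s / (2 * N)) ^+ n <= J kernel.
  rewrite /J; apply: (I_lower (a := y0)) => //.
  - by apply: test_affine => //.
  - by rewrite divr_gt0.
  - by move=> x; exact: kernel_ge0.
  move=> x hx; apply: kernel_ge; rewrite normrZ gtr0_norm // mulrC ler_pdivrMr //.
  by rewrite mulrC.
have MV4 : M ^+ n / (4 * c) * J kernel <= J (fun x => Pv x * kernel x).
  have h : u0 / 4 * J kernel <= c * u0 / M ^+ n * J (fun x => Pv x * kernel x) by lra.
  have e : 0 <= M ^+ n / (c * u0) by nneg.
  have := ler_wpM2l e h.
  have -> : M ^+ n / (c * u0) * (u0 / 4 * J kernel) = M ^+ n / (4 * c) * J kernel.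
    by field; rewrite !gt_eqF.
  have -> // : M ^+ n / (c * u0) * (c * u0 / M ^+ n * J (fun x => Pv x * kernel x)) =
     J (fun x => Pv x * kernel x).
  by field; rewrite !gt_eqF.
apply: le_trans MV4.
have e : 0 <= M ^+ n / (4 * c) by nneg.
apply: le_trans (ler_wpM2l e low).
rewrite -sM -/M.
have -> // : (s * M) ^+ n / (16 * c * (2 * N) ^+ n) = M ^+ n / (4 * c) * (1 / 4 * (s / (2 * N)) ^+ n).
rewrite [(s * M) ^+ n]exprMn [(s / (2 * N)) ^+ n]expr_div_n; field.
by rewrite (gt_eqF c0) expf_neq0 // gt_eqF.
Qed.

End LocalBound.

(** * Comparison of the energy bounds at nearly maximal points *)

Section BlowUp.
Context {R : realType} (m : nat).
Local Notation n := m.+3.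
Variable (I : ('rV[R]_n -> R) -> R).
Hypothesis II : is_integral I.
Hypothesis I_lower : forall f (b : R) a h, test_function f -> 0 < h -> 0 <= b ->
  (forall x : 'rV[R]_n, 0 <= f x) -> (forall x : 'rV[R]_n, `|x - a| <= h -> b <= f x) ->
  b * h ^+ n <= I f.
Variables (u K : 'rV[R]_n -> R) (u1 : 'I_n -> 'rV[R]_n -> R)
  (u2 : 'I_n -> 'I_n -> 'rV[R]_n -> R).
Hypotheses (u_cont : continuous u) (u1_cont : forall i, continuous (u1 i))
  (u2_cont : forall i j, continuous (u2 i j)).
Hypotheses (u_der : forall i (x : 'rV[R]_n), is_derive x (e_ i) u (u1 i x))
  (u1_der : forall i j (x : 'rV[R]_n), is_derive x (e_ j) (u1 i) (u2 i j x)).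
Hypothesis u_pos : forall x, 0 < u x.
Hypothesis u_sol : forall x,
  (\sum_(i < n) u2 i i x) + K x * u x `^ sobolev_exp R n = 0.
Variables (b r1 C' E0 : R).
Hypotheses (b_gt0 : 0 < b) (r1_ge1 : 1 <= r1) (C'_ge0 : 0 <= C') (E0_gt0 : 0 < E0).
Hypothesis K_bound : forall x, r1 ^+ 2 <= rho x -> 0 <= K x <= b.
Hypothesis T_bound : forall x, r1 ^+ 2 <= rho x -> `|radial_part u1 x| <= C' * u x.
Hypothesis energy : forall r, r1 <= r ->
  I (fun x => bump n (rho x / r ^+ 2) ^+ n * u x `^ critical_exp R n) <= E0.
Implicit Types (x y z : 'rV[R]_n) (r s : R) (i j : 'I_n).
Let N : R := n%:R.
Let P x : R := u x `^ critical_exp R n.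

Lemma rho_diff x y : `|rho y - rho x| <= N * `|y - x| * (2 * `|x| + `|y - x|).
Proof.
rewrite /rho -sumrB; apply: (le_trans (ler_norm_sum _ _ _)).
have -> : N * `|y - x| * (2 * `|x| + `|y - x|) =
    \sum_(i < n) `|y - x| * (2 * `|x| + `|y - x|).
  by rewrite sumr_const card_ord -(mulr_natl (_ * _)) /N; ring.
apply: ler_sum => i _.
have h1 : `|y 0 i - x 0 i| <= `|y - x| by have := coord_le_norm (y - x) i; rewrite !mxE.
have h2 : `|x 0 i| <= `|x| by exact: coord_le_norm.
have -> : y 0 i ^+ 2 - x 0 i ^+ 2 = (y 0 i - x 0 i) * (2 * x 0 i + (y 0 i - x 0 i)) by ring.
rewrite normrM; apply: ler_pM => //; apply: (le_trans (ler_normD _ _)); apply: lerD => //.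
by rewrite normrM normr_nat ler_wpM2l.
Qed.

(** The ball lies in the shell where rho differs from rho(y0) by at most 4 N s r. Compared with r^2
    this thickness is of order s / r, so the shell estimate applies with t0 = rho(y0). *)
Lemma ball_upper : exists2 C, 0 <= C & forall r s y0, r1 <= r -> 0 < s ->
  (forall z, `|z - y0| <= s ->
     5 / 4 <= rho z / r ^+ 2 <= 7 / 4 /\ `|rho z - rho y0| <= 4 * N * s * r) ->
  I (fun x => P x * kernel (s^-1 *: (x - y0))) <= C * (s / r).
Proof.
have [C [C0 sh]] : exists C, 0 <= C /\ forall r sg t0 f, r1 <= r -> 0 < sg -> test_function f ->
  (forall x, f x <= 2 * rho x * P x *
     ((1 + ((rho x - t0) / sg) ^+ 2)^-1 / sg) * bump n (rho x / r ^+ 2) ^+ n.+1) -> I f <= C.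
  exists ((2 * (n%:R + critical_exp R n * C') + 8 * n.+1%:R * n.+2%:R) * E0); split.
    have h := C'_ge0; have h' := E0_gt0; have h2 : 0 < critical_exp R n by exact: crit_gt0.
    by nneg.
  move=> r sg t0 f; exact: (shell_estimate II u_cont u1_cont u_der u_pos r1_ge1 C'_ge0 T_bound energy).
exists (C * (4 * N * 16 ^+ n.+1)); first by nneg.
move=> r s y0 rr s0 ball.
have r1' : 1 <= r := le_trans r1_ge1 rr.
have r0 : 0 < r by lra.
have r20 : 0 < r ^+ 2 by rewrite exprn_gt0.
have NN : 0 < N by rewrite ltr0n.
pose sg := 4 * N * s * r.
have sg0 : 0 < sg by rewrite /sg !mulr_gt0.
have cP : continuous P := cont_P u_cont u_pos.
pose f0 x := P x * kernel (s^-1 *: (x - y0)).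
have tf0 : test_function f0.
  apply: testMl => //; apply: test_affine; last exact: test_kernel.
  by rewrite invr_gt0.
(* Lower bound on the ball for the weight in the shell estimate: rho >= r^2, the arctangent density
   is at least 1 / (2 sg), and [bump] is at least 1/16. *)
pose k := r ^+ 2 / sg / 16 ^+ n.+1.
have k16 : 0 < 16 ^+ n.+1 :> R by rewrite exprn_gt0.
have k0 : 0 < k by rewrite !divr_gt0.
have H : I (fun x => k * f0 x) <= C.
  apply: (sh r sg (rho y0)) => //; first exact: testZ.
  move=> x; rewrite /f0.
  have P0 : 0 <= P x by exact: powR_ge0.
  have [hx|/ltW hx] := leP 1 `|s^-1 *: (x - y0)|.
    rewrite kernel_eq0 // !mulr0; have := rho_ge0 x; have := @bump_ge0 R n (rho x / r ^+ 2).
    move=> h1 h2; have h3 := ltW (decay_base_gt0 ((rho x - rho y0) / sg)).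
    have h4 : 0 <= (1 + ((rho x - rho y0) / sg) ^+ 2)^-1 by rewrite invr_ge0.
    by nneg.
  have hx' : `|x - y0| <= s.
    by move: hx; rewrite normrZ gtr0_norm ?invr_gt0 // mulrC ler_pdivrMr // mul1r.
  have [t12 rd] := ball x hx'.
  have bx := @bump_ge R n _ t12; have /andP[t1 t2] := t12.
  have rx : r ^+ 2 <= rho x by move: t1; rewrite ler_pdivlMr //; lra.
  have z2 : ((rho x - rho y0) / sg) ^+ 2 <= 1.
    rewrite -real_normK ?num_real // exprn_ile1 // normrM normfV (gtr0_norm sg0).
    by rewrite ler_pdivrMr // mul1r.
  have hi : 1 / 2 <= (1 + ((rho x - rho y0) / sg) ^+ 2)^-1.
    by rewrite -[1 / 2]invf_div divr1 lef_pV2 ?posrE ?decay_base_gt0 //; lra.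
  have hb : (16 ^+ n.+1)^-1 <= bump n (rho x / r ^+ 2) ^+ n.+1.
    by rewrite -exprVn lerXn2r ?nnegrE ?bump_ge0 //; lra.
  have hk : kernel (s^-1 *: (x - y0)) <= 1 by exact: kernel_le1.
  apply: (@le_trans _ _ (k * P x)).
    by rewrite ler_pM2l // ler_piMr.
  have -> : k * P x = (2 * r ^+ 2 * P x * (1 / 2 / sg)) * (16 ^+ n.+1)^-1.
    by rewrite /k; field; rewrite !gt_eqF.
  have V0 : 0 <= (16 ^+ n.+1)^-1 :> R by rewrite invr_ge0 ltW.
  apply: ler_pM; [by nneg|exact: V0| |exact: hb].
  apply: ler_pM; [by nneg|by nneg| |].
    by apply: ler_wpM2r => //; rewrite ler_wpM2l.
  by rewrite ler_wpM2r // invr_ge0 ltW.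
rewrite (intZ II) // in H.
rewrite -(ler_pM2l k0); apply: (le_trans H).
have -> // : k * (C * (4 * N * 16 ^+ n.+1) * (s / r)) = C.
by rewrite /k /sg; field; rewrite !gt_eqF.
Qed.

(* [y0] maximizes distance to the boundary of a cube times [U], so that [U <= 2 U(y0)] on the ball of
   half that distance. *)
Lemma blow_up : exists2 C, 0 < C & forall r x0, r1 <= r -> rho x0 = 3 / 2 * r ^+ 2 ->
  r * conf u x0 <= C.
Proof.
have [C0 C00 up] := ball_upper.
pose kap : R := bubble_scale m b.
have kap0 : 0 < kap by exact: bubble_scale_gt0.
have NN : 1 <= N by rewrite ler1n.
have N0 : 0 < N by lra.
pose c : R := 2 ^+ m.+1 * 16 ^+ n.
pose low := kap ^+ n / (16 * c * (2 * N) ^+ n).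
have c0 : 0 < c by rewrite mulr_gt0 ?exprn_gt0.
have low0 : 0 < low.
  apply: divr_gt0; first exact: exprn_gt0.
  by apply: mulr_gt0; [exact: mulr_gt0|apply: exprn_gt0; exact: mulr_gt0].
(* Small enough that on the cube of half-side del r the variation of rho is at most r^2 / 4, so rho
   / r^2 stays between 5/4 and 7/4 around its central value 3/2. *)
pose del : R := (16 * N)^-1.
have del0 : 0 < del by rewrite invr_gt0 mulr_gt0.
have delN : N * del = 1 / 16 by rewrite /del; field; rewrite gt_eqF.
have del1 : del <= 1 / 16.
  by rewrite -delN ler_peMl // ltW.
(* The first two summands settle the two cases below; the 1 makes the constant positive. *)
exists (2 * kap / del + C0 * kap / low + 1).
  by rewrite ltr_wpDl //; nneg.
move=> r x0 rr rx0.
have r1' : 1 <= r := le_trans r1_ge1 rr.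
have r0 : 0 < r by lra.
have r20 : 0 < r ^+ 2 by rewrite exprn_gt0.
have cU : continuous (conf u) by exact: cont_powR.
have U0 x : 0 < conf u x by exact: powR_gt0.
have dr0 : 0 < del * r by rewrite mulr_gt0.
have nx0 : `|x0| <= 5 / 4 * r.
  rewrite -(@ler_pXn2r _ 2) ?nnegrE //; last by nneg.
  by apply: (le_trans (sqr_norm_le_rho x0)); rewrite rx0; nra.
have inB y : `|y - x0| <= del * r ->
    [/\ 5 / 4 <= rho y / r ^+ 2 <= 7 / 4, `|y| <= 3 / 2 * r & r1 ^+ 2 <= rho y].
  move=> hy; have hd := rho_diff x0 y.
  have h1 : N * `|y - x0| * (2 * `|x0| + `|y - x0|) <= r / 16 * (5 / 2 * r + r / 16).
    apply: ler_pM; [by nneg|by nneg| |].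
      have -> : r / 16 = N * (del * r) by rewrite mulrA delN; ring.
      by rewrite ler_pM2l.
    have : del * r <= 1 / 16 * r by rewrite ler_pM2r.
    by lra.
  have h2 := le_trans hd h1; rewrite ler_norml rx0 in h2.
  have /andP[h3 h4] := h2.
  have h5 : 5 / 4 * r ^+ 2 <= rho y <= 7 / 4 * r ^+ 2 by apply/andP; split; nra.
  split.
  - by rewrite ler_pdivlMr // ler_pdivrMr.
  - have := ler_normD (y - x0) x0; rewrite subrK.
    have : del * r <= 1 / 16 * r by rewrite ler_pM2r.
    by lra.
  - have /andP[h6 _] := h5; apply: le_trans h6.
    have := r1_ge1; nra.
pose F y : R := (del * r - `|y - x0|) * conf u y.
have cF : continuous F.
  by apply: contM => //; apply: contB; [exact: contC|exact: continuous_dist].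
have [y0 y0B y0max] : exists2 y0, y0 \in [set x : 'rV[R]_n | `|x - x0| <= del * r] &
    forall t, t \in [set x : 'rV[R]_n | `|x - x0| <= del * r] -> F t <= F y0.
  apply: (@compact_EVT_max _ _ F).
  - by exists x0 => /=; rewrite subrr normr0 ltW.
  - exact: compact_cube.
  - exact: continuous_subspaceT.
rewrite inE /= in y0B.
pose D := del * r - `|y0 - x0|; pose M := conf u y0.
have M0 : 0 < M := U0 y0.
have FD : del * r * conf u x0 <= D * M.
  have := y0max x0; rewrite inE /= subrr normr0 => /(_ (ltW dr0)).
  by rewrite /F subrr normr0 subr0.
have D0 : 0 < D.
  have : 0 < D * M by apply: lt_le_trans FD; exact: mulr_gt0.
  by rewrite pmulr_lgt0.
have Ddr : D <= del * r by rewrite /D lerBlDr lerDl.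
have inball z : `|z - y0| <= D / 2 -> `|z - x0| <= del * r /\ conf u z <= 2 * M.
  move=> hz; have h1 := ler_normD (z - y0) (y0 - x0); rewrite subrKA in h1.
  have h2 : `|z - x0| <= del * r - D / 2.
    by apply: (le_trans h1); rewrite /D in hz *; lra.
  have h3 : `|z - x0| <= del * r by lra.
  split => //; have := y0max z; rewrite inE /= => /(_ h3).
  rewrite /F -/D -/M => h4.
  have h5 : D / 2 * conf u z <= D * M.
    by apply: le_trans h4; rewrite ler_pM2r //; lra.
  by rewrite -(@ler_pM2l _ (D / 2)) ?divr_gt0 //; lra.
(* If the radius kap / M does not fit into D / 2, maximality of F at y0 already bounds r U(x0).
   Otherwise both energy bounds apply on the ball of that radius, and low <= C0 s / r bounds r M. *)
have [hs|hs] := leP (M * (D / 2)) kap.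
  have h : del * (r * conf u x0) <= 2 * kap.
    by rewrite mulrA; apply: (le_trans FD); lra.
  apply: (@le_trans _ _ (2 * kap / del)); first by rewrite ler_pdivlMr // mulrC.
  by rewrite -addrA lerDl; nneg.
pose s := kap / M; have s0 : 0 < s by rewrite divr_gt0.
have sD : s <= D / 2 by rewrite ler_pdivrMr // mulrC ltW.
have sr : s <= r.
  have : del * r <= 1 / 16 * r by rewrite ler_pM2r.
  by lra.
have sM : s * M = kap by rewrite divfK // gt_eqF.
have low_le : low <= I (fun x => P x * kernel (s^-1 *: (x - y0))).
  apply: (ball_lower II I_lower u_cont u1_cont u2_cont u_der u1_der u_pos u_sol b_gt0 K_bound s0 sM).
  move=> z hz; have [h1 h2] := inball z (le_trans hz sD).
  by split => //; have [] := inB z h1.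
have up_le : I (fun x => P x * kernel (s^-1 *: (x - y0))) <= C0 * (s / r).
  apply: up => // z hz; have [h1 h2] := inball z (le_trans hz sD).
  have [h3 _ _] := inB z h1; split => //.
  apply: (le_trans (rho_diff y0 z)).
  have [_ h4 _] := inB y0 y0B.
  have -> : 4 * N * s * r = N * s * (4 * r) by ring.
  apply: ler_pM; [by nneg|by nneg| |]; last by lra.
  by rewrite ler_pM2l.
have h := le_trans low_le up_le.
have h1 : r * M <= C0 * kap / low.
  rewrite ler_pdivlMr // -sM.
  have := ler_wpM2l (ltW (mulr_gt0 r0 M0)) h.
  have -> // : r * M * (C0 * (s / r)) = C0 * (s * M) by field; rewrite gt_eqF.
(* Maximality together with D <= del r: the value at x0 does not exceed that at y0. *)
have h2 : conf u x0 <= M.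
  rewrite -(ler_pM2l dr0); apply: (le_trans FD).
  by rewrite ler_pM2r.
apply: (@le_trans _ _ (r * M)); first by rewrite ler_pM2l.
apply: (le_trans h1); have : 0 <= 2 * kap / del by nneg.
by lra.
Qed.

End BlowUp.

(** * Slow decay *)

Section Core.
Context {R : realType} (m : nat).
Local Notation n := m.+3.
Variables (u K : 'rV[R]_n -> R) (u1 K1 : 'I_n -> 'rV[R]_n -> R)
  (u2 : 'I_n -> 'I_n -> 'rV[R]_n -> R).
Hypotheses (u_cont : continuous u) (u1_cont : forall i, continuous (u1 i))
  (u2_cont : forall i j, continuous (u2 i j)).
Hypotheses (K_cont : continuous K) (K1_cont : forall i, continuous (K1 i)).
Hypotheses (u_der : forall i (x : 'rV[R]_n), is_derive x (e_ i) u (u1 i x))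
  (u1_der : forall i j (x : 'rV[R]_n), is_derive x (e_ j) (u1 i) (u2 i j x))
  (K_der : forall i (x : 'rV[R]_n), is_derive x (e_ i) K (K1 i x)).
Hypothesis u2_sym : forall i j x, u2 i j x = u2 j i x.
Hypothesis u_pos : forall x, 0 < u x.
Hypothesis u_sol : forall x,
  (\sum_(i < n) u2 i i x) + K x * u x `^ sobolev_exp R n = 0.
Variables (a b r1 C' c C : R).
Hypotheses (a_gt0 : 0 < a) (b_gt0 : 0 < b) (r1_ge1 : 1 <= r1) (C'_ge0 : 0 <= C')
  (c_gt0 : 0 < c) (C_ge0 : 0 <= C).
Implicit Types (x y z : 'rV[R]_n) (r s : R) (i j : 'I_n).
Hypothesis K_bound : forall x, r1 ^+ 2 <= rho x -> a <= K x <= b.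
Hypothesis T_bound : forall x, r1 ^+ 2 <= rho x -> `|radial_part u1 x| <= C' * u x.
Hypothesis K_radial : forall x, r1 ^+ 2 <= rho x ->
  - (C * (enorm x * expR (- c * enorm x))) <= radial_part K1 x.
Let N : R := n%:R.

Lemma rho_scale s x : rho (s *: x) = s ^+ 2 * rho x.
Proof. by rewrite /rho mulr_sumr; apply: eq_bigr => i _; rewrite mxE exprMn. Qed.

Lemma enorm_scale s x : 0 <= s -> enorm (s *: x) = s * enorm x.
Proof.
move=> s0; rewrite /enorm -/(rho (s *: x)) -/(rho x) rho_scale.
by rewrite sqrtrM ?sqr_ge0 // sqrtr_sqr ger0_norm.
Qed.

Lemma der_ray r x : is_derive r (1 : R) (fun s => u (s *: x)) (\sum_(i < n) x 0 i * u1 i (r *: x)).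
Proof.
have h := @der_dir R n u u1 (0 + r *: x) x u1_cont u_der.
have h2 := is_derive_line h.
have e : (fun s : R => u (0 + s *: x)) = (fun s => u (s *: x)).
  by apply/funext => s; rewrite add0r.
by rewrite e add0r in h2.
Qed.

Lemma radial_part_scale r x : radial_part u1 (r *: x) = r * \sum_(i < n) x 0 i * u1 i (r *: x).
Proof. by rewrite /radial_part mulr_sumr; apply: eq_bigr => i _; rewrite mxE mulrA. Qed.

(** Along each ray s^(-C') u is nonincreasing from r1 on, because s |du/ds| <= C' u; at s = r1 it is
    at most the maximum of u on a compact cube. *)
Lemma growth : exists2 B, 0 < B & forall x, r1 ^+ 2 <= rho x -> u x <= B * enorm x `^ C'.
Proof.
have [B B0 hB] := continuous_bounded_cube r1 u_cont.
exists B => // x rx; have r10 : 0 < r1 by have := r1_ge1; lra.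
have ex0 : r1 <= enorm x.
  by rewrite -(@ler_pXn2r _ 2) ?nnegrE ?enorm_ge0 ?sqr_enorm // ltW.
pose th := (enorm x)^-1 *: x.
have e0 : 0 < enorm x by lra.
have eth : enorm th = 1 by rewrite enorm_scale ?invr_ge0 ?ltW // mulVf // gt_eqF.
have rth : rho th = 1 by rewrite -sqr_enorm eth expr1n.
have xE : x = enorm x *: th by rewrite scalerA divff ?scale1r // gt_eqF.
pose G s := u (s *: th) * s `^ (- C').
pose dG s := u (s *: th) * (- C' * s `^ (- C' - 1)) +
   s `^ (- C') * \sum_(i < n) th 0 i * u1 i (s *: th).
have DG s : 0 < s -> is_derive s (1 : R) G (dG s).
  by move=> s0; exact: derM (der_ray s th) (is_derive1_powR (- C') s0).
have dG0 s : r1 <= s -> dG s <= 0.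
  move=> rs; have s0 : 0 < s by lra.
  have rs2 : r1 ^+ 2 <= rho (s *: th) by rewrite rho_scale rth mulr1 lerXn2r ?nnegrE // ltW.
  have := le_trans (ler_norm _) (T_bound rs2); rewrite radial_part_scale => h.
  have e : s `^ (- C') = s * s `^ (- C' - 1).
    rewrite -{2}[s]powRr1 ?ltW // -powRD; last by rewrite (gt_eqF s0) implybT.
    by congr (_ `^ _); ring.
  have p0 : 0 <= s `^ (- C' - 1) by exact: powR_ge0.
  have -> : dG s = s `^ (- C' - 1) *
     (s * (\sum_(i < n) th 0 i * u1 i (s *: th)) - C' * u (s *: th)).
    by rewrite /dG e; ring.
  by rewrite mulr_ge0_le0 // subr_le0.
have Gle : G (enorm x) <= G r1.
  have [e|lt] := eqVneq r1 (enorm x); first by rewrite e.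
  have {}lt : r1 < enorm x by rewrite lt_neqAle lt.
  have D1 s : s \in `]r1, enorm x[ -> is_derive s (1 : R) G (dG s).
    by rewrite in_itv /= => /andP[h1 h2]; apply: DG; lra.
  have cG : {within `[r1, enorm x], continuous G}.
    apply: derivable_within_continuous => s; rewrite in_itv /= => /andP[h1 h2].
    by have [] := DG s (lt_le_trans r10 h1).
  have [t tb E] := MVT lt D1 cG.
  move: tb; rewrite in_itv /= => /andP[t1 t2].
  have := dG0 t (ltW t1); move: E lt; set d1 := enorm x - r1 => E lt h.
  have d10 : 0 <= d1 by rewrite subr_ge0 ltW.
  by rewrite -subr_le0 E mulr_le0_ge0.
have G1 : G r1 <= B.
  have h1 : u (r1 *: th) <= B.
    apply: le_trans (ler_norm _) _; apply: hB.
    rewrite normrZ gtr0_norm //; apply: ler_piMr; first exact: ltW.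
    rewrite -(@ler_pXn2r _ 2) ?nnegrE //.
    by rewrite expr1n; apply: le_trans (sqr_norm_le_rho th) _; rewrite rth.
  rewrite /G -[leRHS]mulr1; apply: ler_pM => //; [exact: ltW|exact: powR_ge0|].
  have hC := C'_ge0; rewrite powRN invf_le1 ?powR_gt0 //.
  by rewrite -[1](powRr0 r1) ler_powR.
have := le_trans Gle G1; rewrite /G -xE powRN.
by rewrite ler_pdivrMr ?powR_gt0.
Qed.

Lemma exp_dominates (j : nat) : exists2 D, 0 < D & forall r, 1 <= r -> r ^+ j * expR (- c * r) <= D.
Proof.
have cc := c_gt0; have f0 : 0 < (j.+1)`!%:R :> R by rewrite ltr0n fact_gt0.
exists ((j.+1)`!%:R / c ^+ j.+1); first by rewrite divr_gt0 ?exprn_gt0.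
move=> r r1'; have r0 : 0 < r by lra.
have cr : 0 <= c * r by rewrite mulr_ge0 // ltW.
have h := expR_ge1Dxn j cr.
have h2 : (c * r) ^+ j.+1 / (j.+1)`!%:R <= expR (c * r) by lra.
rewrite mulNr expRN ler_pdivrMr ?expR_gt0 //.
have h3 : c ^+ j.+1 * r ^+ j.+1 <= (j.+1)`!%:R * expR (c * r).
  by move: h2; rewrite ler_pdivrMr // exprMn [_ * _%:R]mulrC.
rewrite mulrAC ler_pdivlMr ?exprn_gt0 // mulrC; apply: le_trans h3.
apply: ler_wpM2l; first by nneg.
by rewrite exprS ler_peMl //; nneg.
Qed.

(** The value at n = 3 is the largest; this replaces a real exponent by an integer one. *)
Lemma critical_exp_le6 : critical_exp R n <= 6.
Proof.
have h := @N_gt2 R n isT; have h3 : 3 <= n%:R :> R by rewrite ler_nat.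
rewrite /critical_exp ler_pdivrMr ?subr_gt0 //; lra.
Qed.

(** Near the origin compactness gives the constant. Far out x.grad K is bounded below by an
    exponentially small negative quantity, while u^q and the inverse weight grow at most
    polynomially. *)
Lemma K_radial_decay : exists2 C4, 0 <= C4 & forall x,
  - (C4 * decay (- (N / 4) - 1) (rho x)) <= radial_part K1 x * u x `^ critical_exp R n.
Proof.
have NN : 0 <= N by [].
have [B B0 hB] := growth.
have CC := C_ge0; have CC' := C'_ge0; have rr1 := r1_ge1.
pose k := Num.bound C'.
have Ck : C' <= k%:R by rewrite ltW // archi_boundP.
pose B1 : R := 1 + B; have B11 : 1 <= B1 by rewrite lerDl ltW.
(* Total power of |x| to be beaten: 1 from the factor |x| in x.grad K, 6 k from u^q with u =
   O(|x|^k), and n + 4 from the inverse weight. *)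
pose j : nat := (1 + k * 6 + (n + 4))%N.
have [D D0 hD] := exp_dominates j.
have cP := cont_P u_cont u_pos.
have cTK := cont_radial_part K1_cont.
have cinv : continuous (fun x : 'rV[R]_n => decay (N / 4 + 1) (rho x)).
  by apply: cont_comp; [exact: cont_decay|exact: cont_rho].
have cg : continuous (fun x => radial_part K1 x * u x `^ critical_exp R n * decay (N / 4 + 1) (rho x)).
  exact: contM (contM cTK cP) cinv.
have [M M0 hM] := continuous_bounded_cube r1 cg.
have dec0 x : 0 < decay (- (N / 4) - 1) (rho x) by exact: powR_gt0 (decay_base_gt0 _).
have decV x : decay (N / 4 + 1) (rho x) * decay (- (N / 4) - 1) (rho x) = 1.
  rewrite /decay -powRD ?(gt_eqF (decay_base_gt0 _)) ?implybT //.
  have z : N / 4 + 1 + (- (N / 4) - 1) = 0 by ring.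
  by rewrite z powRr0.
pose C4 := M + C * B1 ^+ 6 * 2 ^+ (n + 4) * D.
have B10 : 0 <= B1 by lra.
have C40 : 0 <= C * B1 ^+ 6 * 2 ^+ (n + 4) * D by nneg.
exists C4; first by rewrite /C4; nneg.
move=> x; set g := radial_part K1 x * u x `^ critical_exp R n.
(* Multiplying by the inverse weight turns the claim into a lower bound by a constant. *)
suff hs : - C4 <= g * decay (N / 4 + 1) (rho x).
  have := ler_wpM2r (ltW (dec0 x)) hs; rewrite -mulrA decV mulr1 mulNr.
  exact.
have [hx|/ltW hx] := leP (r1 ^+ 2) (rho x); last first.
  have h : `|x| <= r1.
    rewrite -(@ler_pXn2r _ 2) ?nnegrE //; last by lra.
    exact: le_trans (sqr_norm_le_rho x) hx.
  by have := hM x h; rewrite ler_norml /C4 -/g => /andP[h1 _]; lra.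
pose r := enorm x.
have rr : r1 <= r by rewrite -(@ler_pXn2r _ 2) ?nnegrE ?enorm_ge0 ?sqr_enorm //; lra.
have r_1 : 1 <= r by lra.
have r0 : 0 < r by lra.
have rk : 1 <= r ^+ k by exact: exprn_ege1.
have hu : u x <= B1 * r ^+ k.
  apply: (le_trans (hB x hx)); apply: ler_pM => //; [exact: ltW|exact: powR_ge0|by rewrite /B1 lerDr|].
  by rewrite -powR_mulrn; [exact: ler_powR|exact: ltW].
have hP : u x `^ critical_exp R n <= (B1 * r ^+ k) ^+ 6.
  have b1 : 1 <= B1 * r ^+ k by rewrite mulr_ege1.
  apply: (@le_trans _ _ ((B1 * r ^+ k) `^ critical_exp R n)).
    have q0 : 0 < critical_exp R n by exact: crit_gt0.
    by apply: ge0_ler_powR; rewrite ?nnegrE //; [exact: ltW|exact: ltW|lra].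
  rewrite -[leRHS]powR_mulrn; last by lra.
  by apply: ler_powR => //; exact: critical_exp_le6.
have hdec : decay (N / 4 + 1) (rho x) <= (2 * r) ^+ (n + 4).
  have -> : (2 * r) ^+ (n + 4) = ((2 * r) ^+ 4) `^ (N / 4 + 1).
    have r20 : 0 <= 2 * r by lra.
    rewrite -[(2 * r) ^+ 4]powR_mulrn // -powRrM -powR_mulrn //; congr (_ `^ _).
    by rewrite natrD -/N; field.
  apply: ge0_ler_powR; rewrite ?nnegrE; [by nneg|exact: ltW (decay_base_gt0 _)|by apply: exprn_ge0; lra|].
  rewrite -sqr_enorm -/r.
  have r4 : 1 <= r ^+ 2 ^+ 2 by rewrite !exprn_ege1.
  have -> : (2 * r) ^+ 4 = 16 * (r ^+ 2 ^+ 2) by ring.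
  by lra.
have hK := K_radial hx; rewrite -/r in hK.
have P0 : 0 <= u x `^ critical_exp R n by exact: powR_ge0.
have d0 : 0 <= decay (N / 4 + 1) (rho x) by exact: decay_ge0.
have ex0 : 0 <= expR (- c * r) by exact: expR_ge0.
have H1 : u x `^ critical_exp R n * decay (N / 4 + 1) (rho x) <=
    (B1 * r ^+ k) ^+ 6 * (2 * r) ^+ (n + 4) by exact: ler_pM.
have PD0 : 0 <= u x `^ critical_exp R n * decay (N / 4 + 1) (rho x) by exact: mulr_ge0.
have H2 := ler_wpM2r PD0 hK.
have Z0 : 0 <= C * (r * expR (- c * r)) by nneg.
have H3 := ler_wpM2l Z0 H1.
have H4 : C * (r * expR (- c * r)) * ((B1 * r ^+ k) ^+ 6 * (2 * r) ^+ (n + 4)) <=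
   C * B1 ^+ 6 * 2 ^+ (n + 4) * D.
  have -> : C * (r * expR (- c * r)) * ((B1 * r ^+ k) ^+ 6 * (2 * r) ^+ (n + 4)) =
     C * B1 ^+ 6 * 2 ^+ (n + 4) * (r ^+ j * expR (- c * r)).
    by rewrite /j !exprMn -exprM !exprD expr1; ring.
  by rewrite ler_wpM2l ?hD //; nneg.
have -> : g * decay (N / 4 + 1) (rho x) =
    radial_part K1 x * (u x `^ critical_exp R n * decay (N / 4 + 1) (rho x)).
  by rewrite /g mulrA.
apply: le_trans H2; rewrite mulNr lerN2 /C4.
by apply: (le_trans (le_trans H3 H4)); rewrite lerDr ltW.
Qed.

(* The radii with [rho x = 3/2 r^2] place [x] in the middle of the annulus [r^2 <= rho <= 2 r^2]. *)
Lemma slow_decay_core : slow_decay u.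
Proof.
have [I [II Iup Ilow]] := @integral_exists R n.
have [C4 C40 KP] := K_radial_decay.
have K_low x : r1 ^+ 2 <= rho x -> a <= K x by move=> /K_bound/andP[].
have K_nneg x : r1 ^+ 2 <= rho x -> 0 <= K x <= b.
  by move=> /K_bound/andP[h ->]; rewrite andbT (le_trans _ h) // ltW.
have [E0 E00 energy] := annulus_energy II Iup u_cont u1_cont u2_cont K_cont K1_cont
  u_der u1_der K_der u2_sym u_pos u_sol a_gt0 r1_ge1 C'_ge0 C40 K_low T_bound KP.
have [C0 C00 blow] := blow_up II Ilow u_cont u1_cont u2_cont u_der u1_der u_pos u_sol
  b_gt0 r1_ge1 C'_ge0 E00 K_nneg T_bound energy.
pose al : R := (n%:R - 2) / 2.
have N2 := @N_gt2 R n isT.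
have al0 : 0 < al by rewrite divr_gt0 // subr_gt0.
have rr1 := r1_ge1.
exists ((2 * C0) `^ al), (2 * r1); split; first by rewrite powR_gt0 // mulr_gt0.
split; first by rewrite mulr_gt0 //; lra.
move=> x hx; have e0 : 0 < enorm x by lra.
pose r := Num.sqrt (2 / 3 * rho x).
have r2 : r ^+ 2 = 2 / 3 * rho x by rewrite sqr_sqrtr // mulr_ge0 // rho_ge0.
have re : enorm x <= 2 * r.
  rewrite -(@ler_pXn2r _ 2) ?nnegrE ?enorm_ge0 ?mulr_ge0 ?sqrtr_ge0 //.
  by rewrite exprMn r2 sqr_enorm; have := rho_ge0 x; lra.
have rr : r1 <= r by lra.
have := blow r x rr; rewrite r2 => /(_ _)h.
have {}h : r * conf u x <= C0 by apply: h; field.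
have cx : 0 < conf u x by exact: powR_gt0.
have h2 : conf u x * enorm x <= 2 * C0.
  have := ler_wpM2l (ltW cx) re; lra.
have ux : u x = conf u x `^ al.
  rewrite /conf -powRrM /al (_ : _ * _ = 1) ?powRr1 ?ltW //; field.
  by rewrite gt_eqF // subr_gt0.
rewrite -/al powRN ler_pdivlMr ?powR_gt0 // ux -powRM; [|exact: ltW|exact: enorm_ge0].
by apply: ge0_ler_powR => //; rewrite ?nnegrE; nneg.
Qed.

End Core.

(** * Polar coordinates and reduction to the core estimate *)

Section Polar.
Context {R : realType} {n : nat}.
Implicit Types (x : 'rV[R]_n).

Lemma polar_decomposition x : 0 < enorm x ->
  exists2 theta : 'rV[R]_n, unit_sphere theta & x = enorm x *: theta.
Proof.
move=> e0; exists ((enorm x)^-1 *: x).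
  rewrite /unit_sphere /= /enorm.
  have -> : \sum_(i < n) ((enorm x)^-1 *: x) 0 i ^+ 2 = (enorm x)^-1 ^+ 2 * rho x.
    by rewrite /rho mulr_sumr; apply: eq_bigr => i _; rewrite mxE exprMn.
  by rewrite -sqr_enorm -exprMn mulVf ?expr1n ?sqrtr1 // gt_eqF.
by rewrite scalerA divff ?scale1r // gt_eqF.
Qed.

(** Turns both radial hypotheses into statements about x.grad f, the form in which the integral
    identities use them. *)
Lemma radial_derivative_smooth (f : 'rV[R]_n -> R) (r : R) (theta : 'rV[R]_n) : smooth f ->
  r * radial_derivative f r theta = radial_part (fun i => partial i f) (r *: theta).
Proof.
move=> sf.
have c i : continuous (partial i f) by apply: smooth_cont; exact: smooth_partial.
have D i y : is_derive y (e_ i) f (partial i f y) by exact: smooth_der.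
have h := @der_dir R n f (fun i => partial i f) (0 + r *: theta) theta c D.
have h2 := is_derive_line h; rewrite add0r in h2.
have e : (fun s : R => f (0 + s *: theta)) = (fun s => f (s *: theta)).
  by apply/funext => s; rewrite add0r.
rewrite e in h2.
rewrite /radial_derivative derive1E (@derive_val _ _ _ _ _ _ _ h2).
by rewrite /radial_part mulr_sumr; apply: eq_bigr => i _; rewrite mxE mulrA.
Qed.

End Polar.

Theorem theoremA (R : realType) (n : nat) (n_ge3 : (3 <= n)%N)
    (K : 'rV[R]_n -> R) (K_smooth : smooth K)
    (K_bounded : exists (A : set 'rV[R]_n) (a b : R),
       compact A /\ 0 < a /\ 0 < b /\
       forall x : 'rV[R]_n, ~ A x -> a <= K x <= b)
    (K_radial : exists r0 c C : R,
       0 < r0 /\ 0 < c /\ 0 < C /\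
       forall (theta : 'rV[R]_n) (r : R), unit_sphere theta -> r0 <= r ->
         - C * expR (- c * r) <= radial_derivative K r theta)
    (u : 'rV[R]_n -> R) (u_smooth : smooth u)
    (u_pos : forall x : 'rV[R]_n, 0 < u x)
    (u_sol : forall x : 'rV[R]_n,
       laplacian u x + K x * u x `^ ((n%:R + 2) / (n%:R - 2)) = 0)
    (u_radial : exists C' r' : R,
       0 < C' /\ 0 < r' /\
       forall (theta : 'rV[R]_n) (r : R), unit_sphere theta -> r' <= r ->
         r * `|radial_derivative u r theta| <= C' * u (r *: theta)) :
  slow_decay u.
Proof.
(* Makes n - 2 the natural number m + 1, so that U^(n-2) is an integer power. *)
have [m nE] : exists m, n = m.+3.
  by move: n_ge3; case: (n) => [|[|[|m]]] // _; exists m.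
subst n.
case: K_bounded => A [a [b [cA [a0 [b0 hK]]]]].
case: K_radial => r0 [c [C [r00 [c0 [C0 hKr]]]]].
case: u_radial => C' [r' [C'0 [r'0 hur]]].
have [L hL] : exists L : R, forall x, A x -> `|x| <= L.
  have [M [_ hM]] := compact_bounded cA.
  by exists (M + 1) => x Ax; apply: hM => //; rewrite ltrDl.
pose N : R := m.+3%:R; have N1 : 1 <= N by rewrite ler1n.
(* Beyond r1 all far-field hypotheses hold at once. The last summand is large because the compact
   set lies in a cube |x| <= L of the sup norm, where rho can be as large as N L^2. *)
pose r1 : R := 1 + r0 + r' + N * (1 + `|L|).
have L0 := normr_ge0 L.
have NL : 0 <= N * (1 + `|L|) by nneg.
have r11 : 1 <= r1 by rewrite /r1; lra.
have r1r0 : r0 <= r1 by rewrite /r1; lra.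
have r1r' : r' <= r1 by rewrite /r1; lra.
have r1L : N * (1 + `|L|) <= r1 by rewrite /r1; lra.
have far x : r1 ^+ 2 <= rho x -> r1 <= enorm x.
  by move=> h; rewrite -(@ler_pXn2r _ 2) ?nnegrE ?enorm_ge0 ?sqr_enorm //; lra.
have K_bound x : r1 ^+ 2 <= rho x -> a <= K x <= b.
  move=> h; apply: hK => Ax; have h1 := hL x Ax; have h2 := rho_le x.
  have h3 : `|x| ^+ 2 < (1 + `|L|) ^+ 2.
    by rewrite ltrXn2r ?nnegrE //; have := ler_norm L; lra.
  have h4 : rho x < N * (1 + `|L|) ^+ 2.
    by apply: le_lt_trans h2 _; rewrite ltr_pM2l //; lra.
  have h5 : N * (1 + `|L|) ^+ 2 <= (N * (1 + `|L|)) ^+ 2.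
    by rewrite exprMn ler_wpM2r ?sqr_ge0 // expr2 ler_peMl //; lra.
  have h6 : (N * (1 + `|L|)) ^+ 2 <= r1 ^+ 2 by rewrite lerXn2r ?nnegrE //; lra.
  by have := lt_le_trans h4 (le_trans h5 (le_trans h6 h)); rewrite ltxx.
have T_bound x : r1 ^+ 2 <= rho x -> `|radial_part (fun i => partial i u) x| <= C' * u x.
  move=> /far h; have e0 : 0 < enorm x by lra.
  have [th uth xE] := polar_decomposition e0.
  have := hur th (enorm x) uth (le_trans r1r' h).
  rewrite [in radial_part _ x]xE -radial_derivative_smooth // normrM (gtr0_norm e0).
  by rewrite -xE.
have K_rad x : r1 ^+ 2 <= rho x ->
    - (C * (enorm x * expR (- c * enorm x))) <= radial_part (fun i => partial i K) x.
  move=> /far h; have e0 : 0 < enorm x by lra.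
  have [th uth xE] := polar_decomposition e0.
  have := ler_wpM2l (ltW e0) (hKr th (enorm x) uth (le_trans r1r0 h)).
  rewrite radial_derivative_smooth // -xE; apply: le_trans.
  by rewrite le_eqVlt; apply/orP; left; apply/eqP; ring.
have cont_p f i : smooth f -> continuous (partial i f).
  by move=> sf; apply: smooth_cont; exact: smooth_partial.
have sol x : (\sum_(i < m.+3) partial i (partial i u) x) + K x * u x `^ sobolev_exp R m.+3 = 0.
  exact: u_sol.
apply: (@slow_decay_core R m u K (fun i => partial i u) (fun i => partial i K)
  (fun i j => partial j (partial i u)) _ _ _ _ _ _ _ _ _ u_pos sol a b r1 C' c C
  a0 b0 r11 (ltW C'0) c0 (ltW C0) K_bound T_bound K_rad).
- exact: smooth_cont.
- by move=> i; exact: cont_p.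
- by move=> i j; apply: cont_p; exact: smooth_partial.
- exact: smooth_cont.
- by move=> i; exact: cont_p.
- by move=> i x; exact: smooth_der.
- by move=> i j x; apply: smooth_der; exact: smooth_partial.
- by move=> i x; exact: smooth_der.
- by move=> i j x; exact: smooth_schwarz.
Qed.
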